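(* Let $\mathcal{T}=(V,E)$ be a rootless and leafless directed tree with countably infinite vertex set $V$, let $\phi(x)$ denote the parent of $x\in V$, and let $\mu$ be a measure on $2^V$ with $0<\mu(\{x\})<\infty$ for every $x\in V$. Let $\{G_m\}_{m\in\mathbb{Z}}$ be a partition of $V$ such that $G_{m+1}=\bigsqcup_{x\in G_m}\phi^{-1}(\{x\})$ for all $m\in\mathbb{Z}$. Assume $\{\kappa_m\}_{m\in\mathbb{Z}}$ are positive integers and $\{\alpha_m\}_{m\in\mathbb{Z}}$ are positive reals such that $\phi^{-1}(\{x\})$ has exactly $\kappa_m$ elements and $\mu(\{x\})=\alpha_m$ for all $x\in G_m$, $m\in\mathbb{Z}$. Define $\hat\kappa_m=\prod_{j=0}^{m-1}\kappa_j$ for $m\ge1$, $\hat\kappa_0=1$, and $\hat\kappa_m=\big(\prod_{j=1}^{-m}\kappa_{-j}\big)^{-1}$ for $m\le-1$. Then $\mathcal{D}^\infty(C_\phi)=\bigcap_{n\ge0}\mathcal{D}(C_\phi^n)$ is dense in $L^2(\mu)$ and the following are equivalent: (i) $C_\phi$ is subnormal; (ii) $\{\|C_\phi^nf\|^2\}_{n=0}^\infty$ is a Stieltjes moment sequence for every $f\in\mathcal{D}^\infty(C_\phi)$; (iii) $\{\mathsf{h}_{\phi^n}(x)\}_{n=0}^\infty$ is a Stieltjes moment sequence for every $x\in V$; (iv) $\{\alpha_m\hat\kappa_m\}_{m\in\mathbb{Z}}$ is a two-sided Stieltjes moment sequence.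
   Context: A directed tree is a connected directed graph without circuits in which every vertex has at most one parent; rootless means every vertex has a parent, leafless means every vertex has at least one child. $C_\phi$ is the composition operator in $L^2(\mu)$: $\mathcal{D}(C_\phi)=\{f\in L^2(\mu):f\circ\phi\in L^2(\mu)\}$, $C_\phi f=f\circ\phi$. $\mathsf{h}_{\phi^n}(x)=\mu(\phi^{-n}(\{x\}))/\mu(\{x\})$, where $\phi^n$ is the $n$-fold composition. A sequence $\{a_n\}_{n\ge0}$ is a Stieltjes moment sequence if $a_n=\int_0^\infty s^n\nu(\mathrm{d}s)$ for some Borel measure $\nu$ on $[0,\infty)$. A two-sided sequence $\{a_n\}_{n\in\mathbb{Z}}\subseteq[0,\infty)$ is a two-sided Stieltjes moment sequence if there is a Borel measure $\nu$ on $(0,\infty)$ with $a_n=\int_{(0,\infty)}s^n\nu(\mathrm{d}s)$ for all $n\in\mathbb{Z}$. Subnormal: $\mathcal{D}(S)\subseteq\mathcal{D}(N)$ and $S=N$ on $\mathcal{D}(S)$ for some normal $N$ in a larger Hilbert space. *)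

(* Defs.v *)
From HB Require Import structures.
From mathcomp Require Import all_boot all_order all_algebra.
From mathcomp Require Import all_classical all_reals.
From mathcomp Require Import topology normedtype sequences esum measure
  lebesgue_measure lebesgue_integral.
From mathcomp Require Import complex.

Set Implicit Arguments.
Unset Strict Implicit.
Unset Printing Implicit Defensive.

Import Order.TTheory GRing.Theory Num.Theory.
Local Open Scope classical_set_scope.
Local Open Scope ring_scope.

(* Directed graphs / directed trees (E u v : (u,v) is an edge, u is the parent of v) *)

Section Trees.
Variable V : Type.
Variable E : V -> V -> Prop.

Definition no_loops : Prop := forall u, ~ E u u.

Definition connected_graph : Prop :=
  forall u v, u <> v -> exists (n : nat) (s : nat -> V),
    s 0%N = u /\ s n = v /\
    forall k, (k < n)%N -> E (s k) (s k.+1) \/ E (s k.+1) (s k).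

Definition has_circuit : Prop :=
  exists (n : nat) (s : nat -> V), (2 <= n)%N /\
    (forall i j, (i < n)%N -> (j < n)%N -> s i = s j -> i = j) /\
    (forall j, (j.+1 < n)%N -> E (s j) (s j.+1)) /\
    E (s n.-1) (s 0%N).

Definition at_most_one_parent : Prop :=
  forall u u' v, E u v -> E u' v -> u = u'.

Definition directed_tree : Prop :=
  no_loops /\ connected_graph /\ ~ has_circuit /\ at_most_one_parent.

Definition rootless : Prop := forall v, exists u, E u v.
Definition leafless : Prop := forall u, exists v, E u v.
End Trees.

Section L2.
Variables (R : realType) (V : choiceType).

Definition mu (w : V -> R) (A : set V) : \bar R := (\esum_(x in A) (w x)%:E)%E.

Definition L2norm2 (w : V -> R) (f : V -> R[i]) : \bar R :=
  (\esum_(x in [set: V]) ((ComplexField.Normc.normc (f x)) ^+ 2 * w x)%:E)%E.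

Definition inL2 (w : V -> R) (f : V -> R[i]) : Prop := (L2norm2 w f < +oo)%E.

Definition dom_Cpow (w : V -> R) (phi : V -> V) (n : nat) (f : V -> R[i]) : Prop :=
  forall k, (k <= n)%N -> inL2 w (f \o iter k phi).

Definition dom_inf (w : V -> R) (phi : V -> V) (f : V -> R[i]) : Prop :=
  forall n, dom_Cpow w phi n f.

Definition h_pow (w : V -> R) (phi : V -> V) (n : nat) (x : V) : \bar R :=
  (mu w [set y | iter n phi y = x] * ((w x)^-1)%:E)%E.
End L2.

Record hilbert_structure (R : realType) (K : lmodType R[i]) := HilbertStructure {
  ip : K -> K -> R[i];
  ip_linear : forall (a : R[i]) (x y z : K), ip (a *: x + y) z = a * ip x z + ip y z;
  ip_conj : forall x y, ip y x = conjc (ip x y);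
  ip_pos : forall x, 0 <= ip x x;
  ip_def : forall x, ip x x = 0 -> x = 0;
  ip_complete : forall u : nat -> K,
    (forall e : R, 0 < e -> exists N : nat, forall m n, (N <= m)%N -> (N <= n)%N ->
        complex.Re (ip (u m - u n) (u m - u n)) < e) ->
    exists l : K, forall e : R, 0 < e -> exists N : nat, forall n, (N <= n)%N ->
        complex.Re (ip (u n - l) (u n - l)) < e
}.

Section Operators.
Variables (R : realType) (K : lmodType R[i]) (H : hilbert_structure K).

Definition hnorm2 (x : K) : R := complex.Re (ip H x x).

Definition hconverges (u : nat -> K) (l : K) : Prop :=
  forall e : R, 0 < e -> exists N : nat, forall n, (N <= n)%N -> hnorm2 (u n - l) < e.

(* operators in K are given by their graphs  T x y  <->  x in D(T) /\ T x = y *)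
Definition linear_operator (T : K -> K -> Prop) : Prop :=
  T 0 0 /\
  (forall x y y', T x y -> T x y' -> y = y') /\
  (forall (a : R[i]) x y x' y', T x y -> T x' y' -> T (a *: x + x') (a *: y + y')).

Definition densely_defined (T : K -> K -> Prop) : Prop :=
  forall x (e : R), 0 < e -> exists y z, T y z /\ hnorm2 (x - y) < e.

Definition closed_operator (T : K -> K -> Prop) : Prop :=
  forall (u v : nat -> K) x y, (forall n, T (u n) (v n)) ->
    hconverges u x -> hconverges v y -> T x y.

Definition adjoint (T : K -> K -> Prop) : K -> K -> Prop :=
  fun y z => forall x w, T x w -> ip H w y = ip H x z.

Definition op_comp (A B : K -> K -> Prop) : K -> K -> Prop :=
  fun x z => exists y, B x y /\ A y z.

Definition normal_operator (N : K -> K -> Prop) : Prop :=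
  linear_operator N /\ densely_defined N /\ closed_operator N /\
  forall x z, op_comp (adjoint N) N x z <-> op_comp N (adjoint N) x z.
End Operators.

(* C_phi in L^2(mu) is subnormal: there are a Hilbert space K containing L^2(mu)
   (via a linear isometric embedding J) and a normal operator N in K with
   D(C_phi) in D(N) and C_phi = N on D(C_phi). *)
Definition subnormal_Cphi (R : realType) (V : choiceType) (w : V -> R) (phi : V -> V) : Prop :=
  exists (K : lmodType R[i]) (H : hilbert_structure K) (J : (V -> R[i]) -> K)
         (N : K -> K -> Prop),
    (forall (a : R[i]) f g, inL2 w f -> inL2 w g ->
        J (fun x => a * f x + g x) = a *: J f + J g) /\
    (forall f, inL2 w f -> ((hnorm2 H (J f))%:E = L2norm2 w f)%E) /\
    normal_operator H N /\
    (forall f, inL2 w f -> inL2 w (f \o phi) -> N (J f) (J (f \o phi))).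

Definition stieltjes_moment (R : realType) (a : nat -> \bar R) : Prop :=
  exists nu : {measure set R -> \bar R},
    forall n, a n = (\int[nu]_(s in [set s : R | (0 <= s)%R]) (s ^+ n)%R%:E)%E.

Definition two_sided_stieltjes (R : realType) (a : int -> R) : Prop :=
  (forall m, 0 <= a m) /\
  exists nu : {measure set R -> \bar R},
    forall m : int, (a m)%:E = (\int[nu]_(s in [set s : R | (0 < s)%R]) (s ^ m)%R%:E)%E.

Definition kappa_hat (R : realType) (kappa : int -> nat) (m : int) : R :=
  match m with
  | Posz k => \prod_(j < k) (kappa (Posz j))%:R
  | Negz k => (\prod_(j < k.+1) (kappa (- Posz j.+1))%:R)^-1
  end.

(* Main.v *)
(** Put [beta m = alpha m * kappa_hat m]; all four conditions amount to the
    nonnegativity of the Hankel forms [\sum c_i c_j beta (m + i + j)], [m : int].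
    A vertex [x] of level [m] has [h_pow n x = beta (m + n) / beta m], so (iii)
    gives this positivity, and (ii) gives (iii) by testing on the point mass at
    [x]; (i) gives it because, for [N] normal, the Hankel form of [||N^k v||^2] is
    [||\sum c_i (N^* N)^i v||^2]. Conversely, positivity yields a two-sided
    representing measure [nu] (finite quadratures approximating ever more moments, and
    a limit along an ultrafilter), hence (iv) and (iii); superposing the
    representing measures of the [h_pow _ x] with weights [|f x|^2 w x] gives (ii).

    For (iv) => (i), let [rho] be the measure on [V * R] given on [{x} * R] by
    [nu / kappa_hat (level x)]. It is preserved by [(x, t) |-> (phi x, t)], and
    [f |-> t^(level x / 2) f x] embeds [L^2(mu)] in [L^2(rho)] so that [C_phi] becomes
    a restriction of [A U], where [A] is the multiplication by [sqrt t] and the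
    isometry [U] is the composition with that map. As [A] is self-adjoint and
    commutes with [U], dilating [U] to a unitary turns [A U] into a normal operator. *)

Require Import Defs.
From HB Require Import structures.
From mathcomp Require Import all_boot all_order all_algebra.
From mathcomp Require Import all_classical all_reals.
From mathcomp Require Import topology normedtype sequences esum measure
  lebesgue_measure lebesgue_integral.
From mathcomp Require Import complex.
From mathcomp Require Import realfun exp numfun
  measurable_realfun ereal spectral.
From mathcomp Require Import ring lra zify.
Set Implicit Arguments.
Unset Strict Implicit.
Unset Printing Implicit Defensive.
Import Order.TTheory GRing.Theory Num.Theory.
Import numFieldNormedType.Exports.
Local Open Scope classical_set_scope.
Local Open Scope ring_scope.

(** * Hilbert spaces and normal operators *)

(** The representing measure of a single sequence [h_pow _ x] need not be unique, so measures
    attached to different vertices cannot simply be glued along the tree. Nonnegativity of the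
    Hankel forms bypasses this: it is checked level by level and, every integer level being
    inhabited, yields one measure [nu] that serves all levels. Forms with consecutive shifts [m] and
    [m + 1] put the nodes of the quadratures on the positive half-line; the moments of order [j - 1]
    and [j + 1] control [s ^ j] near 0 and near infinity, so no mass is lost in the limit. The
    operators are unbounded. For a normal [N] only the equality of the graphs of [N^* N] and [N N^*]
    is given, and vectors of the domain of [N] must first be shown to lie in that of [N^*].
    Conversely, the dilation has to extend [C_phi] on its whole domain. With the weight
    [1 / kappa_hat] the children of a vertex share its mass equally; the half power of [t] comes
    from [alpha m = \int t ^ m / kappa_hat m], which makes the embedding isometric. *)

Section InnerProduct.
Variables (R : realType) (K : lmodType R[i]) (H : hilbert_structure K).
Implicit Types (x y z : K) (a : R[i]).

Lemma ipDl x y z : ip H (x + y) z = ip H x z + ip H y z.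
Proof. by rewrite -{1}[x]scale1r ip_linear mul1r. Qed.

Lemma ip0l z : ip H 0 z = 0.
Proof. by apply: (@addrI _ (ip H 0 z)); rewrite -ipDl !addr0. Qed.

Lemma ipZl a x z : ip H (a *: x) z = a * ip H x z.
Proof. by rewrite -[a *: x]addr0 ip_linear ip0l addr0. Qed.

Lemma ipNl x z : ip H (- x) z = - ip H x z.
Proof. by rewrite -scaleN1r ipZl mulN1r. Qed.

Lemma ipBl x y z : ip H (x - y) z = ip H x z - ip H y z.
Proof. by rewrite ipDl ipNl. Qed.

Lemma ipDr x y z : ip H x (y + z) = ip H x y + ip H x z.
Proof. by rewrite !(ip_conj H _ x) ipDl raddfD. Qed.

Lemma ip0r x : ip H x 0 = 0.
Proof. by rewrite ip_conj ip0l raddf0. Qed.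

Lemma ipZr a x y : ip H x (a *: y) = conjc a * ip H x y.
Proof. by rewrite !(ip_conj H _ x) ipZl rmorphM. Qed.

Lemma ipNr x y : ip H x (- y) = - ip H x y.
Proof. by rewrite !(ip_conj H _ x) ipNl raddfN. Qed.

Lemma ipBr x y z : ip H x (y - z) = ip H x y - ip H x z.
Proof. by rewrite ipDr ipNr. Qed.

Lemma ip_hnorm2 x : ip H x x = (hnorm2 H x)%:C%C.
Proof.
rewrite /hnorm2; have := ip_pos H x.
by case: (ip H x x) => u v; rewrite lecE /= => /andP[/eqP-> _].
Qed.

Lemma hnorm2_ge0 x : 0 <= hnorm2 H x.
Proof. by have := ip_pos H x; rewrite ip_hnorm2 lecR. Qed.

Lemma hnorm20 : hnorm2 H 0 = 0.
Proof. by rewrite /hnorm2 ip0l. Qed.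

Lemma hnorm2_eq0 x : hnorm2 H x = 0 -> x = 0.
Proof. by move=> e; apply: (ip_def (h := H)); rewrite ip_hnorm2 e. Qed.

Lemma hnorm2Z a x : hnorm2 H (a *: x) = ComplexField.Normc.normc a ^+ 2 * hnorm2 H x.
Proof.
rewrite /hnorm2 ipZl ipZr ip_hnorm2; case: a => u v /=.
rewrite sqr_sqrtr ?addr_ge0 ?sqr_ge0//; ring.
Qed.

Lemma hnorm2N x : hnorm2 H (- x) = hnorm2 H x.
Proof. by rewrite /hnorm2 ipNl ipNr opprK. Qed.

Lemma hnorm2B x y : hnorm2 H (x - y) = hnorm2 H (y - x).
Proof. by rewrite -hnorm2N opprB. Qed.

Lemma hnorm2D x y :
  hnorm2 H (x + y) = hnorm2 H x + hnorm2 H y + 2 * complex.Re (ip H x y).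
Proof.
rewrite /hnorm2 ipDl !ipDr !raddfD /= (ip_conj H x y).
case: (ip H x y) => u v /=; ring.
Qed.

Lemma parallelogram x y :
  hnorm2 H (x + y) + hnorm2 H (x - y) = 2 * hnorm2 H x + 2 * hnorm2 H y.
Proof. rewrite !hnorm2D ipNr hnorm2N raddfN /=; ring. Qed.

Lemma hnorm2_double x : hnorm2 H (x + x) = 4 * hnorm2 H x.
Proof. rewrite hnorm2D -/(hnorm2 H x); ring. Qed.

Lemma hnorm2D_le x y : hnorm2 H (x + y) <= 2 * hnorm2 H x + 2 * hnorm2 H y.
Proof. by rewrite -parallelogram lerDl hnorm2_ge0. Qed.

(** At the vector [x + t <x,y> y] with [t] real, the squared norm is a real quadratic in [t]; its
    nonnegativity at the minimum [t = - 1 / ||y||^2] is the inequality. *)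
Lemma cauchy_schwarz x y :
  ComplexField.Normc.normc (ip H x y) ^+ 2 <= hnorm2 H x * hnorm2 H y.
Proof.
set z := ip H x y; set n2 := _ ^+ 2.
have hn2 : n2 = complex.Re z ^+ 2 + complex.Im z ^+ 2.
  by rewrite /n2; case: (z) => u v /=; rewrite sqr_sqrtr ?addr_ge0 ?sqr_ge0.
have key (t : R) : 0 <= hnorm2 H x + 2 * t * n2 + t ^+ 2 * n2 * hnorm2 H y.
  suff -> : hnorm2 H x + 2 * t * n2 + t ^+ 2 * n2 * hnorm2 H y
            = hnorm2 H (x + (t%:C%C * z) *: y) by exact: hnorm2_ge0.
  rewrite hnorm2D hnorm2Z ipZr -/z hn2.
  have -> : ComplexField.Normc.normc (t%:C%C * z) ^+ 2
          = t ^+ 2 * (complex.Re z ^+ 2 + complex.Im z ^+ 2).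
    by case: (z) => u v /=; rewrite sqr_sqrtr ?addr_ge0 ?sqr_ge0//; ring.
  by case: (z) => u v /=; ring.
have n2_ge0 : 0 <= n2 by exact: sqr_ge0.
have [n20|n2N0] := eqVneq n2 0.
  by rewrite n20 mulr_ge0 ?hnorm2_ge0.
have n2_gt0 : 0 < n2 by rewrite lt_neqAle eq_sym n2N0.
have [y0|yN0] := eqVneq (hnorm2 H y) 0.
  (* For [y] of norm 0 the quadratic is affine in [t]; this [t] gives it the value -1. *)
  have := key (- (hnorm2 H x + 1) / (2 * n2)).
  have -> : 2 * (- (hnorm2 H x + 1) / (2 * n2)) * n2 = - (hnorm2 H x + 1) by field.
  by rewrite y0; lra.
have y_gt0 : 0 < hnorm2 H y by rewrite lt_neqAle eq_sym yN0 hnorm2_ge0.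
have := key (- (hnorm2 H y)^-1).
have -> : hnorm2 H x + 2 * - (hnorm2 H y)^-1 * n2
   + (- (hnorm2 H y)^-1) ^+ 2 * n2 * hnorm2 H y
   = hnorm2 H x - n2 / hnorm2 H y by field.
by rewrite subr_ge0 ler_pdivrMr.
Qed.

Lemma cvg_ipl y (u : nat -> K) x (e : R) : hconverges H u x -> 0 < e ->
  exists N : nat, forall n, (N <= n)%N ->
    ComplexField.Normc.normc (ip H (u n) y - ip H x y) ^+ 2 < e.
Proof.
move=> ux e0; have [|N hN] := ux (e / (hnorm2 H y + 1)).
  by rewrite divr_gt0// ltr_wpDl// hnorm2_ge0.
exists N => n /hN h; rewrite -ipBl.
apply: le_lt_trans (cauchy_schwarz _ _) _.
have y0 := hnorm2_ge0 y.
have : hnorm2 H (u n - x) * (hnorm2 H y + 1) < e.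
  by rewrite -ltr_pdivlMr// ltr_wpDl.
have := hnorm2_ge0 (u n - x); nra.
Qed.

(** Continuity of the inner product, in the form in which an identity defining an adjoint passes to
    the limit on both sides. *)
Lemma ip_lim_eq (u v : nat -> K) x y z t : hconverges H u x -> hconverges H v y ->
  (forall n, ip H (u n) z = ip H (v n) t) -> ip H x z = ip H y t.
Proof.
move=> ux vy uv; apply/eqP; rewrite -subr_eq0; apply/eqP.
apply: ComplexField.Normc.eq0_normc.
apply/eqP; rewrite -sqrf_eq0 eq_le sqr_ge0 andbT; apply/ler_addgt0Pl => e e0.
rewrite addr0.
have [|N hN] := cvg_ipl z ux (e := e / 4); first by rewrite divr_gt0.
have [|M hM] := cvg_ipl t vy (e := e / 4); first by rewrite divr_gt0.
have /hN := leq_maxl N M; have /hM := leq_maxr N M; rewrite uv.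
set w := ip H (v _) t; set a := ip H x z; set b := ip H y t.
case: a b w => [a1 a2] [b1 b2] [w1 w2] /=.
rewrite !sqr_sqrtr ?addr_ge0 ?sqr_ge0//.
have := sqr_ge0 ((w1 - b1) + (w1 - a1)); have := sqr_ge0 ((w2 - b2) + (w2 - a2)).
nra.
Qed.

Lemma hconverges_uniq (u : nat -> K) x y :
  hconverges H u x -> hconverges H u y -> x = y.
Proof.
move=> ux uy; apply/eqP; rewrite -subr_eq0; apply/eqP; apply: hnorm2_eq0.
rewrite /hnorm2.
by rewrite ipBl (ip_lim_eq (z := x - y) (t := x - y) ux uy)// subrr.
Qed.

Definition hcauchy (u : nat -> K) := forall e : R, 0 < e -> exists N : nat,
  forall m n, (N <= m)%N -> (N <= n)%N -> hnorm2 H (u m - u n) < e.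

Lemma hconverges_cauchy (u : nat -> K) x : hconverges H u x -> hcauchy u.
Proof.
move=> ux e e0; have [|N hN] := ux (e / 4); first by rewrite divr_gt0.
exists N => m n /hN hm /hN hn.
rewrite -(subrKA x); apply: le_lt_trans (hnorm2D_le _ _) _.
by rewrite (hnorm2B x); lra.
Qed.

Definition linear_subspace (S : K -> Prop) :=
  S 0 /\ forall a x y, S x -> S y -> S (a *: x + y).

(** As [S] may fail to be closed, [l] is the projection on its closure, and the minimising sequence
    is returned along with it: each application recovers what it needs about [l] from that
    sequence. *)
Lemma projection (S : K -> Prop) x : linear_subspace S ->
  exists (u : nat -> K) l, [/\ forall n, S (u n), hconverges H u l &
    forall s, S s -> ip H (x - l) s = 0].
Proof.
move=> [S0 SL].
pose D := [set hnorm2 H (x - s) | s in S].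
have hiD : has_inf D.
  split; first by exists (hnorm2 H (x - 0)); exists 0.
  by exists 0 => _ [s _ <-]; exact: hnorm2_ge0.
set d := inf D.
have dle s : S s -> d <= hnorm2 H (x - s).
  by move=> Ss; apply: ge_inf; [case: hiD|exists s].
have /choice[u hu] (n : nat) : exists s, S s /\ hnorm2 H (x - s) < d + n.+1%:R^-1.
  have [|_ [s Ss <-] hs] := @inf_adherent _ D n.+1%:R^-1 _ hiD.
    by rewrite invr_gt0 ltr0n.
  by exists s.
have Su n : S (u n) by case: (hu n).
have cu : hcauchy u.
  move=> e e0.
  have [N hN] : exists N : nat, N.+1%:R^-1 < e / 4.
    exists (Num.truncn (e / 4)^-1).
    by rewrite invf_plt ?posrE ?ltr0n ?divr_gt0// truncnS_gt.
  exists N => m n Nm Nn.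
  (* The midpoint is at squared distance at least [d] from [x], so the parallelogram law bounds
     [||u m - u n||^2] by [4 (d + e / 4) - 4 d = e]. *)
  have mid : S (2^-1 *: (u m + u n)).
    rewrite scalerDr; apply: (SL) => //; rewrite -[_ *: _]addr0; exact: (SL).
  have h1 := parallelogram (x - u m) (x - u n).
  have e1 : x - u m + (x - u n) = (x - 2^-1 *: (u m + u n)) + (x - 2^-1 *: (u m + u n)).
    rewrite addrACA [RHS]addrACA; congr (_ + _).
    rewrite -opprD -[in RHS]opprD; congr (- _).
    by rewrite -scalerDl -[X in (X + X) *: _]mul1r -splitr scale1r.
  have e2 : x - u m - (x - u n) = u n - u m.
    by rewrite opprB addrC addrA addrNK.
  rewrite e1 e2 hnorm2_double in h1.
  have hs (k : nat) : (N <= k)%N -> hnorm2 H (x - u k) < d + e / 4.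
    move=> Nk; apply: lt_trans (hu k).2 _; rewrite ltrD2l.
    by apply: le_lt_trans hN; rewrite lef_pV2 ?posrE ?ltr0n// ler_nat.
  have hm := hs _ Nm; have hn := hs _ Nn; have hd := dle _ mid.
  rewrite hnorm2B; lra.
have [l ul] := ip_complete cu.
exists u, l; split => // s Ss.
(* First variation at [l]: the squared distance from [x] to [u n - c s] is at least [d], while that
   to [u n] tends to [d]. *)
have q (c : R[i]) : 0 <= 2 * complex.Re (conjc c * ip H (x - l) s)
    + ComplexField.Normc.normc c ^+ 2 * hnorm2 H s.
  rewrite -ipZr -hnorm2Z; set t := c *: s.
  have St : S t by rewrite /t -[_ *: _]addr0; exact: (SL).
  apply/ler_addgt0Pr => e e0.
  have [|N hN] := cvg_ipl t ul (e := (e / 4) ^+ 2).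
    by rewrite exprn_gt0// divr_gt0.
  have [M hM] : exists M : nat, M.+1%:R^-1 < e / 4.
    exists (Num.truncn (e / 4)^-1).
    by rewrite invf_plt ?posrE ?ltr0n ?divr_gt0// truncnS_gt.
  pose n := maxn N M.
  have := hN n (leq_maxl _ _); have [_] := hu n.
  have hMn : n.+1%:R^-1 <= M.+1%:R^-1 :> R.
    by rewrite lef_pV2 ?posrE ?ltr0n// ler_nat ltnS leq_maxr.
  have Sut : S (u n - t) by rewrite addrC -scaleN1r; apply: (SL).
  have := dle _ Sut; rewrite opprB addrCA addrC (hnorm2D (x - u n)) !ipBl.
  case: (ip H (u n) t) (ip H l t) (ip H x t) => [a1 a2] [b1 b2] [c1 c2] /=.
  rewrite sqr_sqrtr; last by rewrite addr_ge0 ?sqr_ge0.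
  move=> h1 h2 h3.
  have h4 : `|a1 - b1| < e / 4.
    rewrite -(@ltr_pXn2r _ 2)// ?nnegrE ?divr_ge0 ?(ltW e0)//.
    rewrite real_normK ?num_real//; have := sqr_ge0 (a2 - b2); lra.
  have h2' := lt_le_trans h2 (lerD (lexx d) (ltW (le_lt_trans hMn hM))).
  move: h4; rewrite ltr_norml => /andP[h4 h5]; lra.
set z := ip H (x - l) s in q *.
have n2 : ComplexField.Normc.normc z ^+ 2 = complex.Re z ^+ 2 + complex.Im z ^+ 2.
  by case: (z) => a b /=; rewrite sqr_sqrtr ?addr_ge0 ?sqr_ge0.
apply: ComplexField.Normc.eq0_normc; apply/eqP; rewrite -sqrf_eq0 n2.
set nz := _ + _ in n2 *.
have nz0 : 0 <= nz by rewrite -n2 sqr_ge0.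
have s0 := hnorm2_ge0 s.
(* With [k = 1 / (||s||^2 + 1)] and [c = - k z] the variation equals [- (k + k^2) |z|^2], which
   forces [z = 0]. *)
have := q (- ((hnorm2 H s + 1)^-1%:C%C) * z).
have -> : ComplexField.Normc.normc (- (hnorm2 H s + 1)^-1%:C%C * z) ^+ 2
  = (hnorm2 H s + 1)^-1 ^+ 2 * nz.
  rewrite /nz; case: (z) => a b /=; rewrite sqr_sqrtr ?addr_ge0 ?sqr_ge0//; ring.
have -> : complex.Re (conjc (- (hnorm2 H s + 1)^-1%:C%C * z) * z)
  = - (hnorm2 H s + 1)^-1 * nz.
  rewrite /nz; case: (z) => a b /=; ring.
set k := (_)^-1; have k0 : 0 < k by rewrite invr_gt0 ltr_wpDl.
have kE : k * hnorm2 H s = 1 - k by rewrite /k; field; rewrite gt_eqF// ltr_wpDl.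
have -> : 2 * (- k * nz) + k ^+ 2 * nz * hnorm2 H s = - (k + k ^+ 2) * nz.
  by have -> : k ^+ 2 * nz * hnorm2 H s = k * nz * (k * hnorm2 H s); [ring|rewrite kE; ring].
rewrite mulNr oppr_ge0 pmulr_rle0 ?addr_gt0 ?exprn_gt0// => ?.
by rewrite eq_le nz0 andbT.
Qed.

End InnerProduct.

(** * Direct sums of Hilbert spaces, for graphs and for dilations *)

Section ProductSpace.
Variables (R : realType) (K1 K2 : lmodType R[i]).
Variables (H1 : hilbert_structure K1) (H2 : hilbert_structure K2).

Let ipp (x y : K1 * K2) := ip H1 x.1 y.1 + ip H2 x.2 y.2.

Let ipp_linear (a : R[i]) (x y z : K1 * K2) : ipp (a *: x + y) z = a * ipp x z + ipp y z.
Proof. rewrite /ipp /= !ip_linear; ring. Qed.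

Let ipp_conj x y : ipp y x = conjc (ipp x y).
Proof. by rewrite /ipp (ip_conj H1) (ip_conj H2) raddfD. Qed.

Let ipp_pos x : 0 <= ipp x x.
Proof. by rewrite addr_ge0 ?ip_pos. Qed.

Let ipp_def x : ipp x x = 0 -> x = 0.
Proof.
move=> /eqP; rewrite paddr_eq0 ?ip_pos// => /andP[/eqP h1 /eqP h2].
by case: x h1 h2 => x1 x2 /= /ip_def -> /ip_def ->.
Qed.

Let ippE x : complex.Re (ipp x x) = hnorm2 H1 x.1 + hnorm2 H2 x.2.
Proof. by rewrite /ipp raddfD. Qed.

Let ipp_complete (u : nat -> K1 * K2) :
    (forall e : R, 0 < e -> exists N : nat, forall m n, (N <= m)%N -> (N <= n)%N ->
        complex.Re (ipp (u m - u n) (u m - u n)) < e) ->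
    exists l, forall e : R, 0 < e -> exists N : nat, forall n, (N <= n)%N ->
        complex.Re (ipp (u n - l) (u n - l)) < e.
Proof.
move=> cu.
have [|l1 hl1] := @ip_complete _ _ H1 (fun n => (u n).1).
  move=> e /cu[N hN]; exists N => m n Nm Nn; have := hN m n Nm Nn.
  by rewrite ippE /=; apply: le_lt_trans; rewrite lerDl hnorm2_ge0.
have [|l2 hl2] := @ip_complete _ _ H2 (fun n => (u n).2).
  move=> e /cu[N hN]; exists N => m n Nm Nn; have := hN m n Nm Nn.
  by rewrite ippE /=; apply: le_lt_trans; rewrite lerDr hnorm2_ge0.
exists (l1, l2) => e e0.
have [|N hN] := hl1 (e / 2); first by rewrite divr_gt0.
have [|M hM] := hl2 (e / 2); first by rewrite divr_gt0.
exists (maxn N M) => n; rewrite geq_max => /andP[/hN h1 /hM h2].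
by rewrite ippE /hnorm2 /= [ltRHS]splitr ltrD.
Qed.

Definition prod_hilbert : hilbert_structure (K1 * K2)%type :=
  HilbertStructure ipp_linear ipp_conj ipp_pos ipp_def ipp_complete.

Lemma ip_prod x y : ip prod_hilbert x y = ip H1 x.1 y.1 + ip H2 x.2 y.2.
Proof. by []. Qed.

Lemma hnorm2_prod x : hnorm2 prod_hilbert x = hnorm2 H1 x.1 + hnorm2 H2 x.2.
Proof. by rewrite /hnorm2 ip_prod raddfD. Qed.

Lemma hconverges_fst u l : hconverges prod_hilbert u l ->
  hconverges H1 (fun n => (u n).1) l.1.
Proof.
move=> ul e /ul[N hN]; exists N => n /hN; rewrite hnorm2_prod; apply: le_lt_trans.
by rewrite lerDl hnorm2_ge0.
Qed.

Lemma hconverges_snd u l : hconverges prod_hilbert u l ->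
  hconverges H2 (fun n => (u n).2) l.2.
Proof.
move=> ul e /ul[N hN]; exists N => n /hN; rewrite hnorm2_prod; apply: le_lt_trans.
by rewrite lerDr hnorm2_ge0.
Qed.

End ProductSpace.

(** * Adjoints, cores, and the Hankel forms of a normal operator *)

Section NormalOperators.
Variables (R : realType) (K : lmodType R[i]) (H : hilbert_structure K).
Implicit Types (T A N : K -> K -> Prop).

Lemma ip_dense_eq0 T y : densely_defined H T ->
  (forall x w, T x w -> ip H x y = 0) -> y = 0.
Proof.
move=> dT y0; apply: hnorm2_eq0; apply/eqP; rewrite eq_le hnorm2_ge0 andbT.
apply/ler_addgt0Pl => e e0; rewrite addr0.
have [x [w [/y0 xy0]]] := dT y e e0.
rewrite hnorm2D hnorm2N ipNr raddfN /= (ip_conj H x) xy0 conjc0 /= => h.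
by have := hnorm2_ge0 H x; lra.
Qed.

Lemma adjoint_fun T y z z' : densely_defined H T ->
  adjoint H T y z -> adjoint H T y z' -> z = z'.
Proof.
move=> dT yz yz'; apply/eqP; rewrite -subr_eq0; apply/eqP.
apply: (ip_dense_eq0 dT) => x w xw.
by rewrite ipBr -(yz _ _ xw) -(yz' _ _ xw) subrr.
Qed.

Lemma adjoint_linear T a y z y' z' :
  adjoint H T y z -> adjoint H T y' z' -> adjoint H T (a *: y + y') (a *: z + z').
Proof.
move=> yz yz' x w xw.
by rewrite !ipDr !ipZr (yz _ _ xw) (yz' _ _ xw).
Qed.

Lemma adjoint_closed T : closed_operator H (adjoint H T).
Proof.
move=> u v y z uv uy vz x w xw.
rewrite !(ip_conj H _ x) (ip_conj H _ w); congr conjc.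
apply: ip_lim_eq uy vz _ => n.
by rewrite (ip_conj H w) (ip_conj H x) (uv n _ _ xw).
Qed.

Lemma graph_subspace T : linear_operator T ->
  linear_subspace (fun p : K * K => T p.1 p.2).
Proof. by move=> [T0 [_ TL]]; split=> // a [? ?] [? ?] /=; exact: TL. Qed.

(** The graph of [T] is closed, so [(k, 0)] has a projection [(u, v)] in it; orthogonality of
    [(k - u, - v)] to the graph says [T^* v = k - u]. Hence [1 + T^* T] is onto. *)
Lemma surjective_id_adjointM T k : linear_operator T -> closed_operator H T ->
  exists u v z, [/\ T u v, adjoint H T v z & u + z = k].
Proof.
move=> lT cT.
have [w [l [Tw wl ol]]] :=
  projection (prod_hilbert H H) (k, 0) (graph_subspace lT).
have Tl : T l.1 l.2 by apply: cT (hconverges_fst wl) (hconverges_snd wl).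
exists l.1, l.2, (k - l.1); split=> //; last by rewrite addrC subrK.
move=> x y xy; have /= := ol (x, y).
rewrite sub0r ipNl => /(_ xy)/eqP; rewrite subr_eq0 => /eqP h.
by rewrite ip_conj -h -ip_conj.
Qed.

(* von Neumann: the domain of [T^* T] is a core of [T]. *)
Lemma adjointM_core T x y : linear_operator T -> closed_operator H T -> T x y ->
  exists u v z : nat -> K, [/\ forall n, T (u n) (v n),
    forall n, adjoint H T (v n) (z n), hconverges H u x & hconverges H v y].
Proof.
move=> lT cT xy; have [T0 [Tfun TL]] := lT.
pose S (p : K * K) := T p.1 p.2 /\ exists z, adjoint H T p.2 z.
have SS : linear_subspace S.
  split; first by split=> //; exists 0 => a b _; rewrite !ip0r.
  move=> a [p1 p2] [q1 q2] [/= h1 [z1 h1']] [/= h2 [z2 h2']]; split; first exact: TL.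
  by exists (a *: z1 + z2); exact: adjoint_linear.
have [w [l [Sw wl ol]]] := projection (prod_hilbert H H) (x, y) SS.
have Tl : T l.1 l.2.
  by apply: cT (hconverges_fst wl) (hconverges_snd wl) => n; case: (Sw n).
have Tdiff : T (x - l.1) (y - l.2).
  rewrite -(scaleN1r l.1) -(scaleN1r l.2) ![_ + -1 *: _]addrC; exact: TL.
(* The rest [(x - l.1, y - l.2)] lies in the graph and is orthogonal to [S]. Writing
   [x - l.1 = u + T^* T u] turns [||x - l.1||^2] into its product with [(u, T u)], an element of
   [S]. *)
have [u [v [z [uv vz uz]]]] := surjective_id_adjointM (x - l.1) lT cT.
have xl0 : x - l.1 = 0.
  apply: (ip_def (h := H)); rewrite -{2}uz ipDr -(vz _ _ Tdiff).
  have /= := ol (u, v); apply.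
  by split=> //=; exists z.
have yl0 : y - l.2 = 0 by rewrite xl0 in Tdiff; exact: Tfun Tdiff T0.
have /choice[z0 hz0] n := (Sw n).2.
exists (fun n => (w n).1), (fun n => (w n).2), z0; split=> //.
- by move=> n; case: (Sw n).
- by move/subr0_eq: xl0 => ->; exact: hconverges_fst wl.
- by move/subr0_eq: yl0 => ->; exact: hconverges_snd wl.
Qed.

(** On the common domain of [N^* N] and [N N^*] one has [||N^* u|| = ||N u||]. Along a sequence of
    the core converging to [x] in the graph norm of [N], the vectors [N^* u n] are therefore Cauchy,
    and [N^*] is closed. *)
Lemma normal_dom_adjoint N x y : normal_operator H N -> N x y ->
  exists z, adjoint H N x z.
Proof.
move=> [lN [dN [cN nN]]] xy; have [N0 [Nfun NL]] := lN.
have [u [v [z [uv vz ux vy]]]] := adjointM_core lN cN xy.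
have /choice[p hp] n : exists p, adjoint H N (u n) p /\ N p (z n).
  have /(nN (u n) (z n))[q [q1 q2]] : op_comp (adjoint H N) N (u n) (z n) by exists (v n).
  by exists q.
have pv m n : hnorm2 H (p m - p n) = hnorm2 H (v m - v n).
  have adj (w : nat -> K) (t : nat -> K) :
      (forall n, adjoint H N (w n) (t n)) -> adjoint H N (w m - w n) (t m - t n).
    move=> h; rewrite -(scaleN1r (w n)) -(scaleN1r (t n)) ![_ + -1 *: _]addrC.
    exact: adjoint_linear.
  have lin (w : nat -> K) (t : nat -> K) :
      (forall n, N (w n) (t n)) -> N (w m - w n) (t m - t n).
    move=> h; rewrite -(scaleN1r (w n)) -(scaleN1r (t n)) ![_ + -1 *: _]addrC.
    exact: NL.
  have h1 := adj _ _ (fun n => (hp n).1) _ _ (lin _ _ (fun n => (hp n).2)).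
  have h2 := adj _ _ vz _ _ (lin _ _ uv).
  by rewrite /hnorm2 -h1 h2 ip_conj; case: (ip _ _ _).
have [|l pl] := @ip_complete _ _ H p.
  by move=> e /(hconverges_cauchy vy)[M hM]; exists M => m n Mm Mn;
    rewrite -/(hnorm2 _ _) pv; exact: hM.
by exists l; apply: (@adjoint_closed N u p) => // n; case: (hp n).
Qed.

(** With [y k = N^* x (k + 1) = N^* N x k], normality gives [N y k = N^* N x (k + 1) = y (k + 1)].
    An orbit of [N] is thus sent to an orbit, so [N^* N] can be applied again and again. *)
Lemma normal_dom_infty N (x : nat -> K) : normal_operator H N ->
  (forall k, N (x k) (x k.+1)) ->
  exists y : nat -> K, (forall k, adjoint H N (x k.+1) (y k)) /\
                       (forall k, N (y k) (y k.+1)).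
Proof.
move=> nN xN; have [_ [dN [_ NN]]] := nN.
have /choice[y hy] k := normal_dom_adjoint nN (xN k.+1).
exists y; split=> // k.
have /(NN (x k.+1) (y k.+1))[q [q1 q2]] :
  op_comp (adjoint H N) N (x k.+1) (y k.+1) by exists (x k.+2).
by rewrite -(adjoint_fun dN q1 (hy k)).
Qed.

(* In terms of [T = N^* N], which commutes with [N], the Hankel form of
   [||N^n x||^2 = <T^n x, x>] is [||\sum_i c_i T^i x||^2]. *)
Lemma normal_hankel_ge0 N (x : nat -> K) (n : nat) (c : 'I_n -> R) :
  normal_operator H N -> (forall k, N (x k) (x k.+1)) ->
  0 <= \sum_i \sum_j c i * c j * hnorm2 H (x (i + j)%N).
Proof.
move=> nN xN.
pose P (x y : nat -> K) := (forall k, adjoint H N (x k.+1) (y k)) /\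
                       (forall k, N (y k) (y k.+1)).
pose next (x : nat -> K) := xget x (P x).
have nextP (z : nat -> K) : (forall k, N (z k) (z k.+1)) -> P z (next z).
  move=> /(normal_dom_infty nN)[y hy]; exact: (xgetPex z (ex_intro _ y hy)).
(* [X i k] is [T^i (x k)] with [T = N^* N]. *)
pose X i := iter i next x.
have XN i k : N (X i k) (X i k.+1).
  elim: i k => [|i IH] k; first exact: xN.
  by rewrite /X /=; have [_] := nextP _ IH; exact.
have XA i k : adjoint H N (X i k.+1) (X i.+1 k) by have [+ _] := nextP _ (XN i); exact.
(* One [N] on both sides amounts to one factor [T] on the right; [swap] then moves [T] across the
   product. *)
have step i j k : ip H (X i k.+1) (X j k.+1) = ip H (X i k) (X j.+1 k).
  exact: XA (XN i k).
have swap i j k : ip H (X i k) (X j.+1 k) = ip H (X i.+1 k) (X j k).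
  by rewrite -step ip_conj step -ip_conj.
have key n' i j : ip H (X 0%N (n' + i + j)%N) (X 0%N (n' + i + j)%N)
                 = ip H (X i (n' + j)%N) (X 0%N (n' + j)%N).
  elim: i j => [|i IH] j; first by rewrite addn0.
  by rewrite [(n' + i.+1)%N]addnS addSnnS IH addnS step swap.
have key2 i j k l : ip H (X i (k + l)%N) (X j (k + l)%N) = ip H (X i k) (X (j + l)%N k).
  elim: l j => [|l IH] j; first by rewrite !addn0.
  by rewrite addnS step IH addnS.
have E i j : hnorm2 H (x (i + j)%N) = complex.Re (ip H (X i 0%N) (X j 0%N)).
  by rewrite /hnorm2 -[x]/(X 0%N) -[(i + j)%N]add0n addnA key (key2 _ _ 0%N).
have : 0 <= hnorm2 H (\sum_i (c i)%:C%C *: X i 0%N) by exact: hnorm2_ge0.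
congr (0 <= _).
have suml (F : 'I_n -> K) z : ip H (\sum_i F i) z = \sum_i ip H (F i) z.
  by rewrite (big_morph (fun t => ip H t z) (fun a b => ipDl H a b z) (ip0l H z)).
have sumr (F : 'I_n -> K) z : ip H z (\sum_i F i) = \sum_i ip H z (F i).
  by rewrite (big_morph (fun t => ip H z t) (ipDr H z) (ip0r H z)).
rewrite /hnorm2 suml raddf_sum; apply: eq_bigr => i _.
rewrite sumr raddf_sum; apply: eq_bigr => j _.
rewrite -/(hnorm2 H (x (i + j)%N)) E ipZl ipZr conjc_real; case: (ip H _ _) => a b /=; ring.
Qed.

End NormalOperators.

(** * Self-adjoint operators, isometries and the unitary dilation *)

Section SelfAdjoint.
Variables (R : realType) (K : lmodType R[i]) (H : hilbert_structure K).

Definition selfadjoint_operator (A : K -> K -> Prop) :=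
  linear_operator A /\ forall x y, adjoint H A x y <-> A x y.

(* If [z] is orthogonal to the domain then [A^* 0 = z], hence [z = A 0 = 0]. *)
Lemma selfadjoint_dense A : selfadjoint_operator A -> densely_defined H A.
Proof.
move=> [[A0 [Afun AL]] sA] x e e0.
pose S x := exists y, A x y.
have SS : linear_subspace S.
  split; first by exists 0.
  by move=> a y z [y' yy'] [z' zz']; exists (a *: y' + z'); exact: AL.
have [u [l [Su ul ol]]] := projection H x SS.
have xl : x - l = 0.
  apply: (Afun 0) A0; apply/sA => v w vw; rewrite ip0r ip_conj ol ?conjc0//.
  by exists w.
have [N hN] := ul e e0; have [y uy] := Su N.
by exists (u N), y; split=> //; rewrite (subr0_eq xl) hnorm2B; exact: hN.
Qed.

(** The identity [(M T)^* = T^* M'], domains included, for an everywhere defined [M] with adjoint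
    [M']. *)
Lemma adjoint_bounded_inv M M' (T : K -> K -> Prop) y z :
  (forall x y, ip H (M x) y = ip H x (M' y)) ->
  adjoint H (fun x y => exists2 w, T x w & y = M w) y z <-> adjoint H T (M' y) z.
Proof.
move=> MM'; split=> h x w.
  by move=> xw; rewrite -MM'; apply: h; exists w.
by move=> [v xv ->]; rewrite MM'; exact: h.
Qed.

(** For [N = M A] the adjoint is [A M' = M' A], and both [N^* N] and [N N^*] reduce to [A A], with
    equal domains because [M] and [M'] preserve the graph of [A]. *)
Lemma normal_unitary_selfadjoint A (M M' : K -> K) : selfadjoint_operator A ->
  (forall a x y, M (a *: x + y) = a *: M x + M y) ->
  (forall x y, ip H (M x) y = ip H x (M' y)) ->
  cancel M M' -> cancel M' M ->
  (forall x y, A x y -> A (M x) (M y)) ->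
  normal_operator H (fun x z => exists2 y, A x y & z = M y).
Proof.
move=> sA Mlin MM' MK M'K AM; have [[A0 [Afun AL]] aA] := sA.
have M0 : M 0 = 0 by have := Mlin (-1) 0 0; rewrite !scaleN1r !addNr.
have AM' x y : A x y -> A (M' x) (M' y).
  move=> xy; apply/aA => v w vw.
  by rewrite -!MM'; move/aA : xy; apply; exact: AM.
have aN x z : adjoint H (fun x z => exists2 y, A x y & z = M y) x z <->
    exists2 y, A x y & z = M' y.
  rewrite (adjoint_bounded_inv A x z MM') aA; split.
    by move=> /AM; rewrite M'K => xz; exists (M z).
  by move=> [y /AM' + ->].
split.
  split; first by exists 0.
  split; first by move=> x _ _ [y xy ->] [z xz ->]; rewrite (Afun _ _ _ xy xz).
  move=> a x _ x' _ [y xy ->] [y' xy' ->]; exists (a *: y + y'); first exact: AL.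
  by rewrite Mlin.
split.
  move=> x e e0; have [y [z [yz he]]] := selfadjoint_dense sA x e0.
  by exists y, (M z); split=> //; exists z.
split.
  move=> u v x y uv ux vy.
  exists (M' y); last by rewrite M'K.
  apply/aA => s t st; rewrite -MM' ip_conj [RHS]ip_conj; congr conjc.
  apply/esym; apply: (ip_lim_eq vy ux) => n.
  have [w uw ->] := uv n; have /aA/(_ _ _ st) h := uw.
  rewrite [RHS]ip_conj h MM' MK ip_conj.
  by [].
move=> x z; split=> [[y [[w xw ->]]]|[y []]].
  move=> /aN[v Av ->]; have /AM' := Av; rewrite MK => wv.
  exists (M' w); split; first by apply/aN; exists w.
  by exists (M' (M' v)); [exact: AM'|rewrite M'K].
move=> /aN[w xw ->] [v Av ->]; have /AM := Av; rewrite M'K => wv.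
exists (M w); split; first by exists w.
by apply/aN; exists (M (M v)); [exact: AM|rewrite MK].
Qed.

Section Isometry.
Variable U : K -> K.
Hypothesis Ulin : forall a x y, U (a *: x + y) = a *: U x + U y.
Hypothesis Uiso : forall x, hnorm2 H (U x) = hnorm2 H x.

Lemma isometry0 : U 0 = 0.
Proof. by have := Ulin (-1) 0 0; rewrite !scaleN1r !addNr. Qed.

Lemma isometryB x y : U (x - y) = U x - U y.
Proof. by rewrite addrC -scaleN1r Ulin scaleN1r addrC. Qed.

Lemma isometry_ip x y : ip H (U x) (U y) = ip H x y.
Proof.
have Re_eq v w : complex.Re (ip H (U v) (U w)) = complex.Re (ip H v w).
  have := Uiso (v + w); rewrite -{1}[v]scale1r Ulin scale1r !hnorm2D !Uiso.
  by move/addrI => h; apply: (@mulfI _ 2) h; rewrite pnatr_eq0.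
have Im_eq v w : complex.Im (ip H v w) = complex.Re (ip H v ('i%C *: w)).
  by rewrite ipZr; case: (ip H v w) => a b /=; ring.
have Ui v : U ('i%C *: v) = 'i%C *: U v.
  by rewrite -[_ *: v]addr0 Ulin isometry0 addr0.
have := Re_eq x y; have := Im_eq (U x) (U y); rewrite -Ui Re_eq -Im_eq.
by case: (ip _ _ _) (ip _ _ _) => [? ?] [? ?] /= -> ->.
Qed.

(** [U' y] is the preimage under [U] of the projection of [y] on the closed range of [U]; the
    preimages of the minimising sequence converge since [U] preserves distances. *)
Lemma isometry_adjoint : exists U' : K -> K,
  forall x y, ip H (U x) y = ip H x (U' y).
Proof.
pose S y := exists x, y = U x.
have SS : linear_subspace S.
  split; first by exists 0; rewrite isometry0.
  by move=> a _ _ [x ->] [y ->]; exists (a *: x + y); rewrite Ulin.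
suff /choice[U' hU'] y : exists z, forall x, ip H (U x) y = ip H x z by exists U'.
have [u [l [/choice[v uv] ul ol]]] := projection H y SS.
have [|z vz] := @ip_complete _ _ H v.
  move=> e /(hconverges_cauchy ul)[N hN]; exists N => m n Nm Nn.
  by rewrite -/(hnorm2 H _) -Uiso isometryB -!uv; exact: hN.
have lU : l = U z.
  apply: (hconverges_uniq ul) => e /vz[N hN]; exists N => n /hN.
  by rewrite uv -isometryB Uiso.
exists z => x; rewrite -[y](subrK l) ipDr ip_conj ol ?conjc0 ?add0r; last by exists x.
by rewrite lU isometry_ip.
Qed.

End Isometry.
End SelfAdjoint.

(* The unitary Halmos dilation [[U, 1 - U U^*], [0, U^*]] of the isometry [U]
   commutes with [A (+) A] as soon as [U] commutes with [A]. *)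
Lemma selfadjoint_isometry_normal (R : realType) (K : lmodType R[i])
    (H : hilbert_structure K) (A : K -> K -> Prop) (U : K -> K) :
  selfadjoint_operator H A ->
  (forall a x y, U (a *: x + y) = a *: U x + U y) ->
  (forall x, hnorm2 H (U x) = hnorm2 H x) ->
  (forall x y, A x y -> A (U x) (U y)) ->
  exists N, normal_operator (prod_hilbert H H) N /\
    forall x y, A x y -> N (x, 0) (U y, 0).
Proof.
move=> sA Ulin Uiso AU; have [[A0 [Afun AL]] aA] := sA.
have [U' UU'] := isometry_adjoint Ulin Uiso.
have Uip := isometry_ip Ulin Uiso.
have ipI x y : (forall z, ip H z x = ip H z y) -> x = y.
  move=> h; apply/eqP; rewrite -subr_eq0; apply/eqP; apply: (ip_def (h := H)).
  by rewrite ipBr h subrr.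
have U'lin a x y : U' (a *: x + y) = a *: U' x + U' y.
  by apply: ipI => z; rewrite -UU' !ipDr !ipZr !UU'.
have U'U x : U' (U x) = x by apply: ipI => z; rewrite -UU' Uip.
have U0 := isometry0 Ulin.
have UB := isometryB Ulin.
have U'0 : U' 0 = 0 by have := U'lin (-1) 0 0; rewrite !scaleN1r !addNr.
have U'B x y : U' (x - y) = U' x - U' y.
  by rewrite addrC -scaleN1r U'lin scaleN1r addrC.
have UD x y : U (x + y) = U x + U y by rewrite -{1}[x]scale1r Ulin scale1r.
have U'D x y : U' (x + y) = U' x + U' y by rewrite -{1}[x]scale1r U'lin scale1r.
have U'U2 x y : ip H (U' x) y = ip H x (U y) by rewrite ip_conj -UU' -ip_conj.
have AU' x y : A x y -> A (U' x) (U' y).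
  move=> xy; apply/aA => v w vw.
  by rewrite -!UU'; move/aA : xy; apply; exact: AU.
have AB x y x' y' : A x y -> A x' y' -> A (x - x') (y - y').
  by move=> h h'; rewrite addrC [y - _]addrC -(scaleN1r x') -(scaleN1r y'); exact: AL.
have AD x y x' y' : A x y -> A x' y' -> A (x + x') (y + y').
  by move=> h h'; rewrite -[x]scale1r -[y]scale1r; exact: AL.
pose A2 (x y : K * K) := A x.1 y.1 /\ A x.2 y.2.
have sA2 : selfadjoint_operator (prod_hilbert H H) A2.
  split.
    split; first by [].
    split; first by move=> [? ?] [? ?] [? ?] [/= h1 h2] [/= h3 h4];
      rewrite (Afun _ _ _ h1 h3) (Afun _ _ _ h2 h4).
    by move=> a [? ?] [? ?] [? ?] [? ?] [/= ? ?] [/= ? ?]; split; exact: AL.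
  move=> [x1 x2] [y1 y2]; split.
    move=> h; split; apply/aA => v w vw /=.
      by have := h (v, 0) (w, 0) (conj vw A0); rewrite !ip_prod /= !ip0l !addr0.
    by have := h (0, v) (0, w) (conj A0 vw); rewrite !ip_prod /= !ip0l !add0r.
  move=> [/= /aA h1 /aA h2] [v1 v2] [w1 w2] [/= vw1 vw2].
  by rewrite /= (h1 _ _ vw1) (h2 _ _ vw2).
(* [M'] is the adjoint of [M]. That they are inverse to each other comes from [U' U = 1], by which
   [1 - U U'] is the projection on the complement of the range of [U]. *)
pose M (x : K * K) : K * K := (U x.1 + (x.2 - U (U' x.2)), U' x.2).
pose M' (x : K * K) : K * K := (U' x.1, x.1 - U (U' x.1) + U x.2).
exists (fun x z => exists2 y, A2 x y & z = M y); split; last first.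
  move=> x y xy; exists (y, 0) => //.
  by rewrite /M /= U'0 U0 subrr addr0.
apply: (normal_unitary_selfadjoint (M' := M') sA2).
- move=> a [x1 x2] [y1 y2]; congr (_, _) => /=; last exact: U'lin.
  rewrite U'lin !Ulin scalerDr scalerBr opprD.
  by rewrite (addrACA (a *: x2)) (addrACA (a *: U x1)).
- move=> [x1 x2] [y1 y2]; rewrite !ip_prod /= !ipDl !ipDr !ipNl !ipNr UU' UU' U'U2 U'U2.
  ring.
- move=> [x1 x2]; congr (_, _) => /=.
    by rewrite U'D U'B !U'U subrr addr0.
  rewrite U'D U'B !U'U subrr addr0.
  by rewrite (addrC (U x1)) addrK subrK.
- move=> [x1 x2]; congr (_, _) => /=.
    rewrite U'D U'B !U'U subrr add0r addrK.
    by rewrite addrC subrK.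
  by rewrite U'D U'B !U'U subrr add0r.
- move=> [x1 x2] [y1 y2] [/= h1 h2]; split => /=; last exact: AU'.
  by apply: AD; [exact: AU|apply: AB => //; apply: AU; exact: AU'].
Qed.

(** * The two-sided Stieltjes moment problem *)

Section PositiveDefinite.
Variable C : numClosedFieldType.
Local Open Scope sesquilinear_scope.

Definition posdefmx n (A : 'M[C]_n) :=
  A ^t* = A /\ forall v : 'rV[C]_n, v != 0 -> 0 < (v *m A *m v ^t*) 0 0.

Lemma trmxC_mul m n p (A : 'M[C]_(m, n)) (B : 'M[C]_(n, p)) :
  (A *m B) ^t* = B ^t* *m A ^t*.
Proof. by rewrite trmx_mul map_mxM. Qed.

Lemma posdefmx_spectral n (A : 'M[C]_n) : posdefmx A ->
  exists (Q : 'M[C]_n) (D : 'rV[C]_n),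
    [/\ Q \is unitarymx, forall i, 0 < D 0 i & A = Q ^t* *m diag_mx D *m Q].
Proof.
move=> [hA pA].
have nA : A \is normalmx by apply/normalmxP; rewrite hA.
have := orthomx_spectralP nA; have := spectral_unitarymx A.
set Q := spectralmx A; set D := spectral_diag A => uQ.
rewrite (invmx_unitary uQ) => AE.
exists Q, D; split=> // i.
(* The form of [A] at the [i]-th row of [Q] is the eigenvalue [D 0 i], so positivity is tested
   there. *)
have rQ0 : row i Q != 0.
  apply/eqP => r0; have /unitarymxP := uQ => /(congr1 (row i)).
  rewrite row_mul r0 mul0mx => /rowP/(_ i).
  by rewrite !mxE eqxx => /eqP; rewrite eq_sym oner_eq0.
have := pA _ rQ0; congr (0 < _).
have -> : row i Q *m A *m (row i Q) ^t* = row i (diag_mx D) *m (row i 1%:M)^T.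
  rewrite {1}AE !rowE trmxC_mul -!mulmxA (mulmxA Q (Q ^t*)) (unitarymxP uQ) mul1mx.
  rewrite [Q *m (Q ^t* *m _)]mulmxA (unitarymxP uQ) !mul1mx mulmx1 trmx_delta.
  by rewrite map_delta_mx.
rewrite mxE (bigD1 i)//= big1 ?addr0 => [|j ji]; first by rewrite !mxE eqxx mulr1 mulr1n.
by rewrite !mxE eq_sym (negbTE ji) mulr0.
Qed.

Lemma posdefmx_congr n (A S : 'M[C]_n) : S \in unitmx -> posdefmx A ->
  posdefmx (S ^t* *m A *m S).
Proof.
move=> uS [hA pA]; split; first by rewrite !trmxC_mul trmxCK hA mulmxA.
move=> v v0; have : v *m S ^t* != 0.
  apply: contra v0 => /eqP h.
  have : v *m S ^t* *m invmx (S ^t*) = 0 by rewrite h mul0mx.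
  by rewrite mulmxK ?map_unitmx ?unitmx_tr// => ->.
by move=> /pA; rewrite trmxC_mul trmxCK !mulmxA.
Qed.

Lemma posdefmx_sqrt n (A : 'M[C]_n) : posdefmx A ->
  exists S : 'M[C]_n, S \in unitmx /\ A = S ^t* *m S.
Proof.
move=> /posdefmx_spectral[Q [D [uQ D0 ->]]].
pose s := map_mx sqrtC D.
have us : diag_mx s \in unitmx.
  rewrite unitmxE det_diag unitfE; apply/prodf_neq0 => i _.
  by rewrite mxE sqrtC_eq0 gt_eqF.
exists (diag_mx s *m Q); split; first by rewrite unitmx_mul us unitarymx_unit.
rewrite trmxC_mul !mulmxA; congr (_ *m _); rewrite -mulmxA; congr (_ *m _).
rewrite tr_diag_mx map_diag_mx mulmx_diag; congr diag_mx; apply/rowP => i.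
rewrite !mxE.
have /CrealP/= -> : sqrtC (D 0 i) \is Num.real by rewrite ger0_real// sqrtC_ge0 ltW.
by rewrite -expr2 sqrtCK.
Qed.

(* Simultaneous diagonalisation [H0 = X^* X], [H1 = X^* diag(T) X]. The Hankel
   relation makes the [k]-th column of [X] equal to [T^k] times its first one. *)
Lemma posdef_hankel_atoms n (H0 H1 : 'M[C]_n.+1) : posdefmx H0 -> posdefmx H1 ->
  (forall l k k' : 'I_n.+1, k' = k.+1 :> nat -> H1 l k = H0 l k') ->
  exists T W : 'I_n.+1 -> C, [/\ forall i, 0 < T i, forall i, 0 <= W i &
    forall k : 'I_n.+1, H0 0 k = \sum_i W i * T i ^+ k].
Proof.
move=> p0 p1 shift.
have [S [uS H0E]] := posdefmx_sqrt p0.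
have uZ : invmx S \in unitmx by rewrite unitmx_inv.
have [Q [D [uQ D0 BE]]] := posdefmx_spectral (posdefmx_congr uZ p1).
set Z := invmx S in uZ BE.
have ZS : Z ^t* *m S ^t* = 1%:M.
  by rewrite -trmxC_mul mulmxV// trmx1 map_mx1.
pose X := Q *m S.
have XX : X ^t* *m X = H0.
  rewrite /X trmxC_mul !mulmxA -(mulmxA _ (Q ^t*)).
  by rewrite -(invmx_unitary uQ) mulVmx ?unitarymx_unit// mulmx1 H0E.
have DX : diag_mx D *m X = Q *m Z ^t* *m H1.
  have -> : diag_mx D *m X = Q *m (Q ^t* *m diag_mx D *m Q) *m S.
    by rewrite /X !mulmxA (unitarymxP uQ) mul1mx.
  by rewrite -BE !mulmxA mulmxKV.
have XE : X = Q *m Z ^t* *m H0.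
  by rewrite H0E mulmxA -(mulmxA Q) ZS mulmx1.
(* By [XE] and [DX] the same matrix sends [H0] to [X] and [H1] to [diag_mx D *m X]; the shift
   between [H0] and [H1] becomes one between the columns of [X]. *)
have XS i (k k' : 'I_n.+1) : k' = k.+1 :> nat -> X i k' = D 0 i * X i k.
  move=> kk'; have := congr1 (fun M : 'M_n.+1 => M i k) DX.
  rewrite /= mul_diag_mx mxE => ->; rewrite {1}XE mxE [RHS]mxE.
  by apply: eq_bigr => l _; rewrite (shift _ _ _ kk').
have Xk i (k : 'I_n.+1) : X i k = D 0 i ^+ k * X i 0.
  case: k => k /=; elim: k => [|k IH] hk.
    by rewrite expr0 mul1r; congr (X i _); exact: val_inj.
  by rewrite (XS i (Ordinal (ltnW hk)))// IH exprS mulrA.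
exists (fun i => D 0 i), (fun i => `|X i 0| ^+ 2); split => [//|i|k]; first exact: exprn_ge0.
rewrite -XX mxE; apply: eq_bigr => i _.
by rewrite 2!mxE (Xk i k) normCK (mulrC (X i 0)) -mulrA (mulrC (X i 0)).
Qed.

End PositiveDefinite.

(** * From positive definite Hankel matrices to finitely many atoms *)

Section FiniteQuadrature.
Variable R : realType.
Local Open Scope sesquilinear_scope.

Definition hankel_pos n (g : nat -> R) :=
  forall c : 'I_n -> R, (exists i, c i != 0) ->
    0 < \sum_i \sum_j c i * c j * g (i + j)%N.

(** For [v = a + i b] the cross terms cancel by symmetry of the real form, leaving
    [q a a + q b b]. *)
Lemma hankel_posdefmx n (g : nat -> R) : hankel_pos n g ->
  posdefmx (\matrix_(i < n, j < n) (g (i + j)%N)%:C%C).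
Proof.
move=> pg; split.
  by apply/matrixP => i j; rewrite !mxE addnC; exact: conjc_real.
move=> v v0.
pose a i := complex.Re (v 0 i); pose b i := complex.Im (v 0 i).
pose q (c d : 'I_n -> R) := \sum_i \sum_j c i * d j * g (i + j)%N.
have -> : (v *m (\matrix_(i < n, j < n) (g (i + j)%N)%:C%C) *m v ^t*) 0 0
   = (q a a + q b b)%:C%C.
  have qC : q b a = q a b.
    rewrite /q exchange_big; apply: eq_bigr => i _; apply: eq_bigr => j _.
    by rewrite addnC (mulrC (b j)).
  rewrite mxE.
  transitivity (\sum_(i < n) \sum_(j < n) (v 0 i * (g (i + j)%N)%:C%C * conjc (v 0 j))).
    rewrite exchange_big; apply: eq_bigr => j _; rewrite mxE mulr_suml.
    by apply: eq_bigr => i _; rewrite !mxE.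
  apply/eqP; rewrite eq_complex; apply/andP; split; apply/eqP.
    rewrite raddf_sum /= /q -big_split; apply: eq_bigr => i _.
    rewrite raddf_sum /= -big_split; apply: eq_bigr => j _ /=.
    rewrite /a /b; case: (v 0 i) (v 0 j) => [? ?] [? ?] /=; ring.
  transitivity (q b a - q a b); last by rewrite qC subrr.
  rewrite raddf_sum /= /q -sumrB; apply: eq_bigr => i _.
  rewrite raddf_sum /= -sumrB; apply: eq_bigr => j _ /=.
  rewrite /a /b; case: (v 0 i) (v 0 j) => [? ?] [? ?] /=; ring.
rewrite ltcR.
have q_ge0 c : 0 <= q c c.
  have [[i ci]|/forallNP c0] := pselect (exists i, c i != 0).
    by apply/ltW/pg; exists i.
  rewrite /q big1// => i _; rewrite big1// => j _.
  by have /negP/negPn/eqP -> := c0 i; rewrite !mul0r.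
have [[i ai]|/forallNP a0] := pselect (exists i, a i != 0).
  by apply: ltr_wpDr => //; apply: pg; exists i.
apply: ltr_wpDl => //; apply: pg.
have /rV0Pn[i vi] := v0; exists i; apply: contra vi => /eqP bi.
have /negP/negPn/eqP ai := a0 i.
by rewrite eq_complex -/(a i) -/(b i) ai bi !eqxx.
Qed.

(** The nodes are the eigenvalues of the second Hankel matrix relative to the first, hence positive.
    Only row 0 of the first matrix is read off, whence exactness up to degree [n]. *)
Lemma hankel_quadrature n (g : nat -> R) :
  hankel_pos n.+1 g -> hankel_pos n.+1 (g \o succn) ->
  exists t w : 'I_n.+1 -> R, [/\ forall i, 0 < t i, forall i, 0 <= w i &
    forall k, (k <= n)%N -> g k = \sum_i w i * t i ^+ k].
Proof.
move=> /hankel_posdefmx p0 /hankel_posdefmx p1.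
have [|T [W [T0 W0 TW]]] := posdef_hankel_atoms p0 p1.
  by move=> l k k' kk'; rewrite !mxE /= kk' addnS.
have TE i : T i = (complex.Re (T i))%:C%C.
  by have := T0 i; case: (T i) => x y; rewrite ltcE /= => /andP[/eqP-> _].
have WE i : W i = (complex.Re (W i))%:C%C.
  by have := W0 i; case: (W i) => x y; rewrite lecE /= => /andP[/eqP-> _].
exists (fun i => complex.Re (T i)), (fun i => complex.Re (W i)); split.
- by move=> i; rewrite -ltcR -TE.
- by move=> i; rewrite -lecR -WE.
move=> k kn; have := TW (inord k); rewrite mxE /= add0n inordK//.
move=> h; apply: (@complexI R); rewrite h rmorph_sum; apply: eq_bigr => i _.
by rewrite rmorphM rmorphXn /= -TE -WE.
Qed.

End FiniteQuadrature.

Section TruncatedMoments.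
Variables (R : realType) (b : int -> R).

(** The shift [m] runs over all integers, odd ones included: this is what will locate the measure on
    the positive half-line instead of the whole line. *)
Definition hankel_nonneg := forall (m : int) n (c : 'I_n -> R),
  0 <= \sum_i \sum_j c i * c j * b (m + (i + j)%N%:Z).

Hypothesis b_pos : hankel_nonneg.

(* Adding a small multiple of the moments of [n.+1] point masses makes the
   truncated Hankel forms positive definite. *)
Lemma hankel_pos_perturb (m : int) n (e : R) : 0 < e ->
  hankel_pos n.+1 (fun k => b (m + k%:Z) + e * \sum_(l < n.+1) l.+1%:R ^ (m + k%:Z)).
Proof.
move=> e0 c [i0 ci0].
have -> : \sum_(i < n.+1) \sum_(j < n.+1) c i * c j * (b (m + (i + j)%N%:Z)
      + e * \sum_(l < n.+1) l.+1%:R ^ (m + (i + j)%N%:Z))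
   = \sum_(i < n.+1) \sum_(j < n.+1) c i * c j * b (m + (i + j)%N%:Z)
     + e * \sum_(l < n.+1) l.+1%:R ^ m * (\sum_(i < n.+1) c i * l.+1%:R ^+ i) ^+ 2.
  have -> : \sum_(l < n.+1) l.+1%:R ^ m * (\sum_(i < n.+1) c i * l.+1%:R ^+ i) ^+ 2
    = \sum_(i < n.+1) \sum_(j < n.+1) c i * c j *
        \sum_(l < n.+1) (l.+1%:R : R) ^ (m + (i + j)%N%:Z).
    under [RHS]eq_bigr do (under eq_bigr do rewrite mulr_sumr; rewrite exchange_big).
    rewrite [RHS]exchange_big; apply: eq_bigr => l _.
    rewrite expr2 mulr_suml mulr_sumr; apply: eq_bigr => i _.
    rewrite mulr_sumr mulr_sumr; apply: eq_bigr => j _.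
    rewrite expfzDr ?pnatr_eq0// -exprnP exprD; ring.
  rewrite mulr_sumr -big_split; apply: eq_bigr => i _ /=.
  rewrite mulr_sumr -big_split; apply: eq_bigr => j _ /=; ring.
apply: ltr_wpDl; first exact: b_pos.
apply: mulr_gt0 => //.
(* The perturbation contributes positive multiples of [p(l)^2] at the nodes [l = 1, ..., n + 1], and
   a nonzero polynomial of degree at most [n] cannot vanish at all of them. *)
pose p := \poly_(i < n.+1) (if insub i is Some i' then c i' else 0).
have pE x : p.[x] = \sum_(i < n.+1) c i * x ^+ i.
  by rewrite horner_poly; apply: eq_bigr => i _; rewrite valK.
have [[l hl]|/forallNP h] := pselect (exists l : 'I_n.+1, p.[l.+1%:R] != 0).
  rewrite (bigD1 l)//=; apply: ltr_pwDl.
    by rewrite mulr_gt0 ?exprz_gt0// lt_neqAle sqr_ge0 andbT eq_sym sqrf_eq0 -pE.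
  by apply: sumr_ge0 => i _; rewrite mulr_ge0 ?sqr_ge0// exprz_ge0.
have p0 : p != 0.
  apply: contra ci0 => /eqP p0; have := congr1 (fun q : {poly R} => q`_i0) p0.
  by rewrite coef_poly ltn_ord valK coef0 => ->.
have := @max_poly_roots _ p [seq l.+1%:R | l : 'I_n.+1] p0.
rewrite size_map -cardE card_ord => H.
have : (n.+1 < size p)%N.
  apply: H.
    by apply/allP => _ /mapP[l _ ->]; rewrite rootE; apply/negPn/negP/h.
  by rewrite map_inj_uniq ?enum_uniq// => i j /eqP; rewrite eqr_nat => /eqP[/val_inj].
by rewrite ltnNge size_poly.
Qed.

Lemma truncated_moments (M : nat) (e : R) : 0 < e ->
  exists n (t w : 'I_n -> R), [/\ forall i, 0 < t i, forall i, 0 <= w i &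
   forall j : int, (`|j| <= M)%N -> `|\sum_i w i * t i ^ j - b j| <= e].
Proof.
move=> e0.
(* The window from [- M] to [M] is shifted to one from 0 to [n], and the weights are multiplied by
   [t ^ M] to shift back. [S] dominates the perturbing moments of order [|j| <= M], so a factor
   [e / S] keeps the error below [e]. *)
pose n := (M + M)%N; pose S : R := \sum_(l < n.+1) l.+1%:R ^+ M.
have S0 : 0 < S.
  rewrite /S big_ord_recl /= expr1n; apply: ltr_pwDl => //.
  by apply: sumr_ge0 => l _; rewrite exprn_ge0.
have eS : 0 < e / S by rewrite divr_gt0.
have h0 := @hankel_pos_perturb (- M%:Z) n _ eS.
have h1 := @hankel_pos_perturb (- M%:Z + 1) n _ eS.
have [|t [w [t0 w0 tw]]] := hankel_quadrature h0.
  move=> c hc; have := h1 c hc; congr (0 < _); apply: eq_bigr => i _.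
  by apply: eq_bigr => j _ /=; rewrite -addrA -PoszD add1n.
exists n.+1, t, (fun i => w i * t i ^+ M); split=> //.
  by move=> i; rewrite mulr_ge0// exprn_ge0// ltW.
move=> j jM.
have [k kE] : exists k : nat, k%:Z = j + M%:Z.
  by exists `|(j + M%:Z)%R|%N; lia.
have kn : (k <= n)%N by rewrite /n; lia.
have -> : \sum_i w i * t i ^+ M * t i ^ j = \sum_i w i * t i ^+ k.
  apply: eq_bigr => i _; rewrite -mulrA [t i ^+ k]exprnP kE addrC.
  by rewrite expfzDr ?gt_eqF// -exprnP.
rewrite -tw//; have -> : - M%:Z + k%:Z = j by lia.
rewrite addrAC subrr add0r.
rewrite ger0_norm; last first.
  by rewrite mulr_ge0 ?(ltW eS)// sumr_ge0// => l _; rewrite exprz_ge0.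
rewrite -mulrA ler_piMr ?(ltW e0)// ler_pdivrMl// mulr1.
apply: ler_sum => l _; rewrite exprnP ler_weXz2l ?ler1n//; lia.
Qed.

End TruncatedMoments.

(** * The limit functional *)

Section PositiveFunctional.
Variables (R : realType) (b : int -> R).
Hypothesis b_pos : hankel_nonneg b.

(* [B] consists of the functions on which the quadratures are bounded; [L] is the
   limit of the quadratures along an ultrafilter. *)
Lemma positive_functional : exists (B : set (R -> R)) (L : (R -> R) -> R),
  [/\ forall (f : R -> R) (C : R), (forall s : R, 0 < s -> `|f s| <= C) -> B f,
      forall j, B (fun s => s ^ j) /\ L (fun s => s ^ j) = b j,
      forall a f g, B f -> B g ->
        B (fun s => a * f s + g s) /\ L (fun s => a * f s + g s) = a * L f + L g &
      forall f g : R -> R, B f -> B g -> (forall s : R, 0 < s -> f s <= g s) ->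
        L f <= L g].
Proof.
have /choice[Lam hLam] (M : nat) : exists Lam : (R -> R) -> R,
  [/\ forall a f g, Lam (fun s => a * f s + g s) = a * Lam f + Lam g,
      forall f g : R -> R, (forall s : R, 0 < s -> f s <= g s) -> Lam f <= Lam g &
      forall j : int, (`|j| <= M)%N -> `|Lam (fun s => s ^ j) - b j| <= M.+1%:R^-1].
  have [|n [t [w [t0 w0 tw]]]] := @truncated_moments _ _ b_pos M M.+1%:R^-1.
    by rewrite invr_gt0.
  exists (fun f => \sum_i w i * f (t i)); split => //.
    move=> a f g; rewrite mulr_sumr -big_split; apply: eq_bigr => i _ /=; ring.
  by move=> f g fg; apply: ler_sum => i _; rewrite ler_wpM2l// fg.
have [U [UU oU]] := @ultraFilterLemma nat \oo _.
pose B := [set f | exists C : R, forall M, `|Lam M f| <= C].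
pose L f := lim (Lam M f @[M --> U]).
have cvgL f : B f -> Lam M f @[M --> U] --> L f.
  move=> [C hC].
  (* A cluster point of the bounded values is a limit, because the ultrafilter contains every set or
     its complement. *)
  have [|x [_ clx]] := @segment_compact R (- C) C (Lam M f @[M --> U]) _.
    suff : U [set M | `[- C, C]%classic (Lam M f)] by [].
    by apply: filterE => M /=; rewrite in_itv /= -ler_norml.
  apply/cvg_ex; exists x => V Vx.
  have [//|UV] := in_ultra_setVsetC [set M | V (Lam M f)] UU.
  by have [y []] := clx (~` V) V UV Vx.
have cvgb j : Lam M (fun s => s ^ j) @[M --> U] --> b j.
  suff h : Lam M (fun s => s ^ j) @[M --> \oo] --> b j.
    by apply: cvg_trans h; exact: cvg_app.
  apply/cvgrPdist_le => e e0; near=> M.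
  have [_ _ /(_ j)] := hLam M; rewrite distrC => /(_ _)/le_trans; apply.
    by near: M; exact: nbhs_infty_ge.
  by apply/ltW; near: M; exact: (near_infty_natSinv_lt (PosNum e0)).
have bB j : B (fun s => s ^ j).
  (* From [M = |j|] on, the quadratures are within 1 of [b j]; each of the finitely many earlier
     ones is bounded by the sum of all their absolute values. *)
  exists (`|b j| + 1 + \sum_(M < `|j|) `|Lam M (fun s => s ^ j)|) => M.
  have [jM|Mj] := leqP `|j| M.
    apply: ler_wpDr; first exact: sumr_ge0.
    have [_ _ /(_ j jM) h] := hLam M.
    rewrite -[leLHS](subrK `|b j|) addrC lerD2l.
    apply: le_trans (lerB_dist _ _) _; apply: le_trans h _.
    by rewrite invf_le1 ?ler1n.
  rewrite (bigD1 (Ordinal Mj))//= ler_wpDl ?ler_wpDr ?sumr_ge0//.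
exists B, L; split.
- move=> f C fC; exists (C * `|b 0| + C + \sum_(M < 1) `|Lam M f|) => M.
  have C0 : 0 <= C by rewrite (le_trans _ (fC 1 ltr01)).
  have [lin mon /(_ 0 isT)] := hLam M; rewrite distrC ler_distlC => /andP[_ h].
  have scale a : Lam M (fun=> a) = a * Lam M (fun s => s ^ 0).
    have z : Lam M (fun=> 0) = 0.
      have := lin 1 (fun=> 0) (fun=> 0).
      under eq_fun do rewrite mulr0 addr0.
      by rewrite mul1r -[LHS]addr0 => /addrI.
    rewrite -[RHS]addr0 -z -lin; congr (Lam M); apply/funext => s.
    by rewrite addr0 mulr1.
  have up : Lam M f <= C * (b 0 + 1).
    apply: (@le_trans _ _ (Lam M (fun=> C))).
      by apply: mon => s /fC; apply: le_trans; exact: ler_norm.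
    rewrite scale ler_wpM2l//; apply: le_trans h _; rewrite lerD2l.
    by rewrite invf_le1 ?ler1n.
  have lo : - (C * (b 0 + 1)) <= Lam M f.
    apply: (@le_trans _ _ (Lam M (fun=> - C))).
      rewrite scale mulNr lerN2 ler_wpM2l//; apply: le_trans h _; rewrite lerD2l.
      by rewrite invf_le1 ?ler1n.
    by apply: mon => s /fC; rewrite ler_norml => /andP[].
  apply: ler_wpDr; first exact: sumr_ge0.
  rewrite (@le_trans _ _ (C * (b 0 + 1)))// ?ler_norml ?lo ?up//.
  by rewrite mulrDr mulr1 lerD2r ler_wpM2l// ler_norm.
- by move=> j; split; [exact: bB|apply: cvg_lim; [exact: Rhausdorff|exact: cvgb]].
- move=> a f g Bf Bg; split.
    have [[C fC] [D gD]] := (Bf, Bg).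
    exists (`|a| * C + D) => M; have [-> _ _] := hLam M.
    by rewrite (le_trans (ler_normD _ _))// lerD// normrM ler_wpM2l.
  apply: cvg_lim; first exact: Rhausdorff.
  have -> : (fun M => Lam M (fun s => a * f s + g s)) = (fun M => a * Lam M f + Lam M g).
    by apply/funext => M; have [-> _ _] := hLam M.
  by apply: cvgD; [apply: cvgMr|]; exact: cvgL.
- move=> f g Bf Bg fg; apply: ler_lim.
  + by apply: cvgP; exact: cvgL.
  + by apply: cvgP; exact: cvgL.
  + by apply: filterE => M; have [_ mon _] := hLam M; exact: mon.
Unshelve. all: by end_near. Qed.

End PositiveFunctional.

(** * The measure of a monotone function *)

Section MonotoneMeasure.
Variables (R : realType) (F : R -> R).
Hypothesis ndF : nondecreasing F.

(** The right-continuous regularisation of [F], to which the Lebesgue-Stieltjes construction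
    applies. *)
Let G (t : R) : R := inf [set F s | s in [set s | t < s]].

Let lbG t s : t < s -> G t <= F s.
Proof.
move=> ts; apply: ge_inf; last by exists s.
by exists (F t) => _ [u /= tu <-]; exact/ndF/ltW.
Qed.

Let leG t x : (forall s, t < s -> x <= F s) -> x <= G t.
Proof.
move=> h; apply: lb_le_inf => [|_ [s /= ts <-]]; last exact: h.
by exists (F (t + 1)), (t + 1) => //=; rewrite ltrDl.
Qed.

Let FG t : F t <= G t.
Proof. by apply: leG => s /ltW; exact: ndF. Qed.

Let ndG : nondecreasing G.
Proof.
move=> x y xy; apply: leG => s ys; apply: lbG; exact: le_lt_trans ys.
Qed.

Let rcG : right_continuous G.
Proof.
move=> x; apply/cvgrPdist_le => e e0.
have [_ [u /= xu <-] hu] : exists2 z, [set F s | s in [set s | x < s]] z & z < G x + e.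
  apply: inf_adherent => //; split.
    by exists (F (x + 1)), (x + 1) => //=; rewrite ltrDl.
  by exists (F x) => _ [v /= xv <-]; exact/ndF/ltW.
near=> y.
have xy : x < y by near: y; exact: nbhs_right_gt.
have yu : y < u by near: y; exact: nbhs_right_lt.
rewrite distrC ger0_norm ?subr_ge0 ?ndG ?ltW//.
rewrite ltrBlDl; apply: le_lt_trans hu.
exact: lbG.
Unshelve. all: by end_near. Qed.

(* Outside the countably many discontinuities of [F]. *)
Let right_continuity_dense a b : a < b -> exists c, [/\ a < c, c < b & G c = F c].
Proof.
move=> ab.
have [[c [cab dc]]|h] := pselect (exists c, (c \in `]a, b[) /\ ~ discontinuity F c); last first.
  (* Otherwise the interval consists of discontinuities, is countable, and has Lebesgue measure 0
     instead of [b - a]. *)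
  have cab : countable `]a, b[%classic.
    have := @discontinuity_countable R a b F (fun x y _ _ => @ndF x y).
    apply: sub_countable; apply: subset_card_le => x /= xab; split => //.
    by apply: contrapT => dx; apply: h; exists x.
  have := countable_lebesgue_measure0 cab; rewrite lebesgue_measure_itv /= lte_fin ab.
  by move=> /eqP; rewrite -EFinB eqe subr_eq0 gt_eqF.
move: cab; rewrite in_itv/= => /andP[ac cb]; exists c; split => //.
apply/eqP; rewrite eq_le FG andbT.
have lr : cvg (F x @[x --> c^'+]).
  apply: nondecreasing_at_right_is_cvgr; near=> x; first by move=> u v _ _; exact: ndF.
  by exists (F c) => _ [u /= + <-]; rewrite in_itv/= => /andP[/ltW cu _]; exact: ndF.
have ll : cvg (F x @[x --> c^'-]).
  apply: nondecreasing_at_left_is_cvgr; near=> x; first by move=> u v _ _; exact: ndF.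
  by exists (F c) => _ [u /= + <-]; rewrite in_itv/= => /andP[_ /ltW cu]; exact: ndF.
have lim_eq : lim (F x @[x --> c^'-]) = lim (F x @[x --> c^'+]).
  by apply: contrapT => /eqP ne; apply: dc.
apply: (@le_trans _ _ (lim (F x @[x --> c^'+]))).
  apply: limr_ge => //; near=> x; apply: lbG; near: x; exact: nbhs_right_gt.
rewrite -lim_eq; apply: limr_le => //; near=> x; apply: ndF; near: x.
exact: nbhs_left_le.
Unshelve. all: by end_near. Qed.

HB.instance Definition _ := isCumulative.Build R _ R G ndG rcG.

(** Increments of [F] give the measure only between points where [G] and [F] agree; these are dense,
    so the vertices of a grid can be chosen among them. *)
Lemma monotone_measure : exists (nu : {measure set R -> \bar R}) (D : set R),
  (forall a b, a < b -> exists c, [/\ a < c, c < b & D c]) /\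
  (forall a b, D a -> D b -> a <= b -> nu `]a, b]%classic = (F b - F a)%:E).
Proof.
pose g : cumulative R R := G.
have mid : measurable_fun [set: measurableTypeR R] (idfun : measurableTypeR R -> R).
  by move=> _ A mA; rewrite setTI.
(* The pushforward along the identity only moves the measure from [measurableTypeR R] to the
   measurable structure of the statement. *)
exists (pushforward (lebesgue_stieltjes_measure g) (idfun : measurableTypeR R -> R)).
exists [set c | G c = F c]; split; first exact: right_continuity_dense.
move=> a b /= Ga Gb ab.
rewrite /pushforward preimage_id.
rewrite /lebesgue_stieltjes_measure /measure_extension measurable_mu_extE/=.
  by rewrite wlength_itv_bnd//= Ga Gb.
exact: is_ocitv.
Unshelve. all: exact: mid. Qed.

End MonotoneMeasure.

Section StepFunctions.
Variables (R : realType).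

Lemma exprz_ratio (x s r : R) (j : int) : 0 < x -> x <= s -> s <= r * x ->
  s ^ j <= r ^+ `|j| * x ^ j /\ x ^ j <= r ^+ `|j| * s ^ j.
Proof.
move=> x0 xs sr; have s0 : 0 < s by exact: lt_le_trans xs.
have r1 : 1 <= r by rewrite -(ler_pM2r x0) mul1r (le_trans xs).
have r0 : 0 < r by exact: lt_le_trans r1.
have h n : x ^+ n <= s ^+ n by rewrite lerXn2r// ?nnegrE ltW.
have h' n : s ^+ n <= r ^+ n * x ^+ n.
  by rewrite -exprMn lerXn2r// ?nnegrE ltW// mulr_gt0.
have r1n n : 1 <= r ^+ n by exact: exprn_ege1.
case: j => n.
  rewrite -!exprnP absz_nat; split => //; apply: le_trans (h n) _.
  by rewrite ler_peMl// exprn_ge0// ltW.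
rewrite NegzE abszN absz_nat -!exprnN; split.
  apply: (@le_trans _ _ (x ^- n.+1)).
    by rewrite lef_pV2 ?posrE ?exprn_gt0.
  by rewrite ler_peMl// invr_ge0 exprn_ge0// ltW.
rewrite -[leLHS]mul1r ler_pdivrMr ?exprn_gt0// mulrAC ler_pdivlMr ?exprn_gt0//.
by rewrite mul1r.
Qed.

(** The cells are half-open to the left, as the intervals on which [monotone_measure] evaluates the
    measure; the value is taken at the left end of each cell. *)
Definition grid_step (P : nat -> R) (N : nat) (j : int) (s : R) :=
  \sum_(i < N) P i ^ j * ((P i < s) && (s <= P i.+1))%:R.

Variable P : nat -> R.
Hypothesis ndP : forall i, P i <= P i.+1.

Let leP_ i k : (i <= k)%N -> P i <= P k.
Proof. by move=> ik; apply: (homo_leq (@lexx _ _) (@le_trans _ _)) ik. Qed.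

Lemma grid_step_in N j s : P 0%N < s -> s <= P N ->
  exists i, [/\ (i < N)%N, P i < s, s <= P i.+1 & grid_step P N j s = P i ^ j].
Proof.
move=> s0; elim: N => [|N IH] sN; first by move: (lt_le_trans s0 sN); rewrite ltxx.
have [sN'|Ns] := leP s (P N).
  have [i [iN h1 h2 h3]] := IH sN'; exists i; split => //; first exact: ltnW.
  by rewrite /grid_step big_ord_recr /= ltNge sN' mulr0 addr0.
exists N; split => //; rewrite /grid_step big_ord_recr /= Ns sN mulr1 big1 ?add0r//.
by move=> [i /= iN] _; rewrite [s <= _]leNgt (le_lt_trans (leP_ iN) Ns) andbF mulr0.
Qed.

Lemma grid_step_out N j s : ~~ ((P 0%N < s) && (s <= P N)) -> grid_step P N j s = 0.
Proof.
rewrite negb_and -leNgt -ltNge => h; rewrite /grid_step big1// => -[i /= iN] _.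
case/orP: h => h.
  by rewrite ltNge (le_trans h (leP_ (leq0n i))) mulr0.
by rewrite [s <= _]leNgt (le_lt_trans (leP_ iN) h) andbF mulr0.
Qed.

End StepFunctions.

Lemma measurable_exprz (R : realType) (j : int) :
  measurable_fun [set s : R | 0 < s] (fun s => s ^ j).
Proof.
have inv : measurable_fun [set s : R | 0 < s] (fun s => s^-1).
  apply: open_continuous_measurable_fun.
    by rewrite (_ : mkset _ = `]0, +oo[%classic) ?set_itvoy//; exact: open_gt.
  by move=> s; rewrite inE /= => s0; apply: inv_continuous; rewrite gt_eqF.
case: j => n; first exact: measurable_funX.
rewrite (_ : (fun s : R => s ^ _) = (fun s => s^-1 ^+ n.+1)); first exact: measurable_funX.
by apply/funext => s; rewrite NegzE -exprnN exprVn.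
Qed.

Section MomentTheorem.
Variables (R : realType) (b : int -> R).
Hypothesis b_pos : hankel_nonneg b.

(* [nu] has distribution function [F t = L 1_(s <= t)]. A step function on a
   geometric grid of ratio about [q] is comparable to [s ^ j] up to powers of [q],
   and it has the same integral against [nu] as against [L]; then [q] tends to 1. *)
Lemma two_sided_moments : two_sided_stieltjes b.
Proof.
have [B [L [bndB mB linB monL]]] := positive_functional b_pos.
have B0 : B (fun=> 0) by apply: (bndB _ 0) => s _; rewrite normr0.
have L0 : L (fun=> 0) = 0.
  have [_] := linB 1 _ _ B0 B0; under eq_fun do rewrite mulr0 addr0.
  by rewrite mul1r -[LHS]addr0 => /addrI.
have BZ a f : B f -> B (fun s => a * f s).
  move=> Bf; have [+ _] := linB a _ _ Bf B0; by under eq_fun do rewrite addr0.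
have LZ a f : B f -> L (fun s => a * f s) = a * L f.
  move=> Bf; have [_] := linB a _ _ Bf B0; under eq_fun do rewrite addr0.
  by rewrite L0 addr0.
have b_ge0 j : 0 <= b j.
  rewrite -L0 -(mB j).2; apply: monL => //; first by case: (mB j).
  by move=> s s0; rewrite exprz_ge0 ?ltW.
split => //.
pose F (t : R) := L (fun s => (s <= t)%R%:R).
have BF (t : R) : B (fun s => (s <= t)%R%:R).
  by apply: (bndB _ 1) => s _; case: (s <= t); rewrite ?normr1 ?normr0.
have ndF : nondecreasing F.
  move=> x y xy; apply: monL => // s _; rewrite ler_nat.
  by case: (leP s x) => // sx; rewrite (le_trans sx xy).
have [nu [D [Ddense nuD]]] := monotone_measure ndF.
exists nu => j.
pose pos := [set s : R | 0 < s].
have mpos : measurable pos.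
  by rewrite /pos -set_itvoy; exact: measurable_itv.
have mexp := @measurable_exprz R j; rewrite -/pos in mexp *.
have mEexp (A : set R) : A `<=` pos ->
    measurable_fun A (fun s : R => (s ^ j)%:E).
  by move=> Apos; apply/measurable_EFinP; exact: measurable_funS mexp.
set I : \bar R := (\int[nu]_(s in pos) _)%E.
have I_ge0 : (0 <= I)%E.
  by apply: integral_ge0 => s s0; rewrite lee_fin exprz_ge0 ?ltW.
have mstep (P : nat -> R) N (A : set R) : measurable_fun A (grid_step P N j).
  apply: measurable_funTS; apply: measurable_sum => i.
  apply: measurable_funM => //.
  rewrite (_ : (fun _ => _) = (\1_`]P i, P i.+1] : R -> R)).
    exact: measurable_indic.
  by apply/funext => s; rewrite indicE mem_setE in_itv.
(* Both sides equal the sum of [P i ^ j * (F (P i.+1) - F (P i))]: under [L], the indicator of a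
   cell is a difference of two functions defining [F]. *)
have Bstep (P : nat -> R) N : (forall i, D (P i)) -> (forall i, P i <= P i.+1) ->
    (forall i, 0 < P i) -> B (grid_step P N j) /\
    (\int[nu]_(s in pos) (grid_step P N j s)%:E = (L (grid_step P N j))%:E)%E.
  move=> DP ndP P0.
  have -> : (\int[nu]_(s in pos) (grid_step P N j s)%:E
      = (\sum_(i < N) P i ^ j * (F (P i.+1) - F (P i)))%:E)%E.
    transitivity (\int[nu]_(s in pos)
        \sum_(i < N) ((P i ^ j)%:E * (\1_`]P i, P i.+1]%classic s)%:E))%E.
      apply: eq_integral => s _; rewrite /grid_step -sumEFin.
      by apply: eq_bigr => i _; rewrite indicE mem_setE in_itv.
    have ind_ge0 (A : set R) s : (0 <= (\1_A s : R)%:E)%E by rewrite lee_fin.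
    have mind i : measurable_fun pos (fun s => (\1_`]P i, P i.+1]%classic s : R)%:E).
      by apply/measurable_EFinP; exact: measurable_indic.
    rewrite ge0_integral_sum//.
    - rewrite -sumEFin; apply: eq_bigr => i _.
      rewrite ge0_integralZl_EFin ?exprz_ge0 ?(ltW (P0 _))//.
      rewrite integral_indic//= setIidl ?nuD ?EFinM//.
      by move=> s /=; rewrite in_itv /= => /andP[+ _]; exact: lt_trans.
    - by move=> i; exact: measurable_funeM.
    - by move=> i s _; rewrite mule_ge0// lee_fin exprz_ge0// ltW.
  elim: N => [|N [IHB IHL]].
    rewrite big_ord0 (_ : grid_step P 0 j = (fun=> 0)) ?L0//.
    by apply/funext => s; rewrite /grid_step big_ord0.
  pose f (s : R) : R := -1 * (s <= P N)%R%:R + (s <= P N.+1)%R%:R.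
  have [Bf Lf] := linB (-1) _ _ (BF (P N)) (BF (P N.+1)).
  have -> : grid_step P N.+1 j = (fun s => P N ^ j * f s + grid_step P N j s).
    apply/funext => s; rewrite /grid_step big_ord_recr /= addrC; congr (_ * _ + _).
    rewrite /f ltNge; have [sP|sP] := leP s (P N).
      by rewrite (le_trans sP (ndP N)) mulr1 addNr.
    by rewrite mulr0 add0r.
  have [Bg Lg] := linB (P N ^ j) _ _ Bf IHB.
  split; first exact: Bg.
  rewrite /f Lg Lf; congr (_%:E); move: IHL => [<-].
  by rewrite big_ord_recr /= addrC mulN1r [- _ + _]addrC.
have key (q : R) : 1 < q -> ((b j)%:E <= (q ^+ (4 * `|j|))%:E * I /\
    I <= (q ^+ (4 * `|j|) * b j)%:E)%E.
  move=> q1; have q0 : 0 < q by exact: lt_trans q1.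
  have qn0 : q != 0 by rewrite gt_eqF.
  (* Points of [D] can only be chosen between powers of [q], so consecutive ones have ratio at most
     [r = q ^+ 2]. Each bound compares [s ^ j] with the step function twice, once under [L] and once
     under [nu]; hence the exponent [4 * |j|]. *)
  have /choice[p hp] (k : int) : exists c, [/\ q ^ k < c, c < q ^ (k + 1) & D c].
    by apply: Ddense; rewrite ltr_eXz2l// ltrDl.
  pose P (K : nat) (i : nat) := p (i%:Z - K%:Z).
  have p0 k : 0 < p k by have [h _ _] := hp k; apply: lt_trans h; exact: exprz_gt0.
  have pS k : p k <= p (k + 1).
    by have [_ h _] := hp k; have [h' _ _] := hp (k + 1); rewrite ltW// (lt_trans h).
  have pr k : p (k + 1) <= q ^+ 2 * p k.
    have [h _ _] := hp k; have [_ h' _] := hp (k + 1).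
    rewrite ltW// (lt_le_trans h')// -addrA expfzDr// mulrC -exprnP ler_pM2l ?exprn_gt0//.
    exact: ltW.
  have PS K i : P K i.+1 = p (i%:Z - K%:Z + 1) by congr p; lia.
  have ndP K i : P K i <= P K i.+1 by rewrite PS; exact: pS.
  have DP K i : D (P K i) by rewrite /P; have [] := hp (i%:Z - K%:Z).
  have P0 K i : 0 < P K i by exact: p0.
  pose g K := grid_step (P K) (K + K) j.
  have [r r_def] : exists r, r = q ^+ 2 by exists (q ^+ 2).
  have rE : q ^+ (4 * `|j|) = r ^+ `|j| * r ^+ `|j|.
    by rewrite r_def -!exprM -exprD; congr (_ ^+ _); lia.
  have rn0 : 0 < r ^+ `|j| by rewrite r_def !exprn_gt0.
  have gB K := @Bstep (P K) (K + K)%N (DP K) (ndP K) (P0 K).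
  have Bexp := (mB j).1.
  have g_le K s : 0 < s -> g K s <= r ^+ `|j| * s ^ j.
    move=> s0; have [/andP[h1 h2]|h] := boolP ((P K 0%N < s) && (s <= P K (K + K)%N)).
      have [i [_ h3 h4 h5]] := grid_step_in (ndP K) j h1 h2; rewrite /g h5.
      have [] := @exprz_ratio R (P K i) s r j (P0 K i) (ltW h3) => //.
      by rewrite r_def (le_trans h4)// PS pr.
    rewrite /g grid_step_out//; apply: mulr_ge0; first exact: ltW.
    by rewrite exprz_ge0 ?ltW.
  have g_ge K s : P K 0%N < s -> s <= P K (K + K)%N -> s ^ j <= r ^+ `|j| * g K s.
    move=> h1 h2; have [i [_ h3 h4 h5]] := grid_step_in (ndP K) j h1 h2.
    have [] := @exprz_ratio R (P K i) s r j (P0 K i) (ltW h3) => //.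
      by rewrite r_def (le_trans h4)// PS pr.
    by rewrite /g h5.
  have g_ge0 K s : 0 <= g K s.
    by rewrite /g /grid_step sumr_ge0// => i _; rewrite mulr_ge0// exprz_ge0 ?ltW.
  have Lg_le K : L (g K) <= r ^+ `|j| * b j.
    rewrite -(mB j).2 -LZ//; apply: monL; [exact: (gB K).1|exact: BZ|exact: g_le].
  have Lg_I K : ((L (g K))%:E <= (r ^+ `|j|)%:E * I)%E.
    rewrite -(gB K).2 -ge0_integralZl_EFin ?(ltW rn0)//.
    - apply: ge0_le_integral => //.
      + by move=> s _; rewrite lee_fin g_ge0.
      + by apply/measurable_EFinP; exact: mstep.
      + by apply: measurable_funeM; exact: mEexp.
      + by move=> s s0; rewrite -EFinM lee_fin g_le.
    - by move=> s s0; rewrite lee_fin exprz_ge0 ?ltW.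
    - exact: mEexp.
  have Plo K : P K 0%N <= q * (q ^+ K)^-1.
    rewrite /P sub0r; have [_ /ltW/le_trans h _] := hp (- K%:Z); apply: h.
    by rewrite expfzDr// mulrC -exprnN.
  have Phi K : (P K (K + K)%N)^-1 <= (q ^+ K)^-1.
    rewrite lef_pV2 ?posrE ?exprn_gt0// /P PoszD addrK exprnP.
    by have [/ltW] := hp K%:Z.
  split.
    rewrite rE; apply/lee_addgt0Pr => e e0.
    (* The parts of [s ^ j] above and below the grid cost at most [b (j + 1) / q ^ K] and
       [q * b (j - 1) / q ^ K]. *)
    pose c := b (j + 1) + q * b (j - 1).
    have c0 : 0 <= c by rewrite addr_ge0// mulr_ge0// ltW.
    have [K hK] : exists K : nat, (q ^+ K)^-1 * c <= e.
      have [K _ hK] : \forall K \near \oo, `|(q^-1) ^+ K| < e / (c + 1).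
        have := @cvg_expr R q^-1; rewrite ger0_norm ?invr_ge0 ?(ltW q0)// invf_lt1// q1.
        move=> /(_ isT)/cvgrPdist_lt/(_ (e / (c + 1))).
        rewrite divr_gt0 ?ltr_wpDl// => /(_ isT).
        by apply: filterS => K; rewrite sub0r normrN.
      exists K; have := hK K (leqnn K); rewrite exprVn.
      rewrite ger0_norm ?invr_ge0 ?exprn_ge0 ?(ltW q0)// => h.
      have : (q ^+ K)^-1 * c <= e / (c + 1) * (c + 1).
        by apply: ler_pM => //; rewrite ?invr_ge0 ?exprn_ge0 ?(ltW q0)// ?(ltW h)// lerDl.
      by rewrite divfK// gt_eqF// ltr_wpDl.
    have B1 := (mB (j + 1)).1; have B2 := (mB (j - 1)).1.
    have BgK := (gB K).1; rewrite -/(g K) in BgK.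
    have [Ba La] := linB (P K 0%N) _ _ B2 (BZ (r ^+ `|j|) _ BgK).
    have [Bb Lb] := linB (P K (K + K)%N)^-1 _ _ B1 Ba.
    (* Outside the grid, [s ^ j] is dominated by multiples of [s ^ (j + 1)] and [s ^ (j - 1)]. *)
    have bj : b j <= r ^+ `|j| * L (g K) + (q ^+ K)^-1 * c.
      rewrite -(mB j).2.
      apply: (@le_trans _ _ (L (fun s => (P K (K + K)%N)^-1 * s ^ (j + 1) +
          (P K 0%N * s ^ (j - 1) + r ^+ `|j| * g K s)))).
        apply: monL => // s s0.
        have sj k : 0 <= s ^ k by rewrite exprz_ge0 ?ltW.
        have t1 : 0 <= (P K (K + K)%N)^-1 * s ^ (j + 1) by rewrite mulr_ge0// invr_ge0 ltW.
        have t2 : 0 <= P K 0%N * s ^ (j - 1) by rewrite mulr_ge0// ltW.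
        have t3 : 0 <= r ^+ `|j| * g K s by rewrite mulr_ge0 ?(ltW rn0).
        have sn0 : s != 0 by rewrite gt_eqF.
        have [h1|h1] := leP s (P K 0%N).
          apply: ler_wpDl => //; apply: ler_wpDr => //.
          have -> : s ^ j = s * s ^ (j - 1).
            by rewrite -{2}(expr1z s) -expfzDr// addrCA subrr addr0.
          exact: ler_wpM2r.
        have [h2|h2] := leP s (P K (K + K)%N).
          by rewrite addrA; apply: ler_wpDl; [exact: addr_ge0|exact: g_ge].
        apply: ler_wpDr; first exact: addr_ge0.
        rewrite expfzDr// expr1z mulrC -mulrA; apply: ler_peMr => //.
        by rewrite ler_pdivlMr// mul1r ltW.
      rewrite Lb La LZ// (mB _).2 (mB _).2 addrA addrC lerD2l.
      rewrite /c mulrDr; apply: lerD; first by rewrite ler_wpM2r.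
      by rewrite mulrA ler_wpM2r// mulrC.
    apply: (@le_trans _ _ (r ^+ `|j| * L (g K) + e)%:E).
      by rewrite lee_fin (le_trans bj)// lerD2l.
    rewrite EFinD leeD2r// EFinM EFinM -muleA.
    by apply: lee_wpmul2l; [rewrite lee_fin ltW|exact: Lg_I].
  (* For the other inequality, the integrals over [A K] increase to [I], and on [A K] the power is
     at most [r ^+ |j|] times the step function. *)
  pose A K := `]P K 0%N, P K (K + K)%N]%classic.
  have Apos K : A K `<=` pos.
    by move=> s; rewrite /A /= in_itv /= => /andP[h _]; apply: lt_trans h.
  have mA K : measurable (A K) by exact: measurable_itv.
  have pmono k l : (k <= l)%R -> p k <= p l.
    move=> kl; have -> : l = k + `|(l - k)%R|%N%:Z by lia.
    elim: `|_|%N => [|n IH]; first by rewrite addr0.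
    by apply: le_trans IH _; rewrite -addn1 PoszD addrA pS.
  have AI : \bigcup_K A K = pos.
    apply/seteqP; split => [s [K _ /Apos]//|s /= s0].
    have qinv : (fun K : nat => q * q^-1 ^+ K) @ \oo --> 0.
      rewrite -[X in _ --> X](mulr0 q); apply: cvgMr; apply: cvg_expr.
      by rewrite ger0_norm ?invr_ge0 ?(ltW q0)// invf_lt1.
    have [K _ /(_ K (leqnn K)) hK] : \forall K \near \oo,
        q * q^-1 ^+ K < s /\ q * q^-1 ^+ K < s^-1.
      by near=> K; split; near: K; apply: (cvgr_lt _ qinv); rewrite ?invr_gt0.
    exists K => //; rewrite /A /= in_itv /=; apply/andP; split.
      by rewrite (le_lt_trans (Plo K))// -exprVn; case: hK.
    rewrite -lef_pV2 ?posrE// (le_trans (Phi K))// (le_trans _ (ltW hK.2))//.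
    by rewrite -exprVn ler_peMl ?exprn_ge0 ?invr_ge0 ?(ltW q0)// ltW.
  have IA : (\int[nu]_(s in A K) (s ^ j)%:E @[K --> \oo] --> I)%E.
    rewrite /I -AI; apply: ge0_nondecreasing_set_cvg_integral.
    - move=> m n mn; apply/subsetPset => s; rewrite /A /= !in_itv /= => /andP[h1 h2].
      apply/andP; split.
        by rewrite (le_lt_trans _ h1)// /P; apply: pmono; lia.
      by rewrite (le_trans h2)// /P; apply: pmono; lia.
    - exact: mA.
    - by move=> K; apply: mEexp; exact: Apos.
    - by move=> K s /Apos /= s0; rewrite lee_fin exprz_ge0 ?ltW.
  apply: (cvge_le _ IA); apply: nearW => K.
  apply: (@le_trans _ _ (\int[nu]_(s in pos) ((r ^+ `|j|)%:E * (g K s)%:E))%E).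
    apply: (@le_trans _ _ (\int[nu]_(s in A K) ((r ^+ `|j|)%:E * (g K s)%:E))%E).
      apply: ge0_le_integral => //.
      + by move=> s /Apos /= s0; rewrite lee_fin exprz_ge0 ?ltW.
      + apply: mEexp; exact: Apos.
      + by apply: measurable_funeM; apply/measurable_EFinP; exact: mstep.
      + move=> s; rewrite /A /= in_itv /= => /andP[h1 h2].
        by rewrite -EFinM lee_fin; exact: g_ge.
    apply: ge0_subset_integral => //.
      by apply: measurable_funeM; apply/measurable_EFinP; exact: mstep.
    by move=> s _; rewrite mule_ge0 ?lee_fin ?g_ge0 ?(ltW rn0).
  rewrite ge0_integralZl_EFin ?(ltW rn0)//.
  - by rewrite (gB K).2 -EFinM lee_fin rE -mulrA ler_pM2l// Lg_le.
  - by move=> s _; rewrite lee_fin g_ge0.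
  - by apply/measurable_EFinP; exact: mstep.
have root (e : R) : 1 < e -> exists2 q : R, 1 < q & q ^+ (4 * `|j|) <= e.
  move=> e1; have e0 : 0 < e by exact: lt_trans e1.
  (* The successor in the exponent avoids a division by zero when [j = 0]. *)
  pose q := e `^ (4 * `|j|).+1%:R^-1.
  have q0 : 0 <= q by exact: powR_ge0.
  have qe : q ^+ (4 * `|j|).+1 = e.
    by rewrite -powR_mulrn// /q -powRrM mulVf// powRr1// ltW.
  have q1 : 1 < q.
    rewrite ltNge; apply/negP => q1; have := exprn_ile1 (4 * `|j|).+1 q0 q1.
    by rewrite qe leNgt e1.
  by exists q => //; rewrite -qe exprS ler_peMl ?exprn_ge0// ltW.
have Ifin : I \is a fin_num.
  have [q q1 _] := root 2 (ltr1n _ 2); have [_ h] := key q q1.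
  by rewrite ge0_fin_numE// (le_lt_trans h)// ltry.
rewrite -(fineK Ifin); congr (_%:E); move: key; rewrite -(fineK Ifin) => key.
have scal (x y : R) : 0 <= y ->
    (forall q, 1 < q -> x <= q ^+ (4 * `|j|) * y) -> x <= y.
  move=> y0 h; apply/ler_addgt0Pr => e e0.
  have [|q q1 qe] := root (1 + e / (y + 1)).
    by rewrite ltrDl divr_gt0// ltr_wpDl.
  rewrite (le_trans (h q q1))// (le_trans (ler_wpM2r y0 qe))//.
  rewrite mulrDl mul1r lerD2l mulrAC ler_pdivrMr ?ltr_wpDl//.
  by rewrite ler_pM2l// lerDl.
apply/eqP; rewrite eq_le; apply/andP; split; apply: scal => //.
- by rewrite /= fine_ge0.
- by move=> q /key[]; rewrite -EFinM lee_fin.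
- by move=> q /key[_]; rewrite lee_fin.
Unshelve. all: by end_near. Qed.

End MomentTheorem.

(** * The Hilbert space of square-integrable functions *)

Section RealL2.
Context d (T : measurableType d) (R : realType).
Variable rho : {measure set T -> \bar R}.
Implicit Types f g h : T -> R.

Definition sqint f := measurable_fun [set: T] f /\
  (\int[rho]_t ((f t) ^+ 2)%:E < +oo)%E.

Definition ipR f g : R := Rintegral rho [set: T] (fun t => f t * g t).

Lemma sqr_integral f : sqint f -> (\int[rho]_t ((f t) ^+ 2)%:E)%E = (ipR f f)%:E.
Proof.
move=> [mf foo]; rewrite /ipR /Rintegral fineK; first by under eq_integral do rewrite expr2.
under eq_integral do rewrite -expr2; rewrite ge0_fin_numE// integral_ge0// => t _.
by rewrite lee_fin sqr_ge0.
Qed.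

Lemma measurable_sqrE f : measurable_fun [set: T] f ->
  measurable_fun [set: T] (fun t => ((f t) ^+ 2)%:E).
Proof. by move=> mf; apply/measurable_EFinP; exact: measurable_funX. Qed.

Lemma sqintM f g : sqint f -> sqint g ->
  rho.-integrable [set: T] (EFin \o (fun t => f t * g t)).
Proof.
move=> [mf fi] [mg gi].
apply: (@le_integrable _ _ _ rho _ measurableT _ (fun t => ((f t) ^+ 2)%:E + ((g t) ^+ 2)%:E)%E).
- by apply/measurable_EFinP; exact: measurable_funM.
- move=> t _; rewrite -EFinD /= lee_fin normrM [leRHS]ger0_norm ?addr_ge0 ?sqr_ge0//.
  rewrite -[f t ^+ 2]real_normK ?num_real// -[g t ^+ 2]real_normK ?num_real//.
  have := sqr_ge0 (`|f t| - `|g t|); have := normr_ge0 (f t); have := normr_ge0 (g t); nra.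
- apply: integrableD => //; apply/integrableP; split; first exact: measurable_sqrE.
  + by under eq_integral do rewrite /= ger0_norm ?sqr_ge0//.
  + exact: measurable_sqrE.
  + by under eq_integral do rewrite /= ger0_norm ?sqr_ge0//.
Qed.

Lemma sqint_le f g : measurable_fun [set: T] f -> sqint g ->
  (forall t, `|f t| <= `|g t|) -> sqint f.
Proof.
move=> mf [mg gi] fg; split=> //; apply: le_lt_trans gi.
apply: ge0_le_integral => //.
- by move=> t _; rewrite lee_fin sqr_ge0.
- exact: measurable_sqrE.
- exact: measurable_sqrE.
- move=> t _; rewrite lee_fin -[leLHS]real_normK ?num_real//.
  by rewrite -[leRHS]real_normK ?num_real// lerXn2r ?nnegrE.
Qed.

Lemma sqint0 : sqint (fun=> 0).
Proof. by split=> //; under eq_integral do rewrite expr0n/=; rewrite integral0. Qed.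

Lemma sqintZ a f : sqint f -> sqint (fun t => a * f t).
Proof.
move=> [mf fi]; split; first exact: measurable_funM.
under eq_integral do rewrite exprMn EFinM.
rewrite ge0_integralZl_EFin ?sqr_ge0//.
- apply: lte_mul_pinfty => //; first by rewrite lee_fin sqr_ge0.
- by move=> t _; rewrite lee_fin sqr_ge0.
- exact: measurable_sqrE.
Qed.

Lemma sqintD f g : sqint f -> sqint g -> sqint (fun t => f t + g t).
Proof.
move=> sf sg; have [mf fi] := sf; have [mg gi] := sg.
split; first exact: measurable_funD.
apply: (@le_lt_trans _ _ (\int[rho]_t ((2%:E * ((f t) ^+ 2)%:E + 2%:E * ((g t) ^+ 2)%:E)))%E).
  apply: ge0_le_integral => //.
  - by move=> t _; rewrite lee_fin sqr_ge0.
  - by apply: measurable_sqrE; exact: measurable_funD.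
  - by apply: emeasurable_funD; apply: measurable_funeM; exact: measurable_sqrE.
  - move=> t _; rewrite -!EFinM -EFinD lee_fin.
    by have := sqr_ge0 (f t - g t); nra.
have pos h t : (0 <= ((h t) ^+ 2)%:E :> \bar R)%E by rewrite lee_fin sqr_ge0.
rewrite ge0_integralD//; last 4 first.
- by move=> t _; rewrite mule_ge0// lee_fin.
- by apply: measurable_funeM; exact: measurable_sqrE.
- by move=> t _; rewrite mule_ge0// lee_fin.
- by apply: measurable_funeM; exact: measurable_sqrE.
rewrite !ge0_integralZl_EFin//; try exact: measurable_sqrE.
by rewrite lte_add_pinfty// lte_mul_pinfty// lee_fin.
Qed.

Lemma sqintB f g : sqint f -> sqint g -> sqint (fun t => f t - g t).
Proof.
move=> sf sg; have := sqintD sf (sqintZ (-1) sg).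
by under eq_fun do rewrite mulN1r.
Qed.

Lemma ipRC f g : ipR f g = ipR g f.
Proof. by apply: eq_Rintegral => t _; rewrite mulrC. Qed.

Lemma ipRDl f g h : sqint f -> sqint g -> sqint h ->
  ipR (fun t => f t + g t) h = ipR f h + ipR g h.
Proof.
move=> sf sg sh; rewrite /ipR -RintegralD//; try exact: sqintM.
by apply: eq_Rintegral => t _; rewrite mulrDl.
Qed.

Lemma ipRZl a f h : sqint f -> sqint h ->
  ipR (fun t => a * f t) h = a * ipR f h.
Proof.
move=> sf sh; rewrite /ipR -RintegralZl//; try exact: sqintM.
by apply: eq_Rintegral => t _; rewrite mulrA.
Qed.

Lemma ipRBl f g h : sqint f -> sqint g -> sqint h ->
  ipR (fun t => f t - g t) h = ipR f h - ipR g h.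
Proof.
move=> sf sg sh; rewrite -[- ipR g h]mulN1r -ipRZl// -ipRDl//; last exact: sqintZ.
by congr (ipR _ h); apply/funext => t; rewrite mulN1r.
Qed.

Lemma ipR_ge0 f : 0 <= ipR f f.
Proof. by apply: Rintegral_ge0 => t _; rewrite -expr2 sqr_ge0. Qed.

(** Riesz-Fischer. Along a subsequence the differences [D k] have squared norm at most [8^-k], so
    the sum of [4^k (D k)^2] is integrable and almost everywhere finite; there [|D k|] is at most a
    constant times [2^-k], and the subsequence converges pointwise. *)
Lemma sqint_complete (u : nat -> T -> R) : (forall n, sqint (u n)) ->
  (forall e : R, 0 < e -> exists N : nat, forall m n, (N <= m)%N -> (N <= n)%N ->
     ipR (fun t => u m t - u n t) (fun t => u m t - u n t) < e) ->
  exists l, sqint l /\ forall e : R, 0 < e -> exists N : nat, forall n, (N <= n)%N ->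
     ipR (fun t => u n t - l t) (fun t => u n t - l t) < e.
Proof.
move=> su cu.
pose N2 f : \bar R := (\int[rho]_t ((f t) ^+ 2)%:E)%E.
have N2E f : sqint f -> N2 f = (ipR f f)%:E by exact: sqr_integral.
have su' m n : sqint (fun t => u m t - u n t) by exact: sqintB.
have /choice[r hr] (k : nat) : exists N : nat, forall m n, (N <= m)%N -> (N <= n)%N ->
     ipR (fun t => u m t - u n t) (fun t => u m t - u n t) < 8^-1 ^+ k.
  by apply: cu; rewrite exprn_gt0.
pose s k := (\sum_(i < k.+1) r i)%N.
have rs k : (r k <= s k)%N by rewrite /s big_ord_recr /= leq_addl.
have ss k : (s k <= s k.+1)%N by rewrite /s [X in (_ <= X)%N]big_ord_recr /= leq_addr.
pose v k := u (s k).
pose D k t := v k.+1 t - v k t.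
have sv k : sqint (v k) by exact: su.
have sD k : sqint (D k) by exact: su'.
have hD k : (N2 (D k) <= ((8^-1) ^+ k)%:E)%E.
  by rewrite N2E// lee_fin ltW// hr// (leq_trans (rs k)).
pose F k t : \bar R := ((4 ^+ k) * (D k t) ^+ 2)%:E.
have F0 k t : (0 <= F k t)%E by rewrite lee_fin mulr_ge0 ?sqr_ge0// exprn_ge0.
have mF k : measurable_fun [set: T] (F k).
  by apply/measurable_EFinP; apply: measurable_funM => //; apply: measurable_funX; case: (sD k).
have intF : (\int[rho]_t (\sum_(k <oo) F k t) < +oo)%E.
  rewrite integral_nneseries//.
  apply: (@le_lt_trans _ _ (\sum_(k <oo) ((2^-1) ^+ k)%:E)%E).
    apply: lee_nneseries => k _; first by rewrite integral_ge0.
    rewrite /F; under eq_integral do rewrite EFinM.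
    rewrite ge0_integralZl_EFin ?exprn_ge0//.
    - apply: (@le_trans _ _ ((4 ^+ k)%:E * ((8^-1) ^+ k)%:E)%E).
        by rewrite lee_wpmul2l ?lee_fin ?exprn_ge0//; exact: hD.
      rewrite -EFinM lee_fin -exprMn lerXn2r// ?nnegrE; lra.
    - by move=> t _; rewrite lee_fin sqr_ge0.
    - by apply: measurable_sqrE; case: (sD k).
  suff -> : (\sum_(k <oo) ((2^-1 : R) ^+ k)%:E = 2%:E)%E by rewrite ltry.
  have /cvg_lim h := @cvg_geometric_eseries_half R 2 0.
  transitivity (limn (eseries (fun k => (2 / (2 ^ (k + 1))%:R : R)%:E))).
    apply: eq_eseriesr => k _; congr (_%:E).
    by rewrite addn1 expnS natrM invfM mulrA divff// mul1r exprVn natrX.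
  by rewrite h// expr0 divr1.
have fG : {ae rho, forall t, [set: T] t -> (\sum_(k <oo) F k t)%E \is a fin_num}.
  apply: integrable_ae => //; apply/integrableP; split.
    exact: ge0_emeasurable_sum.
  by under eq_integral do rewrite gee0_abs ?nneseries_ge0//.
(* An upper limit is measurable without knowing where the sequence converges; [fine] supplies a real
   value elsewhere. *)
pose l t := fine (limn_esup (fun k => (v k t)%:E)).
have ml : measurable_fun [set: T] l.
  apply: measurableT_comp => //; apply: measurable_fun_limn_esup => k.
  by apply/measurable_EFinP; case: (sv k).
have vl t : (\sum_(k <oo) F k t)%E \is a fin_num -> v k t @[k --> \oo] --> l t.
  move=> gfin; set g := (\sum_(k <oo) F k t)%E in gfin.
  have FD k : `|D k t| <= Num.sqrt (fine g) * 2^-1 ^+ k.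
    have : (F k t <= (fine g)%:E)%E.
      rewrite fineK//; apply: le_trans (nneseries_lim_ge k.+1 _); last by move=> i _ _.
      by rewrite big_nat_recr//= leeDr// sume_ge0.
    rewrite lee_fin => h.
    have g0 : 0 <= fine g by rewrite fine_ge0// nneseries_ge0.
    rewrite -(@ler_pXn2r _ 2)// ?nnegrE ?mulr_ge0 ?sqrtr_ge0 ?exprn_ge0//.
    rewrite exprMn sqr_sqrtr// real_normK ?num_real//.
    rewrite -exprM mulnC exprM exprVn -natrX.
    by rewrite exprVn ler_pdivlMr ?exprn_gt0// mulrC.
  have cv : cvgn (v ^~ t).
    have -> : v ^~ t = (fun n => v 0%N t + series (D ^~ t) n).
      by apply/funext => n; rewrite /series /= telescope_sumr// addrC subrK.
    apply: is_cvgD; first exact: is_cvg_cst.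
    apply: normed_cvg; apply: series_le_cvg FD _.
    - by move=> n.
    - by move=> n; rewrite mulr_ge0 ?sqrtr_ge0 ?exprn_ge0.
    - by apply: is_cvg_geometric_series; rewrite ger0_norm// invf_lt1// ltr1n.
  have vE : (v k t)%:E @[k --> \oo] --> (limn (v ^~ t))%:E.
    by apply: cvg_EFin; [exact: nearW|exact: cv].
  by rewrite /l (cvg_limn_einf_sup vE).2.
(* Fatou's lemma along the subsequence, with [u m] fixed. *)
have key j m : (r j <= m)%N -> (N2 (fun t => (u m t - l t)%R) <= ((8^-1) ^+ j)%:E)%E.
  move=> jm.
  have mum k : measurable_fun [set: T] (fun t => ((u m t - v k t) ^+ 2)%:E).
    by apply: measurable_sqrE; case: (su' m (s k)).
  apply: (@le_trans _ _ (\int[rho]_t limn_einf (fun k => ((u m t - v k t) ^+ 2)%R%:E))%E).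
    apply: ae_ge0_le_integral => //.
    - by move=> t _; rewrite lee_fin sqr_ge0.
    - by apply: measurable_sqrE; apply: measurable_funB => //; case: (su m).
    - move=> t _; rewrite limn_einf_lim; apply: lime_ge; first exact: is_cvg_einfs.
      apply: nearW => k; apply: le_ereal_inf_tmp => _ [i _ <-].
      by rewrite lee_fin sqr_ge0.
    - rewrite /limn_einf; apply: measurableT_comp => //.
      apply: measurable_fun_limn_esup => k; exact: measurableT_comp.
    apply: filterS fG => t /(_ I)/vl vt _.
    have h : ((u m t - v k t) ^+ 2)%:E @[k --> \oo] --> ((u m t - l t) ^+ 2)%:E.
      apply: cvg_EFin; first exact: nearW.
      by rewrite expr2; under eq_fun do rewrite /= expr2;
        apply: cvgM; apply: cvgB => //; exact: cvg_cst.
    by rewrite (cvg_limn_einf_sup h).1.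
  apply: le_trans (fatou _ _ _ _) _ => //.
    by move=> k t _; rewrite lee_fin sqr_ge0.
  rewrite limn_einf_lim; apply: lime_le; first exact: is_cvg_einfs.
  near=> k; apply: (@le_trans _ _ (N2 (fun t => (u m t - v k t)%R))).
    by apply: ereal_inf_lbound; exists k => /=.
  rewrite N2E; last exact: su'.
  rewrite lee_fin ltW// hr//.
  apply: (leq_trans (rs j)).
  have jk : (j <= k)%N by near: k; exact: nbhs_infty_ge.
  exact: (homo_leq (@leqnn) (@leq_trans) ss).
have sul j m : (r j <= m)%N -> sqint (fun t => u m t - l t).
  move=> jm; split; first by apply: measurable_funB => //; case: (su m).
  by apply: le_lt_trans (key j m jm) _; rewrite ltry.
exists l; split.
  have := sqintB (su (r 0%N)) (sul 0%N _ (leqnn _)).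
  by under eq_fun do rewrite opprB addrC subrK.
move=> e e0.
have [j hj] : exists j : nat, (8^-1) ^+ j < e.
  have [j _ /(_ j (leqnn j)) hj] : \forall j \near \oo, `|(8^-1 : R) ^+ j| < e.
    have := @cvg_expr R 8^-1; rewrite ger0_norm// invf_lt1// ltr1n.
    move=> /(_ isT)/cvgrPdist_lt/(_ e e0).
    by apply: filterS => K; rewrite sub0r normrN.
  by exists j; rewrite ger0_norm ?exprn_ge0 in hj.
exists (r j) => m jm; rewrite -lte_fin -N2E; last exact: sul jm.
by apply: le_lt_trans (key j m jm) _; rewrite lte_fin.
Unshelve. all: by end_near. Qed.

End RealL2.

(** * Hilbert space of a complete semi-definite form *)

Section Separation.
Variables (R : realType) (E0 : lmodType R[i]) (P : set E0) (s : E0 -> E0 -> R[i]).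
Hypothesis P0 : P 0.
Hypothesis PL : forall (a : R[i]) f g, P f -> P g -> P (a *: f + g).
Hypothesis s_linear : forall (a : R[i]) f g h, P f -> P g -> P h ->
  s (a *: f + g) h = a * s f h + s g h.
Hypothesis s_conj : forall f g, P f -> P g -> s g f = conjc (s f g).
Hypothesis s_pos : forall f, P f -> 0 <= s f f.
Hypothesis s_complete : forall u : nat -> E0, (forall n, P (u n)) ->
  (forall e : R, 0 < e -> exists N : nat, forall m n, (N <= m)%N -> (N <= n)%N ->
    complex.Re (s (u m - u n) (u m - u n)) < e) ->
  exists2 l, P l & forall e : R, 0 < e -> exists N : nat, forall n, (N <= n)%N ->
    complex.Re (s (u n - l) (u n - l)) < e.

(* The separated quotient is realised inside [E0 -> R[i]] by [f |-> <f, .>]. *)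
Let form f : E0 -> R[i] := fun g => if `[< P g >] then s f g else 0.

Definition form_image : {pred (E0 -> R[i])} :=
  mem [set F | exists2 f, P f & F = form f].

Let formL a f g : P f -> P g -> form (a *: f + g) = a *: form f + form g.
Proof.
move=> Pf Pg; apply/funext => h; rewrite /form !fctE /=.
by case: asboolP => [Ph|_]; [exact: s_linear|rewrite scaler0 addr0].
Qed.

Let form_image_submod : submod_closed form_image.
Proof.
split.
  rewrite inE /=; exists 0 => //.
  by have := formL 1 P0 P0; rewrite scaler0 addr0 scale1r -[LHS]addr0 => /addrI.
move=> a _ _ /[!inE] /= -[f Pf ->] [g Pg ->].
by exists (a *: f + g); [exact: PL|rewrite formL].
Qed.

HB.instance Definition _ := GRing.isSubmodClosed.Build _ _ form_image form_image_submod.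

Definition separated := {F : E0 -> R[i] | F \in form_image}.
HB.instance Definition _ := SubChoice.on separated.
HB.instance Definition _ := [SubChoice_isSubLmodule of separated by <:].

(** Elements with the same image have the same products with all of [P], so the form descends to the
    image. A null vector is orthogonal to everything, hence has image 0; completeness is inherited
    through representatives. *)
Lemma separation : exists (K : lmodType R[i]) (H : hilbert_structure K) (pi : E0 -> K),
  [/\ forall (a : R[i]) f g, P f -> P g -> pi (a *: f + g) = a *: pi f + pi g,
      forall x, exists2 f, P f & pi f = x &
      forall f g, P f -> P g -> ip H (pi f) (pi g) = s f g].
Proof.
pose pi f : separated := insubd (0 : separated) (form f).
have piE f : P f -> val (pi f) = form f.
  by move=> Pf; rewrite val_insubd ifT// inE /=; exists f.
have piL a f g : P f -> P g -> pi (a *: f + g) = a *: pi f + pi g.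
  move=> Pf Pg; apply: val_inj.
  by rewrite /= !piE ?formL ?piE//; exact: PL.
have pi_surj x : exists f, P f /\ pi f = x.
  have := valP x; rewrite inE /= => -[f Pf xE]; exists f; split=> //.
  by apply: val_inj; rewrite piE.
have [rep hrep] := choice pi_surj.
have Prep x : P (rep x) by case: (hrep x).
have repK x : pi (rep x) = x by case: (hrep x).
have s_pi f g h : P f -> P g -> P h -> pi f = pi g -> s f h = s g h.
  move=> Pf Pg Ph /(congr1 val); rewrite !piE// => /(congr1 (fun F => F h)).
  by rewrite /form asboolT.
pose ipK (x y : separated) := s (rep x) (rep y).
have ipE f g : P f -> P g -> ipK (pi f) (pi g) = s f g.
  move=> Pf Pg; rewrite /ipK (s_pi _ f)//.
  by rewrite s_conj// (s_pi _ g) ?repK// -s_conj.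
have linK (a : R[i]) (x y z : separated) : ipK (a *: x + y) z = a * ipK x z + ipK y z.
  by rewrite -(repK x) -(repK y) -(repK z) -piL// !ipE ?s_linear//; exact: PL.
have conjK x y : ipK y x = conjc (ipK x y) by exact: s_conj.
have posK x : 0 <= ipK x x by exact: s_pos.
have PB f g : P f -> P g -> P (f - g).
  by move=> Pf Pg; rewrite addrC -scaleN1r; exact: PL.
have piB f g : P f -> P g -> pi (f - g) = pi f - pi g.
  by move=> Pf Pg; rewrite addrC -scaleN1r piL// scaleN1r addrC.
have defK x : ipK x x = 0 -> x = 0.
  rewrite -(repK x); set f := rep x => sf0; have Pf : P f by exact: Prep.
  rewrite ipE// in sf0.
  have sf h : P h -> s f h = 0.
    (* Cauchy-Schwarz for the degenerate form [s]. *)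
    move=> Ph; pose z := s f h; pose c := complex.Re (s h h).
    have q (t : R) : 0 <= c - 2 * t * (complex.Re z ^+ 2 + complex.Im z ^+ 2).
      pose a := - (t%:C%C * conjc z).
      have := s_pos (PL a Pf Ph); rewrite s_linear//; last exact: PL.
      rewrite (s_conj (PL a Pf Ph) Pf) (s_conj (PL a Pf Ph) Ph) !s_linear// sf0.
      rewrite (s_conj Pf Ph) -/z; have := s_pos Ph; rewrite /c /a.
      case: (z) (s h h) => [x1 x2] [y1 y2]; rewrite !lecE /= => /andP[_ _] /andP[_].
      congr (0 <= _); ring.
    set n2 := _ + _ in q; have n20 : 0 <= n2 by rewrite addr_ge0 ?sqr_ge0.
    have : n2 = 0.
      apply/eqP/negPn/negP => n2N0; have := q ((c + 1) / (2 * n2)).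
      have -> : 2 * ((c + 1) / (2 * n2)) * n2 = c + 1 by field.
      lra.
    rewrite -/z /n2; case: (z) => a b /= /eqP.
    rewrite paddr_eq0 ?sqr_ge0// !sqrf_eq0 => /andP[/eqP-> /eqP->].
    by [].
  apply: val_inj; rewrite piE//=; apply/funext => h; rewrite /form.
  by case: asboolP => // /sf.
have compK (u : nat -> separated) :
    (forall e : R, 0 < e -> exists N : nat, forall m n, (N <= m)%N -> (N <= n)%N ->
        complex.Re (ipK (u m - u n) (u m - u n)) < e) ->
    exists l, forall e : R, 0 < e -> exists N : nat, forall n, (N <= n)%N ->
        complex.Re (ipK (u n - l) (u n - l)) < e.
  move=> cu.
  have E f g : P f -> P g -> ipK (pi f - pi g) (pi f - pi g) = s (f - g) (f - g).
    by move=> Pf Pg; rewrite -piB// ipE//; exact: PB.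
  have [|e /cu[N hN]|l Pl hl] := s_complete (u := rep \o u).
  - by move=> n; exact: Prep.
  - by exists N => m n Nm Nn; rewrite /= -E// !repK; exact: hN.
  exists (pi l) => e /hl[N hN]; exists N => n Nn.
  by rewrite -(repK (u n)) E//; exact: hN.
exists separated, (HilbertStructure linK conjK posK defK compK), pi; split => //.
by move=> x; exists (rep x).
Qed.

End Separation.

Section ComplexL2.
Context d (T : measurableType d) (R : realType).
Variable rho : {measure set T -> \bar R}.

Let re (f : T -> R[i]) : T -> R := fun t => complex.Re (f t).
Let im (f : T -> R[i]) : T -> R := fun t => complex.Im (f t).

Definition csqint (f : T -> R[i]) :=
  sqint rho (fun t => complex.Re (f t)) /\ sqint rho (fun t => complex.Im (f t)).

(** The integral of [f] times the conjugate of [g], expanded into real and imaginary parts. *)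
Definition ipC (f g : T -> R[i]) : R[i] :=
  Complex (ipR rho (re f) (re g) + ipR rho (im f) (im g))
          (ipR rho (im f) (re g) - ipR rho (re f) (im g)).

Lemma csqint_linear (a : R[i]) (f g : T -> R[i]) :
  csqint f -> csqint g -> csqint (a *: f + g).
Proof.
move=> [f1 f2] [g1 g2]; case: a => a b; split.
  have := sqintD (sqintB (sqintZ a f1) (sqintZ b f2)) g1.
  congr sqint; apply/funext => t; rewrite !fctE /=.
  by case: (f t) (g t) => [? ?] [? ?].
have := sqintD (sqintD (sqintZ a f2) (sqintZ b f1)) g2.
congr sqint; apply/funext => t; rewrite !fctE /=.
by case: (f t) (g t) => [? ?] [? ?].
Qed.

Lemma csqint0 : csqint 0.
Proof. by split; exact: sqint0. Qed.

Lemma ipC_linear (a : R[i]) f g h : csqint f -> csqint g -> csqint h ->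
  ipC (a *: f + g) h = a * ipC f h + ipC g h.
Proof.
move=> [f1 f2] [g1 g2] [h1 h2]; case: a => a b.
have E1 k : sqint rho k -> ipR rho (re ((a +i* b)%C *: f + g)) k
   = a * ipR rho (re f) k - b * ipR rho (im f) k + ipR rho (re g) k.
  move=> sk; rewrite -!ipRZl// -ipRBl//; try exact: sqintZ.
  rewrite -ipRDl//; last by apply: sqintB; exact: sqintZ.
  congr (ipR rho _ k); apply/funext => t; rewrite /re /im !fctE /=.
  by case: (f t) (g t) => [? ?] [? ?].
have E2 k : sqint rho k -> ipR rho (im ((a +i* b)%C *: f + g)) k
   = a * ipR rho (im f) k + b * ipR rho (re f) k + ipR rho (im g) k.
  move=> sk; rewrite -!ipRZl// -ipRDl//; try exact: sqintZ.
  rewrite -ipRDl//; last by apply: sqintD; exact: sqintZ.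
  congr (ipR rho _ k); apply/funext => t; rewrite /re /im !fctE /=.
  by case: (f t) (g t) => [? ?] [? ?].
rewrite /ipC !E1// !E2//; apply/eqP; rewrite eq_complex /=.
by apply/andP; split; apply/eqP; ring.
Qed.

Lemma ipC_conj f g : ipC g f = conjc (ipC f g).
Proof.
rewrite /ipC /= (ipRC _ (re g)) (ipRC _ (im g) (im f)); congr Complex.
by rewrite opprB (ipRC _ (im g)) (ipRC _ (re g)).
Qed.

Lemma ipC_pos f : 0 <= ipC f f.
Proof. by rewrite lecE /= ipRC subrr eqxx addr_ge0// ipR_ge0. Qed.

Lemma ipC_complete (u : nat -> T -> R[i]) : (forall n, csqint (u n)) ->
  (forall e : R, 0 < e -> exists N : nat, forall m n, (N <= m)%N -> (N <= n)%N ->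
    complex.Re (ipC (u m - u n) (u m - u n)) < e) ->
  exists2 l, csqint l & forall e : R, 0 < e -> exists N : nat, forall n, (N <= n)%N ->
    complex.Re (ipC (u n - l) (u n - l)) < e.
Proof.
move=> su cu.
have reB f g : re (f - g) = (fun t => re f t - re g t).
  by apply/funext => t; rewrite /re !fctE raddfB.
have imB f g : im (f - g) = (fun t => im f t - im g t).
  by apply/funext => t; rewrite /im !fctE raddfB.
have [|l1 [sl1 hl1]] := @sqint_complete _ _ _ rho (fun n => re (u n)) (fun n => (su n).1).
  move=> e /cu[N hN]; exists N => m n Nm Nn; have := hN m n Nm Nn.
  by rewrite /ipC /= reB; apply: le_lt_trans; rewrite lerDl ipR_ge0.
have [|l2 [sl2 hl2]] := @sqint_complete _ _ _ rho (fun n => im (u n)) (fun n => (su n).2).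
  move=> e /cu[N hN]; exists N => m n Nm Nn; have := hN m n Nm Nn.
  by rewrite /ipC /= imB; apply: le_lt_trans; rewrite lerDr ipR_ge0.
exists (fun t => Complex (l1 t) (l2 t)); first by [].
move=> e e0.
have [|N hN] := hl1 (e / 2); first by rewrite divr_gt0.
have [|M hM] := hl2 (e / 2); first by rewrite divr_gt0.
exists (maxn N M) => n; rewrite geq_max => /andP[/hN h1 /hM h2].
by rewrite /ipC /= reB imB [ltRHS]splitr ltrD.
Qed.

Lemma L2_hilbert : exists (K : lmodType R[i]) (H : hilbert_structure K)
    (pi : (T -> R[i]) -> K),
  [/\ forall (a : R[i]) f g, csqint f -> csqint g ->
        pi (a *: f + g) = a *: pi f + pi g,
      forall x, exists2 f, csqint f & pi f = x &
      forall f g, csqint f -> csqint g -> ip H (pi f) (pi g) = ipC f g].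
Proof.
apply: separation.
- exact: csqint0.
- exact: csqint_linear.
- exact: ipC_linear.
- by move=> f g _ _; exact: ipC_conj.
- by move=> f _; exact: ipC_pos.
- exact: ipC_complete.
Qed.

End ComplexL2.

Section RealMultiples.
Variable R : realType.
Implicit Types (a : R) (z : R[i]).

Lemma Re_realM a z : complex.Re (a%:C%C * z) = a * complex.Re z.
Proof. by case: z => x y /=; rewrite mul0r subr0. Qed.

Lemma Im_realM a z : complex.Im (a%:C%C * z) = a * complex.Im z.
Proof. by case: z => x y /=; rewrite mul0r addr0. Qed.

Lemma normc2_realM a z :
  ComplexField.Normc.normc (a%:C%C * z) ^+ 2 = a ^+ 2 * ComplexField.Normc.normc z ^+ 2.
Proof. by case: z => x y /=; rewrite !sqr_sqrtr ?addr_ge0 ?sqr_ge0//; ring. Qed.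

End RealMultiples.

(** * Weighted composition operators preserving the measure *)

Section MultiplicationOperator.
Context d (T : measurableType d) (R : realType).
Variable rho : {measure set T -> \bar R}.
Variables (Phi : T -> T) (theta : T -> R).
Hypothesis mPhi : measurable_fun [set: T] Phi.
Hypothesis Phi_preserving : forall A, measurable A -> rho (Phi @^-1` A) = rho A.
Hypothesis mtheta : measurable_fun [set: T] theta.
Hypothesis theta_inv : forall t, theta (Phi t) = theta t.

Let mul (m : T -> R) (f : T -> R[i]) : T -> R[i] := fun t => (m t)%:C%C * f t.

Let re_mul m f t : complex.Re (mul m f t) = m t * complex.Re (f t).
Proof. exact: Re_realM. Qed.

Let im_mul m f t : complex.Im (mul m f t) = m t * complex.Im (f t).
Proof. exact: Im_realM. Qed.

Let ipC_mul m f g : ipC rho (mul m f) g = ipC rho f (mul m g).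
Proof.
rewrite /ipC; congr Complex; congr (_ + _); try congr (- _);
  apply: eq_Rintegral => t _; rewrite ?re_mul ?im_mul; ring.
Qed.

Let sqint_mul (m : T -> R) (C : R) (f : T -> R) :
  measurable_fun [set: T] m -> (forall t, `|m t| <= C) ->
  sqint rho f -> sqint rho (fun t => m t * f t).
Proof.
move=> mm mC sf; apply: (sqint_le (g := fun t => C * f t)).
- by apply: measurable_funM => //; case: sf.
- exact: sqintZ.
- by move=> t; rewrite !normrM ler_wpM2r// (le_trans (mC t))// ler_norm.
Qed.

Let csqint_mul (m : T -> R) (C : R) (f : T -> R[i]) :
  measurable_fun [set: T] m -> (forall t, `|m t| <= C) ->
  csqint rho f -> csqint rho (mul m f).
Proof.
move=> mm mC [f1 f2]; split.
  by under eq_fun do rewrite re_mul; exact: sqint_mul mC _.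
by under eq_fun do rewrite im_mul; exact: sqint_mul mC _.
Qed.

(** Cut-offs on which [theta] is bounded: a square-integrable function stays so after multiplication
    by [chi n] and [theta]. *)
Let chi (n : nat) (t : T) : R := (`|theta t| <= n%:R)%R%:R.

Let mball n : measurable [set t | `|theta t| <= n%:R].
Proof.
rewrite (_ : mkset _ = theta @^-1` `[- n%:R, n%:R]).
  by rewrite -[X in measurable X]setTI; exact: mtheta.
by apply/seteqP; split => t; rewrite /preimage /= in_itv /= ler_norml.
Qed.

Let mchi n : measurable_fun [set: T] (chi n).
Proof.
rewrite (_ : chi n = \1_[set t | `|theta t| <= n%:R] :> (T -> R)).
  exact: measurable_indic.
apply/funext => t; rewrite /chi indicE; congr (_%:R).
by congr nat_of_bool; apply/idP/idP; rewrite inE.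
Qed.

Let chi_le1 n t : `|chi n t| <= 1.
Proof. by rewrite /chi; case: (`|theta t| <= n%:R); rewrite ?normr1 ?normr0. Qed.

Let chi_theta n t : `|chi n t * theta t| <= n%:R.
Proof.
by rewrite /chi; case: (leP `|theta t| n%:R) => h; rewrite ?mul1r// mul0r normr0.
Qed.

(** Monotone convergence along the sets [|theta| <= n], which exhaust [T]; square-integrability of
    [f] itself is part of what is to be found. *)
Let trunc_eq0R f : measurable_fun [set: T] f ->
  (forall n, sqint rho (fun t => chi n t * f t)) ->
  (forall n, ipR rho (fun t => chi n t * f t) (fun t => chi n t * f t) = 0) ->
  (\int[rho]_t ((f t) ^+ 2)%:E = 0)%E.
Proof.
move=> mf sf f0.
pose A n := [set t | `|theta t| <= n%:R].
have mA n : measurable (A n) by exact: mball.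
have <- : \bigcup_n A n = [set: T].
  apply/seteqP; split => // t _; exists (Num.truncn `|theta t|).+1 => //.
  by rewrite /A /= ltW// truncnS_gt.
have cv : (\int[rho]_(t in A n) ((f t) ^+ 2)%:E @[n --> \oo] -->
    \int[rho]_(t in \bigcup_n A n) ((f t) ^+ 2)%:E)%E.
  apply: ge0_nondecreasing_set_cvg_integral => //.
  - move=> m n mn; apply/subsetPset => t /= h; apply: le_trans h _.
    by rewrite ler_nat.
  - by move=> n; apply: measurable_funTS; exact: measurable_sqrE.
  - by move=> n t _; rewrite lee_fin sqr_ge0.
have A0 n : (\int[rho]_(t in A n) ((f t) ^+ 2)%:E = 0)%E.
  rewrite integral_mkcond -[RHS](congr1 EFin (f0 n)) -sqr_integral//.
  apply: eq_integral => t _; rewrite /patch /chi.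
  have [h|h] := boolP (`|theta t| <= n%:R); first by rewrite mem_set// mul1r.
  by rewrite memNset ?mul0r ?expr0n//; exact/negP.
by rewrite -(cvg_lim _ cv)//; under eq_fun do rewrite A0; exact: lim_cst.
Qed.

Let trunc_eq0 (f : T -> R[i]) :
  measurable_fun [set: T] (fun t => complex.Re (f t)) ->
  measurable_fun [set: T] (fun t => complex.Im (f t)) ->
  (forall n, csqint rho (mul (chi n) f)) ->
  (forall n, ipC rho (mul (chi n) f) (mul (chi n) f) = 0) ->
  csqint rho f /\ ipC rho f f = 0.
Proof.
move=> m1 m2 sf f0.
have s1 n : sqint rho (fun t => chi n t * complex.Re (f t)).
  by have [] := sf n; under eq_fun do rewrite re_mul.
have s2 n : sqint rho (fun t => chi n t * complex.Im (f t)).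
  by have [_] := sf n; under eq_fun do rewrite im_mul.
have E n : ipR rho (fun t => chi n t * complex.Re (f t)) (fun t => chi n t * complex.Re (f t)) = 0
   /\ ipR rho (fun t => chi n t * complex.Im (f t)) (fun t => chi n t * complex.Im (f t)) = 0.
  have := f0 n; rewrite /ipC => -[]; under eq_fun do rewrite re_mul.
  under [X in _ + ipR rho X _]eq_fun do rewrite im_mul.
  under [X in _ + ipR rho _ X]eq_fun do rewrite im_mul.
  by move=> /eqP; rewrite paddr_eq0 ?ipR_ge0// => /andP[/eqP-> /eqP->].
have i1 := trunc_eq0R m1 s1 (fun n => (E n).1).
have i2 := trunc_eq0R m2 s2 (fun n => (E n).2).
have q1 : sqint rho (fun t => complex.Re (f t)) by split=> //; rewrite i1.
have q2 : sqint rho (fun t => complex.Im (f t)) by split=> //; rewrite i2.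
split=> //.
have := sqr_integral q1; rewrite i1 => -[e1].
have := sqr_integral q2; rewrite i2 => -[e2].
rewrite /ipC -e1 -e2 addr0; congr Complex; by rewrite ipRC subrr.
Qed.

Let comp_integral (f : T -> R) : measurable_fun [set: T] f ->
  (\int[rho]_t ((f (Phi t)) ^+ 2)%:E = \int[rho]_t ((f t) ^+ 2)%:E)%E.
Proof.
move=> mf; transitivity (\int[pushforward rho Phi]_t ((f t) ^+ 2)%:E)%E.
  rewrite ge0_integral_pushforward//; first exact: measurable_sqrE.
  by move=> t _; rewrite lee_fin sqr_ge0.
by apply: eq_measure_integral => A mA _; exact: Phi_preserving.
Qed.

Let sqint_comp (f : T -> R) : sqint rho f -> sqint rho (fun t => f (Phi t)).
Proof.
move=> [mf fi]; split; first exact: measurableT_comp.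
by rewrite comp_integral.
Qed.

Let ipR_comp (f : T -> R) : sqint rho f ->
  ipR rho (fun t => f (Phi t)) (fun t => f (Phi t)) = ipR rho f f.
Proof.
move=> sf; apply: EFin_inj; rewrite -!sqr_integral ?comp_integral//; last exact: sqint_comp.
by case: sf.
Qed.

Lemma csqintP (f : T -> R[i]) :
  measurable_fun [set: T] (fun t => complex.Re (f t)) ->
  measurable_fun [set: T] (fun t => complex.Im (f t)) ->
  (\int[rho]_t (ComplexField.Normc.normc (f t) ^+ 2)%:E < +oo)%E -> csqint rho f.
Proof.
move=> m1 m2 fi.
have nE t : (ComplexField.Normc.normc (f t) ^+ 2)%:E =
    ((complex.Re (f t) ^+ 2)%:E + (complex.Im (f t) ^+ 2)%:E)%E.
  by case: (f t) => a b /=; rewrite sqr_sqrtr ?addr_ge0 ?sqr_ge0.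
have mn : measurable_fun [set: T] (fun t => (ComplexField.Normc.normc (f t) ^+ 2)%:E).
  by under eq_fun do rewrite nE; apply: emeasurable_funD; exact: measurable_sqrE.
split; split=> //; apply: le_lt_trans fi; apply: ge0_le_integral => //.
- by move=> t _; rewrite lee_fin sqr_ge0.
- exact: measurable_sqrE.
- by move=> t _; rewrite nE leeDl// lee_fin sqr_ge0.
- by move=> t _; rewrite lee_fin sqr_ge0.
- exact: measurable_sqrE.
- by move=> t _; rewrite nE leeDr// lee_fin sqr_ge0.
Qed.

Lemma ipC_normc (f : T -> R[i]) : csqint rho f ->
  (complex.Re (ipC rho f f))%:E = (\int[rho]_t (ComplexField.Normc.normc (f t) ^+ 2)%:E)%E.
Proof.
move=> [s1 s2]; rewrite /ipC /= EFinD -!sqr_integral//.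
rewrite -ge0_integralD//.
- by apply: eq_integral => t _; case: (f t) => a b /=; rewrite sqr_sqrtr ?addr_ge0 ?sqr_ge0.
- by move=> t _; rewrite lee_fin sqr_ge0.
- by apply: measurable_sqrE; case: s1.
- by move=> t _; rewrite lee_fin sqr_ge0.
- by apply: measurable_sqrE; case: s2.
Qed.

(** Multiplication by [theta] is taken on its maximal domain, which is what makes it equal to its
    adjoint. The target is the double of [L^2(rho)] demanded by the dilation, with [f] placed in the
    first coordinate. *)
Lemma weighted_composition_normal : exists (K : lmodType R[i]) (H : hilbert_structure K)
    (pi : (T -> R[i]) -> K) (N : K -> K -> Prop),
  [/\ forall (a : R[i]) f g, csqint rho f -> csqint rho g ->
        pi (a *: f + g) = a *: pi f + pi g,
      forall f, csqint rho f -> hnorm2 H (pi f) = complex.Re (ipC rho f f),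
      normal_operator H N &
      forall f, csqint rho f -> csqint rho (mul theta f) ->
        N (pi f) (pi (mul theta (f \o Phi)))].
Proof.
have [K [H [pi [piL pi_surj ipE]]]] := L2_hilbert rho.
have pi0 : pi 0 = 0.
  have := piL 1 0 0 (csqint0 rho) (csqint0 rho).
  by rewrite scaler0 addr0 scale1r -[LHS]addr0 => /addrI.
have sB f g : csqint rho f -> csqint rho g -> csqint rho (f - g).
  by move=> sf sg; rewrite addrC -scaleN1r; exact: csqint_linear.
have piB f g : csqint rho f -> csqint rho g -> pi (f - g) = pi f - pi g.
  move=> sf sg; have -> : f - g = -1 *: g + f by rewrite scaleN1r addrC.
  by rewrite piL// scaleN1r addrC.
have pi_eq0 f : csqint rho f -> ipC rho f f = 0 -> pi f = 0.
  by move=> sf f0; apply: (ip_def (h := H)); rewrite ipE.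
have mulB m f g : mul m (f - g) = mul m f - mul m g.
  by apply/funext => t; rewrite /mul !fctE mulrBr.
have mulM m m' f : mul m (mul m' f) = mul (fun t => m t * m' t) f.
  by apply/funext => t; rewrite /mul mulrA rmorphM.
have mulL m (a : R[i]) f g : mul m (a *: f + g) = a *: mul m f + mul m g.
  by apply/funext => t; rewrite /mul !fctE mulrDr mulrCA.
have mulC m m' f : mul m (mul m' f) = mul m' (mul m f).
  by rewrite !mulM; congr mul; apply/funext => t; rewrite mulrC.
have s_chi n f : csqint rho f -> csqint rho (mul (chi n) f).
  by move=> sf; apply: (@csqint_mul (chi n) 1) sf; [exact: mchi|exact: chi_le1].
have s_chith n f : csqint rho f -> csqint rho (mul theta (mul (chi n) f)).
  move=> sf; rewrite mulC mulM; apply: (@csqint_mul _ n%:R) sf; last exact: chi_theta.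
  exact: measurable_funM (mchi n) mtheta.
have mre f : csqint rho f -> measurable_fun [set: T] (fun t => complex.Re (f t)) by move=> [[]].
have mim f : csqint rho f -> measurable_fun [set: T] (fun t => complex.Im (f t)) by move=> [_ []].
(* [g] is mapped to [h] as soon as [theta g = h] weakly on truncated functions. *)
have weak g h : csqint rho g -> csqint rho h ->
    (forall f, csqint rho f -> csqint rho (mul theta f) ->
       ipC rho (mul theta f) g = ipC rho f h) ->
    csqint rho (mul theta g) /\ pi (mul theta g) = pi h.
  move=> sg sh gh; pose q := mul theta g - h.
  have qE : mul theta g = q + h by rewrite /q subrK.
  have chiq n : mul (chi n) q = mul theta (mul (chi n) g) - mul (chi n) h.
    by rewrite /q mulB mulC.
  have sq n : csqint rho (mul (chi n) q).
    by rewrite chiq; apply: sB; [exact: s_chith|exact: s_chi].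
  have chi2 n : (fun t => chi n t * chi n t) = chi n.
    by apply/funext => t; rewrite /chi; case: (_ <= _); rewrite ?mulr1 ?mulr0.
  have sq2 n : csqint rho (mul theta (mul (chi n) q)).
    by rewrite -[chi n]chi2 -mulM; exact: s_chith.
  (* The weak identity is tested on [chi n] times the defect [q] itself. *)
  have q0 n : ipC rho (mul (chi n) q) (mul (chi n) q) = 0.
    have E := gh _ (sq n) (sq2 n).
    have E2 : ipC rho (mul theta (mul (chi n) q)) g =
        ipC rho (mul (chi n) q) (mul theta (mul (chi n) g)).
      rewrite -{1}[chi n]chi2 -mulM mulC ipC_mul.
      by rewrite ipC_mul.
    have E3 : ipC rho (mul (chi n) q) h = ipC rho (mul (chi n) q) (mul (chi n) h).
      by rewrite -{1}[chi n]chi2 -mulM ipC_mul.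
    rewrite [X in ipC _ _ X]chiq ipC_conj -[_ - _](addrC (- _)) -scaleN1r.
    rewrite (ipC_linear (-1) (s_chi n h sh) (s_chith n g sg) (sq n)).
    have -> : ipC rho (mul (chi n) h) (mul (chi n) q)
        = ipC rho (mul theta (mul (chi n) g)) (mul (chi n) q).
      by rewrite ipC_conj [RHS]ipC_conj -E3 -E2 E.
    by rewrite mulN1r addNr conjc0.
  have [||sq' qq0] := trunc_eq0 (f := q) _ _ sq q0.
  - rewrite (_ : (fun t => _) = (fun t => theta t * complex.Re (g t) - complex.Re (h t))).
      by apply: measurable_funB; [apply: measurable_funM => //; exact: mre|exact: mre].
    by apply/funext => t; rewrite /q !fctE raddfB /= re_mul.
  - rewrite (_ : (fun t => _) = (fun t => theta t * complex.Im (g t) - complex.Im (h t))).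
      by apply: measurable_funB; [apply: measurable_funM => //; exact: mim|exact: mim].
    by apply/funext => t; rewrite /q !fctE raddfB /= im_mul.
  have sth : csqint rho (mul theta g).
    by rewrite qE -[q]scale1r; exact: csqint_linear.
  by split=> //; apply/eqP; rewrite -subr_eq0 -piB// -/q pi_eq0.
pose A x y := exists f, [/\ csqint rho f, csqint rho (mul theta f),
  pi f = x & pi (mul theta f) = y].
have AE x y : adjoint H A x y <-> A x y.
  have [g sg <-] := pi_surj x; have [h sh <-] := pi_surj y; split.
    move=> adj; have [|sth thE] := weak g h sg sh; last by exists g.
    move=> f sf sthf; rewrite -!ipE//; apply: adj.
    by exists f.
  move=> [g' [sg' sthg' <- <-]] _ _ [f [sf sthf <- <-]].
  by rewrite !ipE// ipC_mul.
have sA : selfadjoint_operator H A.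
  split=> //; split.
    have z : mul theta 0 = 0 by apply/funext => t; rewrite /mul mulr0.
    by exists 0; rewrite z; split => //; exact: csqint0.
  split.
    move=> x y y' [f [sf sthf <- <-]] [f' [sf' sthf' ff' <-]].
    have sq := sB _ _ sf sf'; have q0 : pi (f - f') = 0 by rewrite piB// ff' subrr.
    have [|_] := weak (f - f') 0 sq (csqint0 _).
      move=> g sg sthg; rewrite -!ipE//; last exact: csqint0.
      by rewrite q0 pi0 !ip0r.
    by rewrite mulB piB// pi0 => /eqP; rewrite subr_eq0 => /eqP.
  move=> a x y x' y' [f [sf sthf <- <-]] [g [sg sthg <- <-]].
  have sfg : csqint rho (a *: f + g) by exact: csqint_linear.
  have sthfg : csqint rho (a *: mul theta f + mul theta g) by exact: csqint_linear.
  by exists (a *: f + g); rewrite mulL !piL.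
have s_comp f : csqint rho f -> csqint rho (f \o Phi).
  by move=> [h1 h2]; split; exact: (sqint_comp (f := fun t => _ (f t))).
have comp_norm f : csqint rho f ->
    complex.Re (ipC rho (f \o Phi) (f \o Phi)) = complex.Re (ipC rho f f).
  by move=> [h1 h2]; rewrite /ipC /=; congr (_ + _); exact: ipR_comp.
have piN f : csqint rho f -> hnorm2 H (pi f) = complex.Re (ipC rho f f).
  by move=> sf; rewrite /hnorm2 ipE.
have /choice[rep hrep] x : exists f, csqint rho f /\ pi f = x.
  by have [f sf fx] := pi_surj x; exists f.
(* Independence of the representative holds because composition with [Phi] preserves the seminorm,
   hence sends null functions to null functions. *)
pose U x := pi (rep x \o Phi).
have UE f : csqint rho f -> U (pi f) = pi (f \o Phi).
  move=> sf; have [sr rE] := hrep (pi f).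
  apply/eqP; rewrite -subr_eq0 -piB//; try exact: s_comp.
  have -> : rep (pi f) \o Phi - (f \o Phi) = (rep (pi f) - f) \o Phi by [].
  apply/eqP; apply: (hnorm2_eq0 (H := H)); rewrite piN; last exact/s_comp/sB.
  have sr' := sB _ _ sr sf.
  by rewrite (comp_norm _ sr') -(piN _ sr') piB// rE subrr hnorm20.
have [|||N [nN NE]] := selfadjoint_isometry_normal (U := U) sA.
- move=> a x y; have [f sf <-] := pi_surj x; have [g sg <-] := pi_surj y.
  by rewrite -piL// !UE//; [rewrite -piL//; exact: s_comp|exact: csqint_linear].
- move=> x; have [f sf <-] := pi_surj x.
  by rewrite UE// !piN ?comp_norm//; exact: s_comp.
- move=> _ _ [f [sf sthf <- <-]]; rewrite !UE//.
  have E : mul theta (f \o Phi) = mul theta f \o Phi.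
    by apply/funext => t; rewrite /mul /= theta_inv.
  by exists (f \o Phi); rewrite E; split => //; exact: s_comp.
exists (K * K)%type, (prod_hilbert H H), (fun f => (pi f, 0)), N; split => //.
- by move=> a f g sf sg; rewrite piL//; congr (_, _) => /=; rewrite scaler0 addr0.
- by move=> f sf; rewrite hnorm2_prod /= hnorm20 addr0 piN.
- move=> f sf sthf.
  have -> : mul theta (f \o Phi) = mul theta f \o Phi.
    by apply/funext => t; rewrite /mul /= theta_inv.
  by rewrite -UE//; apply: NE; exists f.
Qed.

End MultiplicationOperator.

(** * Sums over countable sets and integrals against sums of measures *)

Section EsumLemmas.
Variable R : realType.
Local Open Scope ereal_scope.

(** One inequality comes from finite subsums; the other is the same one applied to [c^-1]. *)
Lemma esumZl (T : choiceType) (A : set T) (c : R) (a : T -> \bar R) : (0 <= c)%R ->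
  (forall x, 0 <= a x) ->
  \esum_(x in A) (c%:E * a x) = c%:E * \esum_(x in A) a x.
Proof.
move=> c0 a0; have [->|cN0] := eqVneq c 0%R.
  by rewrite mul0e esum1// => x _; rewrite mul0e.
have le (k : R) (b : T -> \bar R) : (0 <= k)%R -> (forall x, 0 <= b x) ->
    \esum_(x in A) (k%:E * b x) <= k%:E * \esum_(x in A) b x.
  move=> k0 b0; apply: ge_ereal_sup => _ [X [finX XA] <-].
  rewrite -ge0_mule_fsumr//; apply: lee_wpmul2l; first by rewrite lee_fin.
  by apply: esum_ge; exists X.
apply/eqP; rewrite eq_le le//=.
have := le c^-1%R (fun x => c%:E * a x); rewrite invr_ge0 => /(_ c0).
have h x : 0 <= c%:E * a x by rewrite mule_ge0.
move=> /(_ h) /(lee_wpmul2l (x := c%:E)).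
rewrite lee_fin => /(_ c0); rewrite muleA -EFinM divff// mul1e; apply: le_trans.
apply: lee_wpmul2l => //; apply: le_esum => x Ax.
by rewrite muleA -EFinM mulVf// mul1e.
Qed.

Lemma esum_fiber (T T' : choiceType) (A : set T) (psi : T -> T') (a : T -> \bar R) :
  (forall x, A x -> 0 <= a x) ->
  \esum_(x in A) a x = \esum_(y in [set: T']) \esum_(x in A `&` psi @^-1` [set y]) a x.
Proof.
move=> a0; rewrite (@esum_esum _ _ _ setT (fun y => A `&` psi @^-1` [set y]) (fun _ x => a x)).
  apply/esym/(@reindex_esum R _ _ A _ (fun x => (psi x, x)) (fun z => a z.2)).
  split => [x Ax //|x x' _ _ [_ ->] //|[y x] [_ [Ax /= <-]]].
  by exists x.
by move=> y x _ [Ax _]; exact: a0.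
Qed.

Lemma esum_cst_card (T : choiceType) (A : set T) (n : nat) (c : \bar R) : 0 <= c ->
  (A #= [set k : nat | (k < n)%N])%card -> \esum_(x in A) c = n%:R%:E * c.
Proof.
move=> c0 /card_set_bijP[f bf].
rewrite -(@reindex_esum R _ _ A _ f (fun=> c) bf) esum_fset//.
rewrite -[X in \sum_(i \in X) _]/`I_n -fsbig_ord.
by rewrite sumr_const card_ord mule_natl.
Qed.

Lemma countable_enumeration (T : choiceType) : countable [set: T] -> infinite_set [set: T] ->
  exists (e : nat -> T) (i : T -> nat), cancel e i /\ cancel i e.
Proof.
move=> cT iT; have /card_set_bijP[i [_ inji suri]] : ([set: T] #= [set: nat])%card.
  by rewrite card_eq_le; apply/andP; split => //; exact/infiniteP.
have /choice[e he] : forall k, exists x, i x = k.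
  by move=> k; have [//|x _ <-] := suri k; exists x.
have ei : cancel e i by [].
by exists e, i; split => // x; apply: inji; rewrite ?inE// ei.
Qed.

Lemma esum_enum (T : choiceType) (e : nat -> T) (i : T -> nat) (a : T -> \bar R) :
  cancel e i -> cancel i e -> (forall x, 0 <= a x) ->
  \esum_(x in [set: T]) a x = \sum_(k <oo) a (e k).
Proof.
move=> ei ie a0; rewrite nneseries_esumT//.
rewrite (@reindex_esum R _ _ setT setT e a)//; split => //.
- by move=> x y _ _ exy; rewrite -(ei x) exy ei.
- by move=> x _; exists (i x).
Qed.

End EsumLemmas.

Section MeasureLemmas.
Context d d' (T : measurableType d) (T' : measurableType d') (R : realType).
Local Open Scope ereal_scope.

Lemma pushforward_measure (nu : {measure set T -> \bar R}) (f : T -> T') :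
  measurable_fun [set: T] f -> exists m : {measure set T' -> \bar R},
  (forall A, m A = nu (f @^-1` A)) /\
  forall g : T' -> \bar R, measurable_fun [set: T'] g -> (forall y, 0 <= g y) ->
    \int[m]_y g y = \int[nu]_x g (f x).
Proof.
move=> mf; unshelve eexists; first exact: (pushforward nu f).
split; first by [].
move=> g mg g0.
by rewrite ge0_integral_pushforward.
Unshelve. all: exact: mf. Qed.

Lemma weighted_sum_measure (m_ : nat -> {measure set T -> \bar R}) (c : nat -> R) :
  (forall k, 0 <= c k)%R -> exists rho : {measure set T -> \bar R},
  (forall A, measurable A -> rho A = \sum_(k <oo) (c k)%:E * m_ k A) /\
  forall D g, measurable D -> measurable_fun D g -> (forall y, D y -> 0 <= g y) ->
    \int[rho]_(y in D) g y = \sum_(k <oo) (c k)%:E * \int[m_ k]_(y in D) g y.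
Proof.
move=> c0; exists (mseries (fun k => mscale (NngNum (c0 k)) (m_ k)) 0); split => //.
move=> D g mD mg g0; rewrite ge0_integral_measure_series//.
by apply: eq_eseriesr => k _; rewrite ge0_integral_mscale.
Qed.

Lemma ge0_integral_mrestr (nu : {measure set T -> \bar R}) (A D : set T)
    (mA : measurable A) (g : T -> \bar R) : measurable D -> A `<=` D ->
  measurable_fun D g -> (forall x, D x -> 0 <= g x) ->
  \int[mrestr nu mA]_(x in D) g x = \int[nu]_(x in A) g x.
Proof.
move=> mD AD mg g0.
have mAg : measurable_fun A g by exact: measurable_funS mg.
have mAC : measurable (~` A) by exact: measurableC.
have -> : \int[mrestr nu mA]_(x in D) g x = \int[mrestr nu mA]_(x in A) g x.
  have UD : A `|` (D `\` A) = D by rewrite setDUK.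
  rewrite -{1}UD.
  have mDA : measurable (D `\` A) by exact: measurableD.
  rewrite ge0_integral_setU//; last 3 first.
  - by rewrite UD.
  - by rewrite UD.
  - by apply/disj_setPS => x [Ax [_ /(_ Ax)]].
  rewrite [X in _ + X]null_set_integral ?adde0//.
    by apply: measurable_funS mg => // x [].
  rewrite -[LHS]/(nu ((D `\` A) `&` A)).
    by rewrite setDE -setIA setICl setI0 measure0.
have E B : measurable B -> B `<=` A -> nu B = measure_add (mrestr nu mA) (mrestr nu mAC) B.
  move=> mB BA; rewrite measure_addE -[RHS]/(nu (B `&` A) + nu (B `&` ~` A)) (setIidl BA).
  by rewrite (_ : B `&` ~` A = set0) ?measure0 ?adde0//; apply/disjoints_subset; rewrite setCK.
transitivity (\int[measure_add (mrestr nu mA) (mrestr nu mAC)]_(x in A) g x); last first.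
  by apply: eq_measure_integral => B mB BA; rewrite E.
rewrite ge0_integral_measure_add//; last by move=> x /AD; exact: g0.
rewrite [X in _ = _ + X]null_set_integral ?adde0//.
  by rewrite -[LHS]/(nu (A `&` ~` A)) setICr measure0.
Qed.

End MeasureLemmas.

Lemma measurable_fun_nat_prod d d' (T : measurableType d)
    (T' : measurableType d') (g : nat * T -> T') :
  (forall k, measurable_fun [set: T] (fun t => g (k, t))) ->
  measurable_fun [set: nat * T] g.
Proof.
move=> mg _ B mB; rewrite setTI.
have -> : g @^-1` B = \bigcup_k ([set k] `*` ((fun t => g (k, t)) @^-1` B)).
  apply/seteqP; split => [[k t] /= gB|[k t] [j _ [/= -> ]]//]; exists k => //.
apply: bigcup_measurable => k _; apply: measurableX => //.
by rewrite -[X in measurable X]setTI; exact: mg.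
Qed.


(** * Composition operators on homogeneous trees *)

Section TreeCombinatorics.
Variables (R : realType) (V : choiceType) (phi : V -> V) (w : V -> R)
  (G : int -> set V) (kappa : int -> nat) (alpha : int -> R).
Hypothesis G_disj : forall m n, m <> n -> G m `&` G n = set0.
Hypothesis G_cover : \bigcup_(m in [set: int]) G m = [set: V].
Hypothesis G_succ : forall m, G (m + 1) = \bigcup_(x in G m) [set y | phi y = x].
Hypothesis kappa_gt0 : forall m, (0 < kappa m)%N.
Hypothesis alpha_gt0 : forall m, 0 < alpha m.
Hypothesis card_children : forall m x, G m x ->
  ([set y | phi y = x] #= [set k : nat | (k < kappa m)%N])%card.
Hypothesis w_alpha : forall m x, G m x -> w x = alpha m.

(** One recursion across 0: by it, [kappa_hat (m + n) / kappa_hat m] counts the descendants, [n]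
    generations on, of a vertex of level [m]. *)
Lemma kappa_hat_succ m : kappa_hat R kappa (m + 1) = (kappa m)%:R * kappa_hat R kappa m.
Proof.
have kN0 k : (kappa k)%:R != 0 :> R by rewrite pnatr_eq0 -lt0n.
case: m => [k|[|k]].
- by rewrite -PoszD addn1 /= big_ord_recr mulrC.
- rewrite (_ : Negz 0 + 1 = 0 :> int)//= big_ord0 big_ord_recl big_ord0 mulr1.
  by rewrite NegzE mulfV.
- rewrite (_ : Negz k.+1 + 1 = Negz k :> int) /=; last by rewrite !NegzE; lia.
  rewrite [in RHS]big_ord_recr invfM /= NegzE mulrCA mulfV ?mulr1//.
Qed.

Lemma kappa_hat_gt0 m : 0 < kappa_hat R kappa m.
Proof.
case: m => k /=; rewrite ?invr_gt0; apply: prodr_gt0 => i _; rewrite ltr0n; exact: kappa_gt0.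
Qed.

Definition beta m := alpha m * kappa_hat R kappa m.

Lemma beta_gt0 m : 0 < beta m.
Proof. by rewrite mulr_gt0// kappa_hat_gt0. Qed.

Lemma level_exists : exists lev : V -> int, forall x, G (lev x) x.
Proof.
suff /choice[lev h] : forall x, exists m, G m x by exists lev.
by move=> x; have : [set: V] x by []; rewrite -G_cover => -[m _ Gx]; exists m.
Qed.

Lemma level_uniq m n x : G m x -> G n x -> m = n.
Proof.
move=> mx nx; apply: contrapT => /G_disj mn.
by have : (G m `&` G n) x by []; rewrite mn.
Qed.

Lemma level_child m x : G m (phi x) -> G (m + 1) x.
Proof. by move=> h; rewrite G_succ; exists (phi x). Qed.

Lemma level_parent m x : G (m + 1) x -> G m (phi x).
Proof. by rewrite G_succ => -[y Gy /= ->]. Qed.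

(** Children exist since [kappa] is positive, parents since [phi] is total. This gives access to the
    Hankel forms with every shift [m], negative ones included. *)
Lemma level_nonempty m (x0 : V) : exists x, G m x.
Proof.
have child n x : G n x -> exists y, phi y = x.
  move=> Gx; apply: contrapT => /forallNP h.
  have := card_children Gx; rewrite (_ : [set y | phi y = x] = set0).
    rewrite card_eq_sym card_eq0 => /eqP e.
    have : [set k : nat | (k < kappa n)%N] 0%N by exact: kappa_gt0.
    by rewrite e.
  by apply/seteqP; split => y //= /h.
have [lev hlev] := level_exists.
have up k : exists x, G (lev x0 + k%:Z) x.
  elim: k => [|k [x Gx]]; first by exists x0; rewrite addr0; exact: hlev.
  have [y yx] := child _ _ Gx; exists y.
  by rewrite -addn1 PoszD addrA; apply: level_child; rewrite yx.
have dn k : exists x, G (lev x0 - k%:Z) x.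
  elim: k => [|k [x Gx]]; first by exists x0; rewrite subr0; exact: hlev.
  exists (phi x); apply: level_parent.
  by rewrite -addn1 PoszD opprD addrA subrK.
have [h|h] := leP (lev x0) m.
  have := up `|(m - lev x0)%R|%N.
  by have -> : lev x0 + `|(m - lev x0)%R|%N%:Z = m by lia.
have := dn `|(lev x0 - m)%R|%N.
by have -> : lev x0 - `|(lev x0 - m)%R|%N%:Z = m by lia.
Qed.

Lemma w_ge0 x : 0 <= w x.
Proof. by have [lev hlev] := level_exists; rewrite (w_alpha (hlev x)) ltW. Qed.

(** The fibre of [phi^(n+1)] over [x] is the disjoint union of the fibres of [phi^n] over the
    [kappa m] children of [x], which all have the same measure. *)
Lemma mu_iter_preimage n m x : G m x ->
  mu w [set y | iter n phi y = x] = (beta (m + n%:Z) / kappa_hat R kappa m)%:E.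
Proof.
elim: n m x => [|n IH] m x Gx.
  rewrite /mu (_ : [set y | iter 0 phi y = x] = [set x])// esum_set1.
    by rewrite (w_alpha Gx) addr0 /beta mulfK// gt_eqF// kappa_hat_gt0.
  by rewrite lee_fin (w_alpha Gx) ltW.
rewrite /mu (esum_fiber (iter n phi)); last by move=> y _; rewrite lee_fin w_ge0.
transitivity (\esum_(y in [set y | phi y = x]) mu w [set z | iter n phi z = y]).
  rewrite [RHS]esum_mkcond; apply: eq_esum => y _; have [yx|yx] := pselect (phi y = x).
    rewrite mem_set// /mu; congr (esum _ _).
    by apply/seteqP; split => z /= => [[]|zy]//; rewrite zy.
  rewrite memNset// (_ : _ `&` _ = set0) ?esum_set0//.
  by apply/seteqP; split => // z [/= zx zy]; apply: yx; rewrite -zy.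
transitivity (\esum_(y in [set y | phi y = x])
    (beta (m + 1 + n%:Z) / kappa_hat R kappa (m + 1))%:E).
  by apply: eq_esum => y /= yx; apply: IH; apply: level_child; rewrite yx.
rewrite (esum_cst_card _ (card_children Gx)); last first.
  by rewrite lee_fin divr_ge0 ?ltW ?beta_gt0 ?kappa_hat_gt0.
rewrite -EFinM; congr (_%:E); rewrite kappa_hat_succ -addrA -PoszD add1n invfM mulrCA.
by rewrite [_%:R * _]mulrA mulfV ?mul1r// pnatr_eq0 -lt0n.
Qed.

Lemma L2norm2_iter n (f : V -> R[i]) : L2norm2 w (f \o iter n phi) =
  (\esum_(x in [set: V]) ((ComplexField.Normc.normc (f x)) ^+ 2)%:E
      * mu w [set y | iter n phi y = x])%E.
Proof.
rewrite /L2norm2 (esum_fiber (iter n phi)); last first.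
  by move=> y _; rewrite lee_fin mulr_ge0 ?sqr_ge0// w_ge0.
apply: eq_esum => x _; rewrite setTI /mu -esumZl ?sqr_ge0//.
  by apply: eq_esum => y /= <-; rewrite EFinM.
by move=> y; rewrite lee_fin w_ge0.
Qed.

Lemma L2norm2_delta n x :
  L2norm2 w ((fun y => (y == x)%:R) \o iter n phi) = mu w [set y | iter n phi y = x].
Proof.
rewrite /L2norm2 /mu [RHS]esum_mkcond; apply: eq_esum => y _ /=.
have [e|e] := eqVneq (iter n phi y) x.
  rewrite mem_set// -[true%:R]/(1 : R[i]).
  by rewrite ComplexField.Normc.normc1 expr1n mul1r.
rewrite -[false%:R]/(0 : R[i]) memNset; last exact/eqP.
by rewrite ComplexField.Normc.normc0 expr0n /= mul0r.
Qed.

Lemma dom_inf_delta x : dom_inf w phi (fun y => (y == x)%:R : R[i]).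
Proof.
move=> n k _; have [lev hlev] := level_exists.
by rewrite /inL2 L2norm2_delta (mu_iter_preimage _ (hlev x)) ltry.
Qed.

Lemma h_powE n m x : G m x -> h_pow w phi n x = (beta (m + n%:Z) / beta m)%:E.
Proof.
move=> Gx; rewrite /h_pow (mu_iter_preimage n Gx) -EFinM; congr (_%:E).
by rewrite (w_alpha Gx) -mulrA -invfM mulrC [in RHS]/beta [_ * alpha m]mulrC mulrC.
Qed.

(** The orbit of the point mass at a vertex of level [m] has squared norms
    [beta (m + k) / kappa_hat m]; the choice of the level realises the shift. *)
Lemma subnormal_hankel_nonneg (x0 : V) : subnormal_Cphi w phi -> hankel_nonneg beta.
Proof.
move=> [K [H [J [N [_ [Jnorm [nN NJ]]]]]]] m n c.
have [x Gx] := level_nonempty m x0.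
pose f k : V -> R[i] := (fun y => (y == x)%:R) \o iter k phi.
have f2 k : inL2 w (f k) by exact: (dom_inf_delta x (leqnn k)).
have fS k : f k \o phi = f k.+1.
  by apply/funext => y; rewrite /f /= -(iterSr k phi y).
have Nf k : N (J (f k)) (J (f k.+1)) by rewrite -fS; apply: NJ => //; rewrite fS.
have nf k : hnorm2 H (J (f k)) = beta (m + k%:Z) / kappa_hat R kappa m.
  by apply: EFin_inj; rewrite Jnorm// L2norm2_delta (mu_iter_preimage _ Gx).
have := normal_hankel_ge0 (x := fun k => J (f k)) c nN Nf.
rewrite -(pmulr_lge0 _ (kappa_hat_gt0 m)); congr (0 <= _).
rewrite mulr_suml; apply: eq_bigr => i _; rewrite mulr_suml; apply: eq_bigr => j _.
by rewrite nf -[RHS]mulr1 -(mulVf (lt0r_neq0 (kappa_hat_gt0 m))); ring.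
Qed.

(** Shifting by [m] and dividing by [beta m > 0] preserve nonnegativity; the resulting two-sided
    measure is extended by 0 to the closed half-line. *)
Lemma hankel_nonneg_h_pow : hankel_nonneg beta ->
  forall x, stieltjes_moment (fun n => h_pow w phi n x).
Proof.
move=> hb x; have [lev hlev] := level_exists; pose m := lev x.
have hb' : hankel_nonneg (fun j => beta (m + j) / beta m).
  move=> l n c; have := hb (m + l) n c.
  rewrite -(pmulr_lge0 _ (x := (beta m)^-1)) ?invr_gt0 ?beta_gt0//; congr (0 <= _).
  rewrite mulr_suml; apply: eq_bigr => i _; rewrite mulr_suml; apply: eq_bigr => j _.
  by rewrite !addrA !mulrA.
have [_ [nu hnu]] := two_sided_moments hb'.
have mpos : measurable [set s : R | 0 < s].
  by rewrite -set_itvoy; exact: measurable_itv.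
have mnneg : measurable [set s : R | 0 <= s].
  by rewrite -set_itvcy; exact: measurable_itv.
exists (mrestr nu mpos) => n.
rewrite (h_powE n (hlev x)) -/m (hnu n%:Z) ge0_integral_mrestr//.
- by move=> s /= /ltW.
- by apply/measurable_EFinP; exact: measurable_funX.
- by move=> s /= s0; rewrite lee_fin exprn_ge0.
Qed.

(** At a vertex of level [m] the form is [beta m] times the integral of [(\sum_i c_i s^i)^2].
    One-sided moments suffice, a negative shift being the level of another vertex. *)
Lemma h_pow_hankel_nonneg (x0 : V) :
  (forall x, stieltjes_moment (fun n => h_pow w phi n x)) -> hankel_nonneg beta.
Proof.
move=> hp m n c; have [x Gx] := level_nonempty m x0.
have [nu hnu] := hp x.
have mnneg : measurable [set s : R | 0 <= s].
  by rewrite -set_itvcy; exact: measurable_itv.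
set D := [set s : R | 0 <= s] in hnu mnneg.
have mX k : measurable_fun D (fun s : R => s ^+ k) by exact: measurable_funX.
have iX k : nu.-integrable D (fun s => (s ^+ k)%:E).
  apply/integrableP; split; first by apply/measurable_EFinP.
  rewrite (_ : (\int[nu]_(s in D) _)%E = (\int[nu]_(s in D) (s ^+ k)%:E)%E).
    by rewrite -hnu (h_powE _ Gx) ltry.
  by apply: eq_integral => s; rewrite inE /= => s0; rewrite ger0_norm ?exprn_ge0.
have bE k : beta (m + k%:Z) = beta m * Rintegral nu D (fun s => s ^+ k).
  rewrite /Rintegral -hnu (h_powE _ Gx) /= mulrCA mulfV ?mulr1// gt_eqF//.
  exact: beta_gt0.
have sumI I (r : seq I) (F : I -> R -> R) :
    (forall i, nu.-integrable D (EFin \o F i)) ->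
    nu.-integrable D (EFin \o (fun s => \sum_(i <- r) F i s)) /\
    Rintegral nu D (fun s => \sum_(i <- r) F i s) = \sum_(i <- r) Rintegral nu D (F i).
  move=> iF; elim: r => [|i r [IHi IHr]].
    under eq_fun do rewrite big_nil; rewrite big_nil; split.
      exact: integrable0.
    by rewrite /Rintegral integral0.
  have E : (fun s => \sum_(j <- i :: r) F j s) = (fun s => F i s + \sum_(j <- r) F j s).
    by apply/funext => s; rewrite big_cons.
  rewrite E big_cons -IHr -RintegralD//; split => //.
  apply: (eq_integrable mnneg (fun s => (F i s)%:E + (\sum_(j <- r) F j s)%:E)%E).
    by move=> s _; rewrite /= EFinD.
  exact: (integrableD mnneg (iF i) IHi).
pose F i j (s : R) := c i * c j * s ^+ (i + j)%N.
have iF i j : nu.-integrable D (EFin \o F i j).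
  apply: (eq_integrable mnneg (fun s => (c i * c j)%:E * (s ^+ (i + j)%N)%:E)%E).
    by move=> s _; rewrite /F /= EFinM.
  exact: integrableZl.
have E : \sum_i \sum_j c i * c j * beta (m + (i + j)%N%:Z)
   = beta m * Rintegral nu D (fun s => (\sum_i c i * s ^+ i) ^+ 2).
  transitivity (beta m * \sum_i \sum_j Rintegral nu D (F i j)).
    rewrite mulr_sumr; apply: eq_bigr => i _; rewrite mulr_sumr; apply: eq_bigr => j _.
    by rewrite bE /F RintegralZl//; [rewrite mulrCA | exact: iX].
  congr (_ * _); transitivity (\sum_i Rintegral nu D (fun s => \sum_j F i j s)).
    by apply: eq_bigr => i _; rewrite (sumI _ _ (F i) (iF i)).2.
  rewrite -(sumI _ _ (fun i s => \sum_j F i j s) (fun i => (sumI _ _ (F i) (iF i)).1)).2.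
  apply: eq_Rintegral => s _; rewrite expr2 mulr_suml; apply: eq_bigr => i _.
  rewrite mulr_sumr; apply: eq_bigr => j _; rewrite /F exprD; ring.
rewrite E mulr_ge0 ?(ltW (beta_gt0 _))// Rintegral_ge0// => s _; exact: sqr_ge0.
Qed.

(** Restricting [f] to a large finite set gives an element of the domain of every power, each fibre
    of an iterate of [phi] having finite measure. *)
Lemma dom_inf_dense (f : V -> R[i]) (e : R) : inL2 w f -> 0 < e ->
  exists g, dom_inf w phi g /\ (L2norm2 w (fun x => (f x - g x)%R) < e%:E)%E.
Proof.
rewrite /inL2 /L2norm2; set a := fun x => _; move=> fi e0.
have a0 x : (0 <= a x)%E by rewrite lee_fin mulr_ge0 ?sqr_ge0 ?w_ge0.
have sfin : (\esum_(x in [set: V]) a x)%E \is a fin_num.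
  by rewrite ge0_fin_numE// esum_ge0.
have [_ [X [finX _] <-] hX] := ub_ereal_sup_adherent e0 sfin.
pose g x := if x \in X then f x else 0.
have [lev hlev] := level_exists.
exists g; split.
  move=> n k _; rewrite /inL2 L2norm2_iter.
  rewrite (_ : esum _ _ = (\esum_(x in X) ((ComplexField.Normc.normc (f x)) ^+ 2)%:E
      * mu w [set y | iter k phi y = x])%E); last first.
    rewrite [RHS]esum_mkcond; apply: eq_esum => x _; rewrite /g; case: ifP => // _.
    by rewrite ComplexField.Normc.normc0 expr0n /= mul0e.
  have h x : (0 <= ((ComplexField.Normc.normc (f x)) ^+ 2)%:E
      * mu w [set y | iter k phi y = x])%E.
    by rewrite mule_ge0 ?lee_fin ?sqr_ge0 ?esum_ge0// => y _; rewrite lee_fin w_ge0.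
  rewrite esum_fset// fsbig_finite//=; apply: lte_sum_pinfty => x _.
  by rewrite (mu_iter_preimage _ (hlev x)) -EFinM ltry.
rewrite (_ : esum _ _ = \esum_(x in ~` X) a x)%E; last first.
  rewrite [RHS]esum_mkcond; apply: eq_esum => x _; rewrite /g in_setC /a.
  case: ifP => _; rewrite ?subr0// subrr.
  by rewrite ComplexField.Normc.normc0 expr0n /= mul0r.
move: hX; rewrite -[ereal_sup _]/(\esum_(x in [set: V]) a x)%E (esumID X)//.
rewrite !setTI -(esum_fset finX)//.
move: sfin; rewrite (@esumID _ _ X setT a)// !setTI fin_numD => /andP[fX _].
by rewrite lteBlDr// lteD2lE.
Qed.

Lemma h_pow_moments (f : V -> R[i]) : countable [set: V] -> infinite_set [set: V] ->
  (forall x, stieltjes_moment (fun n => h_pow w phi n x)) ->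
  stieltjes_moment (fun n => L2norm2 w (f \o iter n phi)).
Proof.
move=> cV iV hp; have [e [i [ei ie]]] := countable_enumeration cV iV.
have [nu hnu] := choice hp.
pose c x := ComplexField.Normc.normc (f x) ^+ 2 * w x.
have c0 x : 0 <= c x by rewrite mulr_ge0 ?sqr_ge0 ?w_ge0.
have [rho [_ hrho]] := weighted_sum_measure (fun k => nu (e k)) (fun k => c0 (e k)).
have mnneg : measurable [set s : R | 0 <= s].
  by rewrite -set_itvcy; exact: measurable_itv.
exists rho => n; rewrite hrho//; last 2 first.
- by apply/measurable_EFinP; exact: measurable_funX.
- by move=> s s0; rewrite lee_fin exprn_ge0.
have m0 x : (0 <= mu w [set y | iter n phi y = x])%E.
  by apply: esum_ge0 => y _; rewrite lee_fin w_ge0.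
rewrite L2norm2_iter (esum_enum ei ie); last by move=> x; rewrite mule_ge0// lee_fin sqr_ge0.
apply: eq_eseriesr => k _; rewrite -hnu /h_pow /c [RHS]muleCA -EFinM mulfK 1?muleC// gt_eqF//.
have [lev hlev] := level_exists.
by rewrite (w_alpha (hlev (e k))).
Qed.

Lemma moments_h_pow :
  (forall f : V -> R[i], dom_inf w phi f ->
     stieltjes_moment (fun n => L2norm2 w (f \o iter n phi))) ->
  forall x, stieltjes_moment (fun n => h_pow w phi n x).
Proof.
move=> hf x; have [nu hnu] := hf _ (dom_inf_delta x).
have w0 : 0 <= (w x)^-1 by rewrite invr_ge0 w_ge0.
have mnneg : measurable [set s : R | 0 <= s].
  by rewrite -set_itvcy; exact: measurable_itv.
exists (mscale (NngNum w0) nu) => n; rewrite ge0_integral_mscale//.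
- by rewrite -hnu L2norm2_delta /h_pow muleC.
- by apply/measurable_EFinP; exact: measurable_funX.
- by move=> s s0; rewrite lee_fin exprn_ge0.
Qed.

Lemma two_sided_subnormal : countable [set: V] -> infinite_set [set: V] ->
  two_sided_stieltjes beta -> subnormal_Cphi w phi.
Proof.
move=> cV iV [_ [nu hnu]]; have [e [i [ei ie]]] := countable_enumeration cV iV.
have [lev hlev] := level_exists.
have lev_phi x : lev x = lev (phi x) + 1.
  by apply: (level_uniq (hlev x)); apply: level_child.
have mpos : measurable [set s : R | 0 < s].
  by rewrite -set_itvoy; exact: measurable_itv.
pose nup := mrestr nu mpos.
have nupE (g : R -> \bar R) : measurable_fun [set: R] g -> (forall t, 0 <= g t)%E ->
    (\int[nup]_t g t = \int[nu]_(t in [set s : R | (0 < s)%R]) g t)%E.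
  by move=> mg g0; rewrite ge0_integral_mrestr.
have /choice[m_ hm] : forall k : nat, exists m : {measure set (nat * R) -> \bar R},
    (forall A, m A = nup ((fun t : R => (k, t)) @^-1` A)) /\
    forall g : nat * R -> \bar R, measurable_fun [set: nat * R] g -> (forall y, (0 <= g y)%E) ->
    (\int[m]_y g y = \int[nup]_t g (k, t))%E.
  by move=> k; apply: pushforward_measure; exact: measurable_pair1.
pose c x := (kappa_hat R kappa (lev x))^-1.
have c_gt0 x : 0 < c x by rewrite invr_gt0 kappa_hat_gt0.
have [rho [rhoE rho_int]] := weighted_sum_measure m_ (fun k => ltW (c_gt0 (e k))).
have rho_integral (g : nat * R -> \bar R) : measurable_fun [set: nat * R] g ->
    (forall y, (0 <= g y)%E) -> (\int[rho]_y g y =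
    \esum_(x in [set: V]) (c x)%:E * \int[nu]_(t in [set s : R | (0 < s)%R]) g (i x, t))%E.
  move=> mg g0; rewrite rho_int// (esum_enum ei ie); last first.
    by move=> x; rewrite mule_ge0 ?lee_fin ?(ltW (c_gt0 _))// integral_ge0.
  apply: eq_eseriesr => k _; rewrite (hm k).2// nupE ?ei//.
  exact: (measurableT_comp mg (measurable_pair1 k)).
(* [V * R] is encoded as [nat * R] through the enumeration [e] of [V]. *)
pose Phi (p : nat * R) := (i (phi (e p.1)), p.2).
have mPhi : measurable_fun [set: nat * R] Phi.
  by apply: measurable_fun_nat_prod => k; exact: (pair1_measurable (i (phi (e k)))).
have Phi_preserving A : measurable A -> rho (Phi @^-1` A) = rho A.
  move=> mA.
  have mPA : measurable (Phi @^-1` A) by rewrite -[X in measurable X]setTI; exact: mPhi.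
  pose M x := nup ((fun t : R => (i x, t)) @^-1` A).
  have rhoA : rho A = (\esum_(x in [set: V]) (c x)%:E * M x)%E.
    rewrite rhoE// (esum_enum ei ie) => [|x]; last first.
      by rewrite mule_ge0 ?lee_fin ?(ltW (c_gt0 _)).
    by apply: eq_eseriesr => k _; rewrite (hm k).1 /M ei.
  have -> : rho (Phi @^-1` A) = (\esum_(x in [set: V]) (c x)%:E * M (phi x))%E.
    rewrite rhoE// (esum_enum ei ie) => [|x]; last first.
      by rewrite mule_ge0 ?lee_fin ?(ltW (c_gt0 _)).
    by apply: eq_eseriesr => k _; rewrite (hm k).1.
  rewrite rhoA (esum_fiber phi); last first.
    by move=> x _; rewrite mule_ge0 ?lee_fin ?(ltW (c_gt0 _)).
  apply: eq_esum => y _; rewrite setTI.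
  (* The [kappa (lev y)] children of [y] each carry the weight [1 / kappa_hat (lev y + 1)], which
     adds up to the weight of [y]. *)
  transitivity (\esum_(x in phi @^-1` [set y]) ((kappa_hat R kappa (lev y + 1))^-1%:E * M y))%E.
    by apply: eq_esum => x /= <-; rewrite /c (lev_phi x).
  rewrite (esum_cst_card _ (card_children (hlev y))); last first.
    by rewrite mule_ge0 ?lee_fin ?invr_ge0 ?(ltW (kappa_hat_gt0 _)).
  rewrite muleA -EFinM kappa_hat_succ invfM mulrA mulfV ?mul1r//.
  by rewrite pnatr_eq0 -lt0n.
(* The values of [r] off the positive axis are irrelevant, as [nup] does not charge them. *)
pose r (t : R) := if 0 < t then Num.sqrt t else 1.
have r_gt0 t : 0 < r t by rewrite /r; case: ifP => // t0; rewrite sqrtr_gt0.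
have mr : measurable_fun [set: R] r.
  apply: measurable_fun_ifT => //; first exact: measurable_fun_ltr.
  by apply: continuous_measurable_fun; exact: sqrt_continuous.
have mrX j : measurable_fun [set: R] (fun t => r t ^ j).
  have -> : (fun t => r t ^ j) = (fun s : R => s ^ j) \o r by [].
  apply: (measurable_comp mpos) => //; last exact: measurable_exprz.
  by move=> _ [t _ <-]; exact: r_gt0.
pose theta (p : nat * R) := r p.2.
have mtheta : measurable_fun [set: nat * R] theta.
  exact: (measurableT_comp mr measurable_snd).
pose mul (m : nat * R -> R) (f : nat * R -> R[i]) : nat * R -> R[i] :=
  fun p => (m p)%:C%C * f p.
(* The map [m] is the identity for the embedding and the successor for its image under
   multiplication by [theta], so one computation gives both norms. *)
pose pw (m : int -> int) (p : nat * R) := r p.2 ^ m (lev (e p.1)).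
pose lift m (f : V -> R[i]) := mul (pw m) (f \o e \o fst).
have normc_lift m f p : ComplexField.Normc.normc (lift m f p) ^+ 2 =
    (r p.2 ^ m (lev (e p.1))) ^+ 2 * ComplexField.Normc.normc (f (e p.1)) ^+ 2.
  exact: normc2_realM.
(* Squaring the half power makes the integral over the slice of [x] the moment of [nu] of order
   [m (lev x)], that is [beta (m (lev x))]. *)
have int_lift m f : (\int[rho]_p (ComplexField.Normc.normc (lift m f p) ^+ 2)%:E =
  \esum_(x in [set: V])
    (ComplexField.Normc.normc (f x) ^+ 2 * (beta (m (lev x)) / kappa_hat R kappa (lev x)))%:E)%E.
  rewrite rho_integral; last 2 first.
  - apply: measurable_fun_nat_prod => k; apply/measurable_EFinP.
    under eq_fun do rewrite normc_lift/=.
    apply: measurable_funM => //; exact: measurable_funX.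
  - by move=> p; rewrite lee_fin sqr_ge0.
  apply: eq_esum => x _.
  transitivity ((c x)%:E * ((ComplexField.Normc.normc (f x) ^+ 2)%:E *
      \int[nu]_(t in [set s : R | (0 < s)%R]) (t ^ m (lev x))%:E))%E.
    congr (_ * _)%E; rewrite -ge0_integralZl//; last 3 first.
    - by apply/measurable_EFinP; exact: measurable_exprz.
    - by move=> t /= t0; rewrite lee_fin exprz_ge0// ltW.
    - by rewrite lee_fin sqr_ge0.
    apply: eq_integral => t; rewrite inE /= => t0.
    rewrite normc_lift /= ie -EFinM mulrC; congr (_ * _)%:E.
    by rewrite /r t0 exprnP exprz_exp mulrC -exprz_exp -exprnP sqr_sqrtr ?ltW.
  by rewrite -hnu -!EFinM /c; congr (_%:E); ring.
have csq_lift m f : (\esum_(x in [set: V]) (ComplexField.Normc.normc (f x) ^+ 2 *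
    (beta (m (lev x)) / kappa_hat R kappa (lev x)))%:E < +oo)%E -> csqint rho (lift m f).
  move=> fi; apply: csqintP; last by rewrite int_lift.
    apply: measurable_fun_nat_prod => k; under eq_fun do rewrite Re_realM.
    by rewrite /pw /=; apply: measurable_funM => //; exact: mrX.
  apply: measurable_fun_nat_prod => k; under eq_fun do rewrite Im_realM.
  by rewrite /pw /=; apply: measurable_funM => //; exact: mrX.
have normE0 f : (\esum_(x in [set: V]) (ComplexField.Normc.normc (f x) ^+ 2 *
    (beta (lev x) / kappa_hat R kappa (lev x)))%:E = L2norm2 w f)%E.
  apply: eq_esum => x _; congr (_ * _)%:E.
  by rewrite (w_alpha (hlev x)) /beta mulfK// gt_eqF// kappa_hat_gt0.
have normE1 f : (\esum_(x in [set: V]) (ComplexField.Normc.normc (f x) ^+ 2 *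
    (beta (lev x + 1) / kappa_hat R kappa (lev x)))%:E = L2norm2 w (f \o phi))%E.
  rewrite -[f \o phi]/(f \o iter 1 phi) L2norm2_iter; apply: eq_esum => x _.
  by rewrite (mu_iter_preimage 1 (hlev x)) -EFinM.
have lift2 f : inL2 w f -> csqint rho (lift id f) by move=> f2; apply: csq_lift; rewrite normE0.
have rS t j : (r t)%:C%C * (r t ^ j)%:C%C = (r t ^ (j + 1))%:C%C.
  by rewrite expfzDr ?gt_eqF// expr1z rmorphM mulrC.
have theta_lift f : mul theta (lift id f) = lift (fun m => m + 1) f.
  by apply/funext => -[k t]; rewrite /lift /mul /theta /pw /= mulrA rS.
(* As [lev x = lev (phi x) + 1], the factor supplied by [theta] makes up for the level lost under
   [phi]. *)
have theta_lift_Phi f : mul theta (lift id f \o Phi) = lift id (f \o phi).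
  by apply/funext => -[k t]; rewrite /lift /mul /theta /pw /= !ie mulrA rS -lev_phi.
have [K [H [pi [N [piL piN nN Nlift]]]]] :=
  weighted_composition_normal mPhi Phi_preserving mtheta (fun=> erefl).
exists K, H, (pi \o lift id), N; split; [|split; [|split]] => //.
- move=> a f g f2 g2; rewrite /= -piL; [|exact: lift2|exact: lift2].
  by congr (pi _); apply/funext => p; rewrite /lift /mul /= mulrDr mulrCA.
- by move=> f f2; rewrite /= piN ?ipC_normc ?int_lift ?normE0//; exact: lift2.
(* The domains match: the norm of [theta] times the lift of [f] is that of [f \o phi]. *)
- move=> f f2 fphi2; rewrite /= -theta_lift_Phi; apply: Nlift; first exact: lift2.
  rewrite -[X in csqint rho X]/(mul theta (lift id f)) theta_lift.
  by apply: csq_lift; rewrite normE1.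
Qed.

End TreeCombinatorics.

Theorem theorem44 (R : realType) (V : choiceType) (E : V -> V -> Prop)
  (phi : V -> V) (w : V -> R) (G : int -> set V) (kappa : int -> nat)
  (alpha : int -> R) :
  countable [set: V] -> infinite_set [set: V] ->
  directed_tree E -> rootless E -> leafless E ->
  (forall x, E (phi x) x) ->
  (forall x, 0 < w x) ->
  (forall m n, m <> n -> G m `&` G n = set0) ->
  \bigcup_(m in [set: int]) G m = [set: V] ->
  (forall m, G (m + 1) = \bigcup_(x in G m) [set y | phi y = x]) ->
  (forall m, (0 < kappa m)%N) ->
  (forall m, 0 < alpha m) ->
  (forall m x, G m x -> ([set y | phi y = x] #= [set k : nat | (k < kappa m)%N])%card) ->
  (forall m x, G m x -> w x = alpha m) ->
  (forall f, inL2 w f -> forall e : R, 0 < e ->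
     exists g, dom_inf w phi g /\ (L2norm2 w (fun x => (f x - g x)%R) < e%:E)%E) /\
  ([<-> subnormal_Cphi w phi;
        forall f, dom_inf w phi f ->
          stieltjes_moment (fun n => L2norm2 w (f \o iter n phi));
        forall x, stieltjes_moment (fun n => h_pow w phi n x);
        two_sided_stieltjes (fun m => alpha m * kappa_hat R kappa m)]).
Proof.
move=> cV iV _ _ _ _ _ Gdisj Gcover Gsucc kappa0 alpha0 card_ch wE.
have [x0 _] : [set: V] !=set0 by exact: infinite_setN0.
split; first by move=> f f2 e e0; exact: (dom_inf_dense (G := G) (kappa := kappa) (alpha := alpha)).
split.
  (* The implication from (i) to (ii) passes through the Hankel forms and (iii); the cycle is then
     closed in the order of the statement. *)
  move=> sub f _; apply: (h_pow_moments (G := G) (alpha := alpha)) => //.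
  apply: (hankel_nonneg_h_pow (G := G) (kappa := kappa) (alpha := alpha)) => //.
  exact: (subnormal_hankel_nonneg (G := G) (phi := phi) (w := w)).
split; first exact: (moments_h_pow (G := G) (kappa := kappa) (alpha := alpha)).
split.
  move=> hp; apply: two_sided_moments.
  exact: (h_pow_hankel_nonneg (G := G) (phi := phi) (w := w)).
exact: (two_sided_subnormal (G := G)).
Qed.
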